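(* Let $k\ge 1$, let $u$ be the solution of the boundary value problem $$-\varepsilon u''+a u'+c u=f \ \text{ in } (-1,1),\qquad u(-1)=u(1)=0,$$ and let $u_N\in V^N$ be the Galerkin finite element solution of order $k$ on the piecewise equidistant mesh described in the context, i.e. $B_\varepsilon(u_N,v_N)=(f,v_N)$ for all $v_N\in V^N$. Then there is a constant $C>0$, independent of $\varepsilon$ and $N$, such that $$\|u-u_N\|_{\varepsilon}\ \le\ C\left((\mathcal K+1)N^{-1}\right)^k\ \le\ C\left(N^{-1}\ln N\right)^k .$$
   Context: **Problem and standing assumptions.** $\varepsilon\in(0,1]$ is a (small) perturbation parameter. The data $a,c,f$ are sufficiently smooth and satisfy on $[-1,1]$: $a(x)=-x\,b(x)$ with $b(x)>0$, $c(x)\ge 0$, $c(0)>0$ (simple attractive turning point at $0$). Moreover $\left(c-\tfrac12 a'\right)(x)\ge\gamma>0$ for all $x\in[-1,1]$, with a constant $\gamma$. **The exponent $\lambda$.** Put $\bar\lambda:=c(0)/|a'(0)|$. The parameter $\lambda$ satisfies $0<\lambda<\bar\lambda$ (or $\lambda=\bar\lambda$ if $\bar\lambda$ is not an integer); for such $\lambda$ the a priori bounds $|u^{(i)}(x)|\le C\left(1+(\varepsilon^{1/2}+|x|)^{\lambda-i}\right)$, $x\in[-1,1]$, are known to hold with $C$ independent of $\varepsilon$ for all derivative orders $i$ needed ($0\le i\le k+1$). It is assumed throughout that $\lambda\in(0,k+1)$. **Norms and forms.** $(\cdot,\cdot)$ and $\|\cdot\|$ are the inner product and norm of $L^2((-1,1))$,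 $|v|_1:=\|v'\|$. For $v,w\in H_0^1((-1,1))$, $$B_\varepsilon(v,w):=(\varepsilon v',w')+(av',w)+(cv,w),\qquad \|v\|_\varepsilon:=\left(\varepsilon|v|_1^2+\|v\|^2\right)^{1/2}.$$ **Mesh.** Let $N$ be a positive integer, sufficiently large (dependent on $k$), and set $$\sigma=\max\left\{\varepsilon^{(1-\lambda/(k+1))/2},\,N^{-(2k+1)}\right\},\qquad \mathcal K=\left\lfloor 1-\frac{\ln\sigma}{\ln 10}\right\rfloor .$$ It is assumed that $N/(\mathcal K+1)$ is a (positive) integer. The interval $(0,1]$ is partitioned into the $\mathcal K+1$ subintervals $(0,10^{-\mathcal K}],(10^{-\mathcal K},10^{-\mathcal K+1}],\dots,(10^{-1},1]$, and each of these is divided uniformly into $N/(\mathcal K+1)$ parts. This gives mesh points $0=x_0<x_1<\dots<x_N=1$; the mesh is extended to $[-1,0]$ by symmetry, $x_{-i}=-x_i$, so that $-1=x_{-N}<\dots<x_N=1$. **Finite element space.** $V^N$ is the space of all $v\in C([-1,1])$ with $v(-1)=v(1)=0$ whose restriction to each mesh interval $(x_{i-1},x_i)$, $i=-N+1,\dots,N$, is a polynomial of degree at most $k$. **Constants.** $C$ denotes a generic positive constant (possibly different at each occurrence) independent of $\varepsilon$ and $N$; it may depend on $a,c,f,\gamma,k,\lambda$. *)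

(* Defs.v *)
From HB Require Import structures.
From mathcomp Require Import all_boot all_order all_algebra.
From mathcomp Require Import all_classical all_reals all_analysis.

Set Implicit Arguments.
Unset Strict Implicit.
Unset Printing Implicit Defensive.

Import Order.TTheory GRing.Theory Num.Theory.
Import numFieldNormedType.Exports.

Local Open Scope classical_set_scope.
Local Open Scope ring_scope.

(* Functions on [-1,1] are represented by total functions R -> R; every notion
   below depends only on their values on [-1,1]. *)

(* C^m([-1,1]): m times differentiable in (-1,1), with f and all the derivatives
   of order at most m extending continuously to [-1,1]; the extension of f itself
   is f. *)
Definition smooth_upto (R : realType) (m : nat) (f : R -> R) : Prop :=
  {within `[-1, 1], continuous f} /\
  forall i : nat, (i <= m)%N ->
    ((i < m)%N -> forall x : R, -1 < x < 1 -> derivable (derive1n i f) x 1) /\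
    exists g : R -> R, {within `[-1, 1], continuous g} /\
      forall x : R, -1 < x < 1 -> derive1n i f x = g x.

Definition L2ip (R : realType) (v w : R -> R) : R :=
  \int[@lebesgue_measure R]_(x in `]-1, 1[) (v x * w x).

Definition L2norm (R : realType) (v : R -> R) : R := Num.sqrt (L2ip v v).

(* An element of H^1_0(-1,1) has an absolutely continuous representative v, and
   the weak derivative of v is its classical derivative, which exists almost
   everywhere.  Hence derive1 v below is the pointwise derivative; for a piecewise
   polynomial v its value at the nodes is irrelevant for the integrals. *)
Definition bilin (R : realType) (eps : R) (a c : R -> R) (v w : R -> R) : R :=
  L2ip (fun x => eps * derive1 v x) (derive1 w)
  + L2ip (fun x => a x * derive1 v x) w
  + L2ip (fun x => c x * v x) w.

Definition eps_norm (R : realType) (eps : R) (v : R -> R) : R :=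
  Num.sqrt (eps * L2norm (derive1 v) ^+ 2 + L2norm v ^+ 2).

Definition bvp_solution (R : realType) (eps : R) (a c f u : R -> R) : Prop :=
  [/\ {within `[-1, 1], continuous u},
      forall x : R, -1 < x < 1 ->
        [/\ derivable u x 1, derivable (derive1 u) x 1 &
            - eps * derive1n 2 u x + a x * derive1 u x + c x * u x = f x],
      u (-1) = 0 &
      u 1 = 0].

(* The inequality for a' is stated in the open interval, where derive1 a does not
   depend on the values of a outside [-1,1]; for a and c in C^1([-1,1]) it extends
   to the end points by continuity. *)
Definition turning_point_data (R : realType) (a b c : R -> R) (gamma : R) : Prop :=
  [/\ {within `[-1, 1], continuous b} /\
      (forall x : R, -1 <= x <= 1 -> a x = - x * b x /\ 0 < b x),
      forall x : R, -1 <= x <= 1 -> 0 <= c x,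
      0 < c 0,
      0 < gamma &
      forall x : R, -1 < x < 1 -> gamma <= c x - 2^-1 * derive1 a x].

Definition lambda_bar (R : realType) (a c : R -> R) : R := c 0 / `|derive1 a 0|.

Definition admissible_lambda (R : realType) (a c : R -> R) (k : nat) (lam : R) : Prop :=
  [/\ 0 < lam,
      lam < lambda_bar a c \/
      (lam = lambda_bar a c /\ lambda_bar a c \isn't a Num.int) &
      lam < k.+1%:R].

Definition mesh_sigma (R : realType) (k : nat) (lam eps : R) (N : nat) : R :=
  Num.max (eps `^ ((1 - lam / k.+1%:R) / 2)) (N%:R ^- (2 * k + 1)).

(* For eps <= 1 and N >= 1 one has 0 < mesh_sigma <= 1, so the argument of
   truncn is at least 1 and truncn is the integer part. *)
Definition mesh_K (R : realType) (k : nat) (lam eps : R) (N : nat) : nat :=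
  Num.truncn (1 - ln (mesh_sigma k lam eps N) / ln 10).

(* The K + 1 subintervals of (0,1] are (breakpoint K j, breakpoint K j.+1],
   j = 0, ..., K. *)
Definition breakpoint (R : realType) (K j : nat) : R :=
  if j == 0%N then 0 else 10 ^- (K.+1 - j).

(* The point x_i, 0 <= i <= N, lies in the subinterval number j = i %/ n, where
   n = N / (K + 1) is the number of mesh intervals in each of them. *)
Definition pos_mesh_point (R : realType) (K N i : nat) : R :=
  let n := (N %/ K.+1)%N in
  let j := (i %/ n)%N in
  breakpoint R K j
  + (i %% n)%N%:R / n%:R * (breakpoint R K j.+1 - breakpoint R K j).

Definition mesh_point (R : realType) (K N : nat) (i : int) : R :=
  (sgz i)%:~R * pos_mesh_point R K N `|i|%N.

Definition fe_space (R : realType) (k K N : nat) (v : R -> R) : Prop :=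
  [/\ {within `[-1, 1], continuous v},
      v (-1) = 0,
      v 1 = 0 &
      forall i : int, - N%:Z < i <= N%:Z ->
        exists p : {poly R}, (size p <= k.+1)%N /\
          forall x : R, mesh_point R K N (i - 1) < x < mesh_point R K N i ->
            v x = p.[x]].

Definition galerkin_solution (R : realType) (k K N : nat) (eps : R)
    (a c f uN : R -> R) : Prop :=
  fe_space k K N uN /\
  forall vN : R -> R, fe_space k K N vN -> bilin eps a c uN vN = L2ip f vN.

(* Main.v *)
(** The pointwise a priori bounds are replaced by weighted L^2 bounds, which are
    enough for the interpolation error and are obtained from energy estimates.
    The i-th derivative of the equation reads
    - eps v'' + a v' + (c + i a') v = (derivatives of u of order < i and data)
    for v = u^(i).  Testing it with W v, where
    W = (K eps + x^2)^p exp (beta x^2), leaves the zero order coefficient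
    (c + (i - 1/2) a' + p b)(x) + beta b(x) x^2 up to defects carrying a factor
    eps.  It is positive for large beta as soon as it is positive at 0, that is, for
    i - p < lambda_bar + 1/2, and the defects are absorbed by the bound of order
    i - 1.  The boundary terms have the good sign, because a points inwards and
    the equation of order i - 1 controls the Robin quantity - eps v' + a v at 1 and
    -1.  Fix Lam with max (lam, 1/2) <= Lam < lambda_bar + 1/2 and n = floor Lam.
    For i <= n the weight is p = 0, for i > n it is p = i - Lam.  To start the
    second range one needs the singular exponent p = n - Lam in (-1, 0] at order n;
    it becomes admissible after subtracting from u^(n) a multiple of 1 - x^2 which
    makes the right-hand side vanish at 0.

    The Galerkin error is then bounded by the energy norm of u - w for an
    interpolant w, thanks to coercivity and Galerkin orthogonality; the convection
    term costs only the weight (eps + x^2)^(1/2) in front of u' - w'.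
    On each element w matches u at the nodes and w' approximates u' like a Taylor
    polynomial; if sigma = N^-(2k+1), then w is linear in (-10^-K, 10^-K), which is so
    short that the bounds on u and (eps + x^2)^(1/2) u' suffice there. *)
Require Import Defs.
From HB Require Import structures.
From mathcomp Require Import all_boot all_order all_algebra.
From mathcomp Require Import all_classical all_reals all_analysis.
From mathcomp Require Import measurable_realfun ring lra zify.
Import Order.TTheory GRing.Theory Num.Theory.
Import numFieldNormedType.Exports.
Local Open Scope classical_set_scope.
Local Open Scope ring_scope.

Set Implicit Arguments.
Unset Strict Implicit.
Unset Printing Implicit Defensive.

(** * Calculus on an interval *)

(** The lower limit 1/2 for [Lam] comes from order 1. The bound of u' in L^1, which yields the bound
    of u itself, is drawn from the weight of exponent max (0, 1 - Lam), and the reciprocal of this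
    weight is integrable uniformly in eps only for an exponent below 1/2. The integer n must stay
    strictly below lambda_bar because the correction at order n divides by a quantity whose limit
    for small eps is c(0) - n b(0); this is where an integer value lam = lambda_bar has to be
    excluded.

    The obstacle is the passage from n to n + 1. The defect at order i with exponent p is the
    eps-part of an energy of order i - 1 with exponent p - 1. For i = n + 1 this exponent is n -
    Lam, which may lie below -1/2, so that a bounded right-hand side is no longer integrable against
    the weight. A right-hand side vanishing at 0 is Hoelder continuous of exponent 1/2 there, and
    its square gains a factor |x|, just enough for every exponent above -1.

    On the mesh, sigma^(2(k+1)) = eps^(k+1-lam) unless sigma = N^-(2k+1). The inner elements thus
    only need a bound of eps^(k+1-lam) |u^(k+1)|^2 in L^1. *)

(* Records, so that unification does not unfold ctn and drv. *)
Record ctn (R : realType) (l r : R) (f : R -> R) : Prop :=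
  Ctn { ctnP : {within `[l, r], continuous f} }.

Record drv (R : realType) (l r : R) (f df : R -> R) : Prop :=
  Drv { drvP : forall x : R, l < x < r -> is_derive x 1 f (df x) }.

Definition itgbl (R : realType) (l r : R) (f : R -> R) : Prop :=
  (@lebesgue_measure R).-integrable `]l, r[ (EFin \o f).

Definition itg (R : realType) (l r : R) (f : R -> R) : R :=
  \int[@lebesgue_measure R]_(x in `]l, r[) f x.

Section Calculus.
Context {R : realType}.
Implicit Types (l r x y : R) (f g h : R -> R).

Lemma ctn_cts l r f : continuous f -> ctn l r f.
Proof. by move=> cf; split; exact: continuous_subspaceT. Qed.

Lemma ctn_cst l r (c : R) : ctn l r (fun=> c).
Proof. by apply: ctn_cts => x; exact: cvg_cst. Qed.

Lemma ctn_id l r : ctn l r (fun x => x).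
Proof. by apply: ctn_cts => x; exact: cvg_id. Qed.

Lemma ctnD l r f g : ctn l r f -> ctn l r g -> ctn l r (fun x => f x + g x).
Proof. by move=> [cf] [cg]; split => x; apply: continuousD; [exact: cf|exact: cg]. Qed.

Lemma ctnN l r f : ctn l r f -> ctn l r (fun x => - f x).
Proof. by move=> [cf]; split => x; apply: continuousN; exact: cf. Qed.

Lemma ctnM l r f g : ctn l r f -> ctn l r g -> ctn l r (fun x => f x * g x).
Proof. by move=> [cf] [cg]; split => x; apply: continuousM; [exact: cf|exact: cg]. Qed.

Lemma ctnX l r f n : ctn l r f -> ctn l r (fun x => f x ^+ n).
Proof.
move=> cf; elim: n => [|n ihn]; first exact: ctn_cst.
have -> : (fun x => f x ^+ n.+1) = (fun x => f x * f x ^+ n).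
  by apply/funext => x; rewrite exprS.
exact: ctnM.
Qed.

Lemma ctn_sum l r (n : nat) (F : nat -> R -> R) :
  (forall i, (i < n)%N -> ctn l r (F i)) ->
  ctn l r (fun x => \sum_(i < n) F i x).
Proof.
elim: n => [|n ihn] cF.
  by rewrite (_ : (fun _ => _) = fun=> 0); [exact: ctn_cst|
    apply/funext => x; rewrite big_ord0].
rewrite (_ : (fun _ => _) = fun x => \sum_(i < n) F i x + F n x); last first.
  by apply/funext => x; rewrite big_ord_recr.
by apply: ctnD; [apply: ihn => i /ltnW; exact: cF|exact: cF].
Qed.

Lemma ctn_expR l r f : ctn l r f -> ctn l r (fun x => expR (f x)).
Proof.
by move=> [cf]; split => x; apply: (@continuous_comp (subspace `[l, r]) R R f expR x);
  [exact: cf|exact: continuous_expR].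
Qed.

Lemma ctn_abs l r f : ctn l r f -> ctn l r (fun x => `|f x|).
Proof.
by move=> [cf]; split => x; apply: (@continuous_comp (subspace `[l, r]) R R f Num.norm x);
  [exact: cf|exact: norm_continuous].
Qed.

Lemma ctn_horner l r (p : {poly R}) : ctn l r (horner p).
Proof. by apply: ctn_cts; exact: continuous_horner. Qed.

Lemma ctn_sub l r l' r' f : l <= l' -> r' <= r -> ctn l r f -> ctn l' r' f.
Proof.
move=> ll rr [cf]; split; apply: continuous_subspaceW cf => x /=; rewrite !in_itv/=.
by move=> /andP[? ?]; apply/andP; split; [exact: le_trans ll _|exact: le_trans rr].
Qed.

Lemma eq_ctn l r f g : (forall x, l <= x <= r -> f x = g x) ->
  ctn l r f -> ctn l r g.
Proof.
move=> fg [cf]; split; apply: subspace_eq_continuous cf => x; rewrite inE/= in_itv/=; exact: fg.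
Qed.

Lemma ctn_bounded l r f : ctn l r f ->
  exists2 M : R, 0 <= M & forall x, l <= x <= r -> `|f x| <= M.
Proof.
move=> cf; have [lr|rl] := leP l r; last first.
  exists 0 => // x /andP[lx xr].
  by have := lt_le_trans rl (le_trans lx xr); rewrite ltxx.
have [c _ Hc] := EVT_max lr (ctnP (ctn_abs cf)).
exists `|f c| => // x xlr; apply: Hc; by rewrite in_itv.
Qed.

Lemma drvD l r f g df dg : drv l r f df -> drv l r g dg ->
  drv l r (fun x => f x + g x) (fun x => df x + dg x).
Proof. by move=> [hf] [hg]; split => x xlr; exact: (is_deriveD (hf x xlr) (hg x xlr)). Qed.

Lemma drvN l r f df : drv l r f df -> drv l r (fun x => - f x) (fun x => - df x).
Proof. by move=> [hf]; split => x xlr; exact: (is_deriveN (hf x xlr)). Qed.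

Lemma drvM l r f g df dg : drv l r f df -> drv l r g dg ->
  drv l r (fun x => f x * g x) (fun x => df x * g x + f x * dg x).
Proof.
move=> [hf] [hg]; split => x xlr; apply: is_derive_eq (is_deriveM (hf x xlr) (hg x xlr)) _.
by rewrite addrC /= ![_ *: _]/GRing.scale/= mulrC.
Qed.

Lemma drv_cst l r (c : R) : drv l r (fun=> c) (fun=> 0).
Proof. by split => x _; exact: is_derive_cst. Qed.

Lemma drv_id l r : drv l r (fun x => x) (fun=> 1).
Proof. by split => x _; exact: is_derive_id. Qed.

Lemma eq_drv l r f df dg : drv l r f df ->
  (forall x, l < x < r -> df x = dg x) -> drv l r f dg.
Proof. by move=> [hf] e; split => x xlr; rewrite -e//; exact: hf. Qed.

Lemma drvZ l r (c : R) f df : drv l r f df ->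
  drv l r (fun x => c * f x) (fun x => c * df x).
Proof.
move=> hf; apply: eq_drv (drvM (drv_cst l r c) hf) _ => x _ /=.
by rewrite mul0r add0r.
Qed.

Lemma drvX l r f df n : drv l r f df ->
  drv l r (fun x => f x ^+ n) (fun x => n%:R * f x ^+ n.-1 * df x).
Proof.
move=> hf; elim: n => [|n ihn].
  have -> : (fun x => f x ^+ 0) = (fun=> 1) by apply/funext => x.
  by apply: eq_drv (drv_cst l r 1) _ => x _; rewrite !mul0r.
have -> : (fun x => f x ^+ n.+1) = (fun x => f x * f x ^+ n).
  by apply/funext => x; rewrite exprS.
apply: eq_drv (drvM hf ihn) _ => x _ /=; case: n {ihn} => [|n] /=.
  by rewrite !expr0; ring.
by rewrite exprS -[n.+2]add1n natrD; ring.
Qed.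

Lemma drv_sum l r (n : nat) (F dF : nat -> R -> R) :
  (forall i, (i < n)%N -> drv l r (F i) (dF i)) ->
  drv l r (fun x => \sum_(i < n) F i x) (fun x => \sum_(i < n) dF i x).
Proof.
elim: n => [|n ihn] cF.
  have -> : (fun x => \sum_(i < 0) F i x) = fun=> 0.
    by apply/funext => x; rewrite big_ord0.
  by apply: eq_drv (drv_cst _ _ _) _ => x _; rewrite big_ord0.
have -> : (fun x => \sum_(i < n.+1) F i x) = fun x => \sum_(i < n) F i x + F n x.
  by apply/funext => x; rewrite big_ord_recr.
have hn : drv l r (fun x => \sum_(i < n) F i x) (fun x => \sum_(i < n) dF i x).
  by apply: ihn => i /ltnW; exact: cF.
by apply: eq_drv (drvD hn (cF n (ltnSn n))) _ => x _; rewrite big_ord_recr.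
Qed.

Lemma drv_expR l r f df : drv l r f df ->
  drv l r (fun x => expR (f x)) (fun x => df x * expR (f x)).
Proof.
move=> [hf]; split => x xlr; rewrite mulrC.
exact: (is_derive1_comp (is_derive_expR (f x)) (hf x xlr)).
Qed.

Lemma drv_ln l r f df : (forall x, l < x < r -> 0 < f x) -> drv l r f df ->
  drv l r (fun x => ln (f x)) (fun x => df x / f x).
Proof.
move=> f0 [hf]; split => x xlr; rewrite mulrC.
exact: (is_derive1_comp (is_derive1_ln (f0 x xlr)) (hf x xlr)).
Qed.

Lemma drv_horner l r (p : {poly R}) : drv l r (horner p) (horner p^`()).
Proof. by split => x _; exact: is_derive_poly. Qed.

Lemma drv_sub l r l' r' f df : l <= l' -> r' <= r ->
  drv l r f df -> drv l' r' f df.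
Proof.
move=> ll rr [hf]; split => x /andP[lx xr]; apply: hf.
by rewrite (le_lt_trans ll lx) (lt_le_trans xr rr).
Qed.

Lemma drv_ext l r f g df : (forall x, l < x < r -> f x = g x) ->
  drv l r f df -> drv l r g df.
Proof.
move=> fg [hf]; split => x xlr.
have fgx : \near x, f x = g x.
  have /near_in_itvoo : x \in `]l, r[ by rewrite in_itv.
  by apply: filterS => y; rewrite in_itv => /fg.
have [dfx e] := hf x xlr; split; first exact: near_eq_derivable fgx dfx.
by rewrite -e; apply/esym/near_eq_derive.
Qed.

Lemma ctn_ln l r f : (forall x, 0 < f x) -> ctn l r f ->
  ctn l r (fun x => ln (f x)).
Proof.
move=> f0 [cf]; split => x; apply: (@continuous_comp (subspace `[l, r]) R R f (@ln R) x).
  exact: cf.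
by apply: continuous_ln; exact: f0.
Qed.

Lemma ctnV l r f : (forall x, f x != 0) -> ctn l r f ->
  ctn l r (fun x => (f x)^-1).
Proof. by move=> f0 [cf]; split => x; apply: continuousV; [exact: f0|exact: cf]. Qed.

Lemma drv_derive1 l r f df : drv l r f df ->
  forall x, l < x < r -> derivable f x 1 /\ derive1 f x = df x.
Proof. by move=> [hf] x /hf [d e]; split => //; rewrite derive1E. Qed.

End Calculus.

(** * Integrals over open intervals and the fundamental theorem *)

Section Integral.
Context {R : realType}.
Implicit Types (l r m x y c : R) (f g h F : R -> R).
Local Notation mu := (@lebesgue_measure R).

Lemma ctn_itgbl l r f : ctn l r f -> itgbl l r f.
Proof.
move=> [cf]; have : mu.-integrable `[l, r] (EFin \o f).
  by apply: continuous_compact_integrable => //; exact: segment_compact.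
by apply: integrableS => //; exact: subset_itv_oo_cc.
Qed.

Lemma eq_itgbl l r f g : itgbl l r f ->
  (forall x, l < x < r -> f x = g x) -> itgbl l r g.
Proof.
move=> + fg; apply: eq_integrable => // x; rewrite inE/= in_itv/= => /fg.
by move=> ->.
Qed.

Lemma eq_itg l r f g : (forall x, l < x < r -> f x = g x) ->
  itg l r f = itg l r g.
Proof.
by move=> fg; apply: eq_Rintegral => x; rewrite inE/= in_itv/= => /fg.
Qed.

Lemma itgblD l r f g : itgbl l r f -> itgbl l r g ->
  itgbl l r (fun x => f x + g x).
Proof. by move=> hf hg; exact: (integrableD _ hf hg). Qed.

Lemma itgblZ l r c f : itgbl l r f -> itgbl l r (fun x => c * f x).
Proof. by move=> hf; exact: (integrableZl _ c hf). Qed.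

Lemma itgbl_cst l r c : itgbl l r (fun=> c).
Proof. exact/ctn_itgbl/ctn_cst. Qed.

Lemma itgbl_sub l r l' r' f : l <= l' -> r' <= r ->
  itgbl l r f -> itgbl l' r' f.
Proof.
move=> ll rr; apply: integrableS => // x /=; rewrite !in_itv/=.
by move=> /andP[? ?]; apply/andP; split;
  [exact: le_lt_trans ll _|exact: lt_le_trans rr].
Qed.

Lemma itgD l r f g : itgbl l r f -> itgbl l r g ->
  itg l r (fun x => f x + g x) = itg l r f + itg l r g.
Proof. by move=> hf hg; exact: RintegralD. Qed.

Lemma itgZ l r c f : itgbl l r f -> itg l r (fun x => c * f x) = c * itg l r f.
Proof. by move=> hf; exact: RintegralZl. Qed.

Lemma itg_le l r f g : itgbl l r f -> itgbl l r g ->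
  (forall x, l < x < r -> f x <= g x) -> itg l r f <= itg l r g.
Proof.
by move=> hf hg fg; apply: le_Rintegral => // x /=; rewrite in_itv/=; exact: fg.
Qed.

Lemma itg_ge0 l r f : (forall x, l < x < r -> 0 <= f x) -> 0 <= itg l r f.
Proof. by move=> f0; apply: Rintegral_ge0 => x /=; rewrite in_itv/=; exact: f0. Qed.

Lemma itg_cst l r c : l <= r -> itg l r (fun=> c) = c * (r - l).
Proof.
move=> lr; rewrite /itg Rintegral_cst//= lebesgue_measure_itv/= lte_fin.
case: ltP => //= rl.
by rewrite (_ : r = l) ?subrr//; apply/eqP; rewrite eq_le rl lr.
Qed.

Lemma itg_empty l f : itg l l f = 0.
Proof. by rewrite /itg set_itvoo0 Rintegral_set0. Qed.

Lemma ftc l r F f : l <= r -> ctn l r F -> ctn l r f -> drv l r F f ->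
  itg l r f = F r - F l.
Proof.
rewrite le_eqVlt => /predU1P[<-|lr cF cf dF]; first by rewrite itg_empty subrr.
rewrite /itg.
have fi := ctn_itgbl cf.
have fi2 : mu.-integrable `]l, r] (EFin \o f).
  have : mu.-integrable `[l, r] (EFin \o f).
    apply: continuous_compact_integrable => //; first exact: segment_compact.
    exact: ctnP.
  by apply: integrableS => //; exact: subset_itv_oc_cc.
rewrite Rintegral_itv_bndo_bndc// Rintegral_itv_obnd_cbnd//.
rewrite /Rintegral (@continuous_FTC2 _ f F)//.
- exact: ctnP.
- have [_ c1 c2] := (continuous_within_itvP F lr).1 (ctnP cF).
  by split => // x; rewrite in_itv/= => /(drvP dF) [].
- by move=> x; rewrite in_itv/= => /(drv_derive1 dF) [].
Qed.

Lemma integrable_disjointU (A B : set R) f : measurable A -> measurable B ->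
  [disjoint A & B] -> mu.-integrable A (EFin \o f) ->
  mu.-integrable B (EFin \o f) -> mu.-integrable (A `|` B) (EFin \o f).
Proof.
move=> mA mB AB /integrableP[m1 i1] /integrableP[m2 i2].
apply/integrableP; split; first exact/measurable_funU.
rewrite ge0_integral_setU//; first exact: lte_add_pinfty.
apply: measurableT_comp => //.
exact/measurable_funU.
Qed.

Lemma itgbl_cat l m r f : l <= m -> m <= r -> itgbl l m f -> itgbl m r f ->
  itgbl l r f.
Proof.
rewrite le_eqVlt => /predU1P[<-//|lm].
rewrite le_eqVlt => /predU1P[<-//|mr] h1 h2.
(* The two open intervals miss the point [m]; it is added to the left one as a null set. *)
have h3 : mu.-integrable `]l, m] (EFin \o f).
  rewrite -(@setUitv1 _ _ (BRight l) m true)//.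
  apply: integrable_disjointU => //.
    by apply/disj_setPS => x [/= + xm]; rewrite in_itv/= xm ltxx andbF.
  apply/integrableP; split; first exact: measurable_fun_set1.
  by rewrite integral_set1.
have -> : itgbl l r f = mu.-integrable (`]l, m] `|` `]m, r[) (EFin \o f).
  rewrite /itgbl; congr (mu.-integrable _ _).
  by rewrite -itv_bndbnd_setU// ?bnd_simp ?ltW.
apply: integrable_disjointU => //.
by apply/disj_setPS => x [/=]; rewrite !in_itv/= => /andP[_ h] /andP[]; rewrite ltNge h.
Qed.

Lemma itg_cat l m r f : l <= m -> m <= r -> itgbl l r f ->
  itg l r f = itg l m f + itg m r f.
Proof.
move=> lm mr hf; rewrite /itg.
have [<-|lm'] := eqVneq l m; first by rewrite set_itvoo0 Rintegral_set0 add0r.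
have [mr'|mr'] := eqVneq m r; first by rewrite mr' set_itvoo0 Rintegral_set0 addr0.
have {}lm : l < m by rewrite lt_neqAle lm' lm.
have {}mr : m < r by rewrite lt_neqAle mr' mr.
have := @Rintegral_itvB _ f (BRight l) (BLeft r) m hf.
rewrite !bnd_simp => /(_ (ltW lm) mr) <-.
rewrite -(@Rintegral_itv_bndo_bndc _ (BRight l) m f) ?subrKC//.
exact: (itgbl_sub (lexx _) (ltW mr) hf).
Qed.

Lemma itg_sub_le l r l' r' f : l <= l' -> l' <= r' -> r' <= r -> itgbl l r f ->
  (forall x, l < x < r -> 0 <= f x) -> itg l' r' f <= itg l r f.
Proof.
move=> ll lr rr hf f0.
rewrite (@itg_cat l l' r)// ?(le_trans lr)//.
rewrite (@itg_cat l' r' r)//; last exact: itgbl_sub hf.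
have h1 : 0 <= itg l l' f.
  apply: itg_ge0 => x /andP[lx xl]; apply: f0; rewrite lx/=.
  by rewrite (lt_le_trans xl)// (le_trans lr).
have h2 : 0 <= itg r' r f.
  apply: itg_ge0 => x /andP[lx xl]; apply: f0; rewrite xl andbT.
  by rewrite (le_lt_trans _ lx)// (le_trans ll).
lra.
Qed.

Lemma antiderivative l r f : l < r -> ctn l r f ->
  exists F, ctn l r F /\ drv l r F f.
Proof.
move=> lr cf.
have fi : mu.-integrable `[l, r] (EFin \o f).
  apply: continuous_compact_integrable => //; first exact: segment_compact.
  exact: ctnP.
exists (fun x => \int[mu]_(t in `[l, x]) f t); split; first split.
  exact: (@parameterized_integral_continuous R l r f (ltW lr) fi).
split => x /andP[lx xr].
have cfx : {for x, continuous f}.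
  have [c1 _ _] := (continuous_within_itvP f lr).1 (ctnP cf).
  by apply: c1; rewrite in_itv/= lx.
have [d1 d2] := continuous_FTC1_closed xr fi lx cfx.
split; first exact: d1.
by rewrite -derive1E; exact: d2.
Qed.

End Integral.

(** * Piecewise continuous functions on a partition *)

Definition nodes (R : realType) (t : nat -> R) (n : nat) : Prop :=
  forall i, (i < n)%N -> t i < t i.+1.

(** Nothing is asked at the nodes, where [derive1] of a piecewise polynomial carries no information.
    The continuous extension to each closed element provides integrability. *)
Definition pwc (R : realType) (t : nat -> R) (n : nat) (f : R -> R) : Prop :=
  forall i, (i < n)%N -> exists g, ctn (t i) (t i.+1) g /\
    forall x, t i < x < t i.+1 -> f x = g x.

Section Piecewise.
Context {R : realType}.
Implicit Types (t : nat -> R) (n : nat) (f g F : R -> R).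

Lemma nodes_le t n i j : nodes t n -> (i <= j)%N -> (j <= n)%N -> t i <= t j.
Proof.
move=> ht; elim: j => [|j ihj]; first by rewrite leqn0 => /eqP ->.
rewrite leq_eqVlt => /predU1P[->//|]; rewrite ltnS => ij jn.
exact: le_trans (ihj ij (ltnW jn)) (ltW (ht _ jn)).
Qed.

Lemma nodesS t n : nodes t n.+1 -> nodes t n.
Proof. by move=> ht i /ltnW; exact: ht. Qed.

Lemma pwcS t n f : pwc t n.+1 f -> pwc t n f.
Proof. by move=> ht i /ltnW; exact: ht. Qed.

Lemma pwc_itgbl t n f : nodes t n -> pwc t n f -> itgbl (t 0%N) (t n) f.
Proof.
elim: n => [|n ihn] ht hf.
  by rewrite /itgbl set_itvoo0; exact: integrable_set0.
apply: (@itgbl_cat _ (t 0%N) (t n)); first exact: nodes_le (nodesS ht) _ _.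
- exact/ltW/ht.
- exact: ihn (nodesS ht) (pwcS hf).
- have [g [cg fg]] := hf n (ltnSn n).
  by apply: eq_itgbl (ctn_itgbl cg) _ => x /fg.
Qed.

Lemma itg_sum t n f : nodes t n -> itgbl (t 0%N) (t n) f ->
  itg (t 0%N) (t n) f = \sum_(i < n) itg (t i) (t i.+1) f.
Proof.
elim: n => [|n ihn] ht hf; first by rewrite big_ord0 itg_empty.
have h0 : t 0%N <= t n by exact: nodes_le (nodesS ht) _ _.
have h1 : t n <= t n.+1 by exact/ltW/ht.
rewrite big_ord_recr/= -ihn; [exact: itg_cat|exact: nodesS|].
exact: itgbl_sub hf.
Qed.

Lemma pwcD t n f g : pwc t n f -> pwc t n g -> pwc t n (fun x => f x + g x).
Proof.
move=> hf hg i ni; have [f' [cf ef]] := hf i ni; have [g' [cg eg]] := hg i ni.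
exists (fun x => f' x + g' x); split; first exact: ctnD.
by move=> x xi; rewrite ef// eg.
Qed.

Lemma pwcM t n f g : pwc t n f -> pwc t n g -> pwc t n (fun x => f x * g x).
Proof.
move=> hf hg i ni; have [f' [cf ef]] := hf i ni; have [g' [cg eg]] := hg i ni.
exists (fun x => f' x * g' x); split; first exact: ctnM.
by move=> x xi; rewrite ef// eg.
Qed.

Lemma ctn_pwc t n f : nodes t n -> ctn (t 0%N) (t n) f -> pwc t n f.
Proof.
move=> ht cf i ni; exists f; split => //.
by apply: ctn_sub cf; [exact: nodes_le ht _ (ltnW ni)|exact: nodes_le ht ni _].
Qed.

Lemma pwc_cst t n (c : R) : nodes t n -> pwc t n (fun=> c).
Proof. by move=> ht; apply: ctn_pwc => //; exact: ctn_cst. Qed.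

Lemma pwcX t n f (m : nat) : nodes t n -> pwc t n f ->
  pwc t n (fun x => f x ^+ m).
Proof.
move=> ht hf i ni; have [f' [cf ef]] := hf i ni.
exists (fun x => f' x ^+ m); split; first exact: ctnX.
by move=> x xi; rewrite ef.
Qed.

Lemma eq_pwc t n f g : (forall i, (i < n)%N ->
    forall x, t i < x < t i.+1 -> f x = g x) -> pwc t n f -> pwc t n g.
Proof.
move=> fg hf i ni; have [f' [cf ef]] := hf i ni; exists f'; split => //.
by move=> x xi; rewrite -(fg i)// ef.
Qed.

(** Continuity of [F] across the nodes lets the contributions of the elements telescope. This is the
    form of integration by parts available for finite element functions, whose derivatives jump. *)
Lemma ftc_pw t n F f : nodes t n -> ctn (t 0%N) (t n) F -> pwc t n f ->
  (forall i, (i < n)%N -> drv (t i) (t i.+1) F f) ->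
  itg (t 0%N) (t n) f = F (t n) - F (t 0%N).
Proof.
move=> ht cF hf dF; rewrite itg_sum//; last exact: pwc_itgbl.
transitivity (\sum_(i < n) (F (t i.+1) - F (t i))); last first.
  by rewrite -(big_mkord xpredT (fun i => F (t i.+1) - F (t i))) telescope_sumr.
apply: eq_bigr => -[i ni] _ /=; have [g [cg fg]] := hf i ni.
rewrite (eq_itg fg); apply: ftc => //; first exact/ltW/ht.
- by apply: ctn_sub cF; [exact: nodes_le ht _ (ltnW ni)|exact: nodes_le ht ni _].
- by apply: eq_drv (dF i ni) _ => x /fg.
Qed.

Lemma ctn_cat (l m r : R) f : l <= m -> m <= r ->
  ctn l m f -> ctn m r f -> ctn l r f.
Proof.
move=> lm mr [c1] [c2]; split.
rewrite (_ : `[l, r]%classic = `[l, m] `|` `[m, r]).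
  by apply: withinU_continuous => //; exact: itv_closed.
apply/seteqP; split => x /=; rewrite !in_itv/=.
  by move=> /andP[-> ->]; rewrite andbT/=; apply/orP; exact: le_total.
move=> [/andP[-> xm]|/andP[mx ->]]; first by rewrite (le_trans xm).
by rewrite (le_trans lm).
Qed.

Lemma glue t n (q : nat -> R -> R) : nodes t n.+1 ->
  (forall i, (i <= n)%N -> ctn (t i) (t i.+1) (q i)) ->
  (forall i, (i < n)%N -> q i (t i.+1) = q i.+1 (t i.+1)) ->
  exists w, ctn (t 0%N) (t n.+1) w /\
    forall i, (i <= n)%N -> forall x, t i <= x <= t i.+1 -> w x = q i x.
Proof.
elim: n => [|n ihn] ht cq eq.
  exists (q 0%N); split; first exact: cq.
  by move=> i; rewrite leqn0 => /eqP ->.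
have [||w [cw ew]] := ihn (nodesS ht).
- by move=> i ni; apply: cq; exact: leqW.
- by move=> i ni; apply: eq; exact: leqW.
have t0 : t 0%N <= t n.+1 by exact: nodes_le (nodesS ht) _ _.
have t1 : t n.+1 <= t n.+2 by exact/ltW/ht.
have en : w (t n.+1) = q n.+1 (t n.+1).
  by rewrite (ew n)// ?eq// lexx andbT ltW// ht// ltnW.
exists (fun x => if x <= t n.+1 then w x else q n.+1 x); split.
  apply: (@ctn_cat _ (t n.+1)) => //.
    by apply: eq_ctn cw => x /andP[_ ->].
  apply: eq_ctn (cq n.+1 (leqnn _)) => x /andP[x1 _].
  by case: ifPn => // x2; have -> : x = t n.+1 by apply/eqP; rewrite eq_le x1 x2.
move=> i; rewrite leq_eqVlt => /predU1P[->|] => [x /andP[x1 _]|ni x /andP[x1 x2]].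
  by case: ifPn => // x2; have -> : x = t n.+1 by apply/eqP; rewrite eq_le x1 x2.
rewrite (le_trans x2); first by apply: ew => //; rewrite x1.
by apply: nodes_le (nodesS ht) _ _.
Qed.

End Piecewise.

(** * Weighted energy estimates *)

(* The j-th component of a sequence stands for the j-th derivative; jmul is
   Leibniz' rule, so that the third clause of sol is the equation differentiated
   i times. *)
Definition jet (R : realType) (m : nat) (F : nat -> R -> R) : Prop :=
  (forall j, (j <= m)%N -> ctn (-1) 1 (F j)) /\
  forall j, (j < m)%N -> drv (-1) 1 (F j) (F j.+1).

Definition jmul (R : realType) (F G : nat -> R -> R) (r : nat) (x : R) : R :=
  \sum_(s < r.+1) 'C(r, s)%:R * (F s x * G (r - s)%N x).

Definition sol (R : realType) (A C F : nat -> R -> R) (m : nat) (eps : R)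
    (V : nat -> R -> R) : Prop :=
  [/\ 0 < eps <= 1, jet m V,
     forall i, (i.+2 <= m)%N -> forall x, -1 <= x <= 1 ->
       eps * V i.+2 x = jmul A (fun j => V j.+1) i x + jmul C V i x - F i x,
     V 0%N (-1) = 0 & V 0%N 1 = 0].

(** * Derivatives up to the boundary and the differentiated equation *)

Section Jets.
Context {R : realType}.
Implicit Types (x y : R) (f g : R -> R) (F G A C V : nat -> R -> R).

Lemma jet_leq m p F : (p <= m)%N -> jet m F -> jet p F.
Proof.
move=> pm [h1 h2]; split => j jp; first by apply: h1; exact: leq_trans pm.
by apply: h2; exact: leq_trans pm.
Qed.

Lemma jetS m F : jet m.+1 F -> jet m (fun j => F j.+1).
Proof. by move=> [h1 h2]; split => j jm; [exact: h1|exact: h2]. Qed.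

Lemma ctn_jmul m F G r : (r <= m)%N -> jet m F -> jet m G ->
  ctn (-1) 1 (jmul F G r).
Proof.
move=> rm [hF _] [hG _].
apply: (@ctn_sum _ _ _ _ (fun s x => 'C(r, s)%:R * (F s x * G (r - s)%N x))).
move=> i ir; apply: ctnM; first exact: ctn_cst.
by apply: ctnM; [apply: hF|apply: hG]; apply: leq_trans rm; rewrite ?leq_subr.
Qed.

(** Differentiating each product gives two sums; after a shift of the index in one of them, Pascal's
    rule recombines the binomial coefficients. *)
Lemma drv_jmul m F G r : (r < m)%N -> jet m F -> jet m G ->
  drv (-1) 1 (jmul F G r) (jmul F G r.+1).
Proof.
move=> rm [_ hF] [_ hG].
have h : drv (-1) 1 (jmul F G r) (fun x => \sum_(s < r.+1)
    ('C(r, s)%:R * (F s.+1 x * G (r - s)%N x + F s x * G (r - s).+1 x))).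
  apply: (@drv_sum _ _ _ _ (fun s x => 'C(r, s)%:R * (F s x * G (r - s)%N x))
    (fun s x => 'C(r, s)%:R *
      (F s.+1 x * G (r - s)%N x + F s x * G (r - s).+1 x))).
  move=> i ir; apply: drvZ; apply: drvM.
    by apply: hF; exact: leq_ltn_trans rm.
  by apply: hG; apply: leq_ltn_trans rm; exact: leq_subr.
apply: eq_drv h _ => x _; rewrite /jmul.
under eq_bigr do rewrite mulrDr; rewrite big_split/= addrC.
rewrite [RHS]big_ord_recl/= bin0 subn0.
under [in RHS]eq_bigr do
  rewrite /bump/= add1n subSS binS natrD mulrDl.
rewrite [in RHS]big_split/= [in LHS]big_ord_recl/= bin0 subn0 -addrA.
congr (_ + _); congr (_ + _).
rewrite [in RHS]big_ord_recr/= bin_small// mul0r addr0.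
by apply: eq_bigr => i _; rewrite /bump/= add1n subnSK.
Qed.

(** The components are the continuous extensions of the derivatives, which may differ from
    [derive1n] at the end points. At order 0 the function itself is taken. *)
Lemma smooth_jet m f : smooth_upto m f -> exists F, jet m F /\ F 0%N = f.
Proof.
move=> [cf hf].
have hg j : exists g, (j <= m)%N -> [/\ ctn (-1) 1 g,
    (forall x, -1 < x < 1 -> derive1n j f x = g x) & j = 0%N -> g = f].
  case: j => [|j]; first by exists f => _; split => //; split.
  have [jm|mj] := leqP j.+1 m; last by exists f.
  have [_ [g [cg eg]]] := hf _ jm.
  by exists g => _; split => //; split.
have [F hF] := choice hg.
exists F; split; last by have [] := hF 0%N (leq0n m) => _ _ ->.
split => j jm; first by have [] := hF j jm.
have [_ ej _] := hF j (ltnW jm); have [_ ej1 _] := hF j.+1 jm.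
apply: (@drv_ext _ _ _ (derive1n j f)) => //.
split => x xI; have [/(_ jm x xI) d _] := hf j (ltnW jm).
by rewrite -ej1// derive1nS derive1E; exact: derivableP.
Qed.

Lemma drv0_cst (l r : R) f : drv l r f (fun=> 0) ->
  forall x y, l < x < r -> l < y < r -> f x = f y.
Proof.
move=> df.
have main x y : l < x < r -> l < y < r -> x <= y -> f x = f y.
  move=> /andP[lx xr] /andP[ly yr] xy.
  have cf : ctn x y f.
    split; apply: derivable_within_continuous => z; rewrite in_itv/= => /andP[xz zy].
    have zI : l < z < r by rewrite (lt_le_trans lx)//= (le_lt_trans zy).
    by have [] := drvP df zI.
  have := ftc xy cf (ctn_cst x y 0) (drv_sub (ltW lx) (ltW yr) df).
  by rewrite itg_cst// mul0r => /esym/eqP; rewrite subr_eq0 => /eqP.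
move=> x y hx hy; have [xy|/ltW yx] := leP x y; first exact: main.
exact/esym/main.
Qed.

Lemma eq_jmul F G G' r x : (forall j, (j <= r)%N -> G j x = G' j x) ->
  jmul F G r x = jmul F G' r x.
Proof. by move=> e; apply: eq_bigr => i _; rewrite e// leq_subr. Qed.

Lemma jmul0 F G x : jmul F G 0 x = F 0%N x * G 0%N x.
Proof. by rewrite /jmul big_ord1/= bin0 mul1r. Qed.

(** A solution is only assumed continuous on [-1,1] and twice differentiable inside. An integrating
    factor shows that u' extends continuously to the end points; the equation then defines all
    further derivatives. The argument is qualitative, so dividing by [eps] does no harm here. *)
Lemma sol_exists m A C F eps u : jet m A -> jet m C -> jet m F ->
  0 < eps <= 1 -> bvp_solution eps (A 0%N) (C 0%N) (F 0%N) u ->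
  exists V, sol A C F m.+2 eps V /\ V 0%N = u.
Proof.
move=> jA jC jF eps01 [cu hu um1 u1].
have /andP[eps0 _] := eps01.
have cu' : ctn (-1) 1 u by split.
have m11 : (-1 : R) < 1 by lra.
pose rhs x := (C 0%N x * u x - F 0%N x) / eps.
have [P [cP dP]] : exists P, ctn (-1) 1 P /\
    drv (-1) 1 P (fun x => eps^-1 * A 0%N x).
  by apply: antiderivative => //; apply: ctnM; [exact: ctn_cst|exact: jA.1].
have crhs : ctn (-1) 1 rhs.
  apply: ctnM; last exact: ctn_cst.
  by apply: ctnD; [apply: ctnM => //; exact: jC.1|apply: ctnN; exact: jF.1].
have [Q [cQ dQ]] : exists Q, ctn (-1) 1 Q /\
    drv (-1) 1 Q (fun x => expR (- P x) * rhs x).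
  by apply: antiderivative => //; apply: ctnM => //; apply/ctn_expR/ctnN.
have du : drv (-1) 1 u (derive1 u).
  by split => x /hu [d _ _]; rewrite derive1E; exact: derivableP.
have d2u : drv (-1) 1 (derive1 u) (fun x => (A 0%N x * derive1 u x) / eps + rhs x).
  split => x xI; have [_ d e] := hu x xI.
  have -> : A 0%N x * derive1 u x / eps + rhs x = 'D_1 (derive1 u) x.
    rewrite -derive1E -[derive1 (derive1 u) x]/(derive1n 2 u x) /rhs.
    by rewrite -e; field; rewrite gt_eqF.
  exact: derivableP.
(* With P' = a / eps, the equation says that exp(-P) u' has the continuous derivative exp(-P) (c u -
   f) / eps = Q'. Hence exp(-P) u' - Q is constant, and solving for u' gives the extension [U1]. *)
have dz : drv (-1) 1 (fun x => expR (- P x) * derive1 u x + - Q x) (fun=> 0).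
  apply: eq_drv (drvD (drvM (drv_expR (drvN dP)) d2u) (drvN dQ)) _ => x _ /=.
  by rewrite /rhs; field; rewrite gt_eqF.
pose cst0 := expR (- P 0) * derive1 u 0 - Q 0.
pose U1 x := (Q x + cst0) * expR (P x).
have eU1 x : -1 < x < 1 -> derive1 u x = U1 x.
  move=> xI; have := drv0_cst dz xI (_ : -1 < 0 < 1) => /(_ ltac:(lra)) e.
  rewrite /U1 /cst0 -e expRN; field.
  by rewrite gt_eqF// expR_gt0.
have cU1 : ctn (-1) 1 U1.
  by apply: ctnM; [apply: ctnD => //; exact: ctn_cst|exact: ctn_expR].
(* The i-th derivative of the equation, solved for the derivative of order i + 2. It serves as the
   definition of that component. *)
pose form V i x := (jmul A (fun j => V j.+1) i x + jmul C V i x - F i x) / eps.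
suff H : forall p, (p <= m)%N -> exists V, [/\ jet p.+2 V, V 0%N = u,
    (forall x, -1 < x < 1 -> derive1 u x = V 1%N x) &
    forall i, (i <= p)%N -> forall x, V i.+2 x = form V i x].
  have [V [jV V0 _ eV]] := H m (leqnn m).
  exists V; split => //; split; rewrite ?V0// => i; rewrite !ltnS => im x _.
  by rewrite eV// /form; field; rewrite gt_eqF.
elim => [_|p ihp pm].
  pose V (j : nat) : R -> R := if j is j'.+1 then (if j' is _.+1 then
    (fun x => A 0%N x * U1 x / eps + rhs x) else U1) else u.
  have eform x : form V 0%N x = A 0%N x * U1 x / eps + rhs x.
    by rewrite /form !jmul0 /rhs /=; field; rewrite gt_eqF.
  exists V; split => //; last by case.
  split => -[|[|[|//]]] //= _.
  - apply: ctnD => //; apply: ctnM; last exact: ctn_cst.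
    by apply: ctnM => //; exact: jA.1.
  - exact: eq_drv du eU1.
  - apply: (drv_ext eU1); apply: (eq_drv d2u) => x xI; by rewrite eU1.
have [V [jV V0 V1 eV]] := ihp (ltnW pm).
pose V' j := if j == p.+3 then form V p.+1 else V j.
have V'E j : (j < p.+3)%N -> V' j = V j by move=> jp; rewrite /V' ltn_eqF.
have eform i x : (i <= p.+1)%N -> form V' i x = form V i x.
  move=> ip; rewrite /form; congr ((_ + _ - _) / _); apply: eq_jmul => j ji.
    by rewrite V'E//; lia.
  by rewrite V'E//; lia.
have jVS : jet p.+1 (fun j => V j.+1) by exact: jetS.
have jV1 : jet p.+1 V by exact: jet_leq jV.
have jA1 : jet p.+1 A by exact: jet_leq jA.
have jC1 : jet p.+1 C by exact: jet_leq jC.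
have jF1 : jet p.+1 F by exact: jet_leq jF.
have cform : ctn (-1) 1 (form V p.+1).
  apply: ctnM; last exact: ctn_cst.
  apply: ctnD; last by apply: ctnN; exact: jF1.1.
  by apply: ctnD; apply: (ctn_jmul (leqnn _)).
have dform : drv (-1) 1 (form V p) (form V p.+1).
  have h := drvD (drvD (drv_jmul (ltnSn p) jA1 jVS) (drv_jmul (ltnSn p) jC1 jV1))
    (drvN (jF1.2 p (ltnSn p))).
  have := drvM h (drv_cst (-1) 1 eps^-1).
  by move=> /eq_drv; apply => x _; rewrite mulr0 addr0.
exists V'; split.
- split => j jp.
    have [->|jn] := eqVneq j p.+3; first by rewrite /V' eqxx.
    have jp2 : (j < p.+3)%N by lia.
    by rewrite V'E//; exact: jV.1.
  rewrite V'E//; have [jE|jn] := eqVneq j p.+2.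
    rewrite jE /V' eqxx; apply: drv_ext dform => x _.
    by rewrite eV.
  have jp2 : (j < p.+2)%N by lia.
  by rewrite V'E//; exact: jV.2.
- by rewrite V'E.
- by move=> x; rewrite V'E//; exact: V1.
- move=> i ip x; rewrite eform//; have [->|ni] := eqVneq i p.+1.
    by rewrite /V' eqxx.
  have {}ip : (i <= p)%N by lia.
  by rewrite V'E ?eV//; lia.
Qed.

End Jets.

(** * The weighted energy inequality *)

Section Energy.
Context {R : realType}.
Implicit Types (x y : R).

(* The right-hand side minus the left-hand side, with Bd 1 - Bd (-1) written as an
   integral, is the integral of a sum of squares times W. *)
Lemma energy (eps kap : R) (a a1 d g v v1 v2 W om q : R -> R) :
  0 < eps -> 0 < kap ->
  ctn (-1) 1 a -> ctn (-1) 1 a1 -> ctn (-1) 1 g -> ctn (-1) 1 v ->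
  ctn (-1) 1 v1 -> ctn (-1) 1 v2 -> ctn (-1) 1 W -> ctn (-1) 1 om ->
  ctn (-1) 1 q -> (forall x, 0 <= W x) ->
  drv (-1) 1 a a1 -> drv (-1) 1 v v1 -> drv (-1) 1 v1 v2 ->
  drv (-1) 1 W (fun x => om x * W x) ->
  (forall x, -1 < x < 1 -> - eps * v2 x + a x * v1 x + d x * v x = g x) ->
  (forall x, -1 < x < 1 ->
    kap <= d x - 2^-1 * a1 x - 2^-1 * a x * om x + q x) ->
  let Bd := fun x => W x * (2^-1 * a x * v x ^+ 2 - eps * v x * v1 x) in
  is_true (itg (-1) 1 (fun x => 2^-1 * (eps * (W x * v1 x ^+ 2) + kap * (W x * v x ^+ 2)))
  <= itg (-1) 1 (fun x => (2 * kap)^-1 * (W x * g x ^+ 2)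
       + (2^-1 * eps * om x ^+ 2 + q x) * (W x * v x ^+ 2)) - (Bd 1 - Bd (-1))).
Proof.
move=> eps0 kap0 ca ca1 cg cv cv1 cv2 cW com cq W0 da dv dv1 dW eqv coer Bd.
pose D x := om x * W x * (2^-1 * a x * v x ^+ 2 - eps * v x * v1 x)
  + W x * (2^-1 * a1 x * v x ^+ 2 + a x * v x * v1 x - eps * v1 x ^+ 2
           - eps * v x * v2 x).
have cc r : ctn (-1) 1 (fun=> r : R) by exact: ctn_cst.
have c2 := ctnX 2 cv; have c3 := ctnX 2 cv1.
have cBd : ctn (-1) 1 Bd.
  apply: ctnM => //; apply: ctnD; first by do 2![apply: ctnM => //].
  by apply: ctnN; do 2![apply: ctnM => //].
have cD : ctn (-1) 1 D.
  apply: ctnD.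
    apply: ctnM; first exact: ctnM.
    apply: ctnD; first by do 2![apply: ctnM => //].
    by apply: ctnN; do 2![apply: ctnM => //].
  apply: ctnM => //; apply: ctnD; first apply: ctnD; first apply: ctnD.
  - by do 2![apply: ctnM => //].
  - by do 2![apply: ctnM => //].
  - by apply: ctnN; apply: ctnM.
  - by apply: ctnN; do 2![apply: ctnM => //].
have dBd : drv (-1) 1 Bd D.
  have h1 := drvM (drvM (drv_cst (-1) 1 2^-1) da) (drvX 2 dv).
  have h2 := drvN (drvM (drvM (drv_cst (-1) 1 eps) dv) dv1).
  by apply: eq_drv (drvM dW (drvD h1 h2)) _ => x _; rewrite /D /=; field.
have m11 : (-1 : R) <= 1 by lra.
rewrite -(ftc m11 cBd cD dBd) lerBrDr -itgD; last 2 first.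
- apply: ctn_itgbl; apply: ctnM => //.
  by apply: ctnD; apply: ctnM => //; exact: ctnM.
- exact: ctn_itgbl.
apply: itg_le.
- apply: ctn_itgbl; apply: ctnD => //; apply: ctnM => //.
  by apply: ctnD; apply: ctnM => //; exact: ctnM.
- apply: ctn_itgbl; apply: ctnD; apply: ctnM => //.
  + by apply: ctnM => //; exact: ctnX.
  + apply: ctnD => //; apply: ctnM; [exact: cc|exact: ctnX].
  + exact: ctnM.
move=> x xI; have ex := eqv x xI; have ce := coer x xI; rewrite -subr_ge0.
rewrite /D; set E := (X in 0 <= X).
have -> : E = W x * (2^-1 * eps * (v1 x + om x * v x) ^+ 2
    + (2 * kap)^-1 * (kap * v x - g x) ^+ 2
    + (d x - 2^-1 * a1 x - 2^-1 * a x * om x + q x - kap) * v x ^+ 2).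
  by rewrite /E -ex; field; rewrite gt_eqF.
apply: mulr_ge0 => //; apply: addr_ge0; last by rewrite mulr_ge0 ?sqr_ge0 ?subr_ge0.
apply: addr_ge0; apply: mulr_ge0; rewrite ?sqr_ge0// ?invr_ge0; nra.
Qed.

(* The term beta b x^2 is the gain from the factor exp (beta x^2) of the weight. *)
Lemma ctn_pos_near0 (G b : R -> R) : ctn (-1) 1 G -> ctn (-1) 1 b ->
  (forall x, -1 <= x <= 1 -> 0 < b x) -> 0 < G 0 ->
  exists beta kap, [/\ 0 <= beta, 0 < kap &
    forall x, -1 <= x <= 1 -> kap <= G x + beta * (b x * x ^+ 2)].
Proof.
move=> cG cb b0 G0.
have [M M0 hM] := ctn_bounded cG.
have [c ci hc] := @EVT_min R b (-1) 1 ltac:(lra) (ctnP cb).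
have bc : 0 < b c by apply: b0; rewrite in_itv in ci.
have cG0 : {for 0, continuous G}.
  have [h _ _] := (continuous_within_itvP G (ltac:(lra) : (-1 : R) < 1)).1 (ctnP cG).
  by apply: h; rewrite in_itv/=; lra.
have [e /= e0 he] : \forall x \near (0 : R), G 0 / 2 < G x.
  by apply: (cvgr_gt (G 0) cG0); lra.
(* For |x| < e continuity keeps [G] above half its value at 0. For |x| >= e the quotient makes the
   added term at least M + G 0, which outweighs G >= -M. *)
exists ((M + G 0) / (b c * e ^+ 2)), (G 0 / 2); split; last 1 first.
- move=> x xI.
  have bx : b c <= b x by apply: hc; rewrite in_itv.
  have q0 : 0 < b c * e ^+ 2 by rewrite mulr_gt0// exprn_gt0.
  have [xe|ex] := ltP `|x| e.
    have h : G 0 / 2 < G x by apply: he; rewrite /ball_/= sub0r normrN.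
    rewrite (le_trans (ltW h))// lerDl; apply: mulr_ge0.
      by rewrite divr_ge0 ?addr_ge0 ?(ltW q0) ?(ltW G0).
    by apply: mulr_ge0; [exact/ltW/b0|exact: sqr_ge0].
  have h1 : 1 <= (b x * x ^+ 2) / (b c * e ^+ 2).
    rewrite ler_pdivlMr// mul1r ler_pM// ?sqr_ge0 ?(ltW bc)//.
    rewrite -[x ^+ 2]real_normK ?num_real//.
    have ee (y : R) : e <= y -> e ^+ 2 <= y ^+ 2 by nra.
    exact: ee.
  have := hM x xI; rewrite ler_norml => /andP[hx _].
  rewrite [_ / _ * _]mulrAC -mulrA.
  have : (M + G 0) * 1 <= (M + G 0) * (b x * x ^+ 2 / (b c * e ^+ 2)).
    by rewrite ler_wpM2l// addr_ge0// ltW.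
  lra.
- by rewrite divr_ge0 ?addr_ge0// ?ltW// mulr_gt0// exprn_gt0.
- lra.
Qed.

End Energy.

(** * Powers of K eps + x^2 as weights *)

Definition rho (R : realType) (K eps x : R) : R := K * eps + x ^+ 2.

(** The real power of [rho] with exponent [p], which may be negative. [K] is a free constant: for K
    >= 1 the function [rho] is comparable to eps + x^2, and [est_special] takes K large to make a
    defect small. *)
Definition wt (R : realType) (K eps p x : R) : R :=
  expR (p * ln (rho K eps x)).

Section Weights.
Context {R : realType} (K eps : R) (K1 : 1 <= K) (eps01 : 0 < eps <= 1).
Implicit Types (x p q : R).
Local Notation rh := (rho K eps).
Local Notation w := (wt K eps).

Lemma rho_gt0 x : 0 < rh x.
Proof.
case/andP: eps01 => e0 _; rewrite ltr_pwDl ?sqr_ge0// mulr_gt0//.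
exact: lt_le_trans K1.
Qed.

Lemma ctn_rho : ctn (-1) 1 rh.
Proof. by apply: ctnD; [exact: ctn_cst|apply/ctnX/ctn_id]. Qed.

Lemma drv_rho : drv (-1) 1 rh (fun x => 2 * x).
Proof.
apply: eq_drv (drvD (drv_cst _ _ _) (drvX 2 (drv_id _ _))) _ => x _ /=; ring.
Qed.

Lemma wt_gt0 p x : 0 < w p x. Proof. exact: expR_gt0. Qed.

Lemma ctn_wt p : ctn (-1) 1 (w p).
Proof.
apply: ctn_expR; apply: ctnM; first exact: ctn_cst.
by apply: ctn_ln; [exact: rho_gt0|exact: ctn_rho].
Qed.

Lemma drv_wt p : drv (-1) 1 (w p) (fun x => p * (2 * x / rh x) * w p x).
Proof.
apply: (drv_expR (drvZ p _)); apply: drv_ln drv_rho => x _; exact: rho_gt0.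
Qed.

Lemma wtD p q x : w (p + q) x = w p x * w q x.
Proof. by rewrite /wt mulrDl expRD. Qed.

Lemma wt0 x : w 0 x = 1. Proof. by rewrite /wt mul0r expR0. Qed.

Lemma wt1 x : w 1 x = rh x.
Proof. by rewrite /wt mul1r lnK// posrE rho_gt0. Qed.

Lemma wtn (n : nat) x : w n%:R x = rh x ^+ n.
Proof.
elim: n => [|n ihn]; first by rewrite wt0.
by rewrite -addn1 natrD wtD ihn wt1 addn1 exprSr.
Qed.

Lemma rho_le x : -1 <= x <= 1 -> rh x <= K + 1.
Proof.
case/andP: eps01 => e0 e1 /andP[x1 x2].
have K0 : 0 <= K by exact: le_trans K1.
have h := ler_wpM2l K0 e1; have hx : x ^+ 2 <= 1 by nra.
by rewrite /rho; lra.
Qed.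

Lemma wt_le p x : 0 <= p -> -1 <= x <= 1 -> w p x <= expR (p * ln (K + 1)).
Proof.
move=> p0 xI; rewrite ler_expR ler_wpM2l// ler_ln ?posrE ?rho_gt0 ?rho_le//.
by have := K1; lra.
Qed.

Lemma wt_leq p q x : p <= q -> -1 <= x <= 1 ->
  w q x <= expR ((q - p) * ln (K + 1)) * w p x.
Proof.
move=> pq xI; rewrite -{1}(subrK p q) wtD ler_pM2r ?wt_gt0// wt_le//.
by rewrite subr_ge0.
Qed.

Lemma eps_rho x : eps <= rh x.
Proof.
case/andP: eps01 => e0 _; have := ler_wpM2r (ltW e0) K1.
by rewrite mul1r /rho; have := sqr_ge0 x; lra.
Qed.

(** A factor [eps] is worth one power of [rho], so that exponents down to -1 become harmless. *)
Lemma epswt_le p x : -1 <= p -> -1 <= x <= 1 ->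
  eps * w p x <= expR ((p + 1) * ln (K + 1)).
Proof.
move=> p1 xI; apply: le_trans (@wt_le (p + 1) x _ xI); last by lra.
by rewrite wtD wt1 mulrC ler_pM2l ?wt_gt0 ?eps_rho.
Qed.

End Weights.

(** The derivative of x rho^p is (1 + 2 p x^2 / rho) rho^p. Since x^2 / rho lies in [0,1], it is at
    least [m0] times rho^p with m0 = min (1, 1 + 2p) > 0, so the integral is controlled by the
    weights at the end points, where rho lies between 1 and K + 1. *)
Lemma wt_itg (R : realType) (K p : R) : 1 <= K -> - 2^-1 < p ->
  exists M, forall eps, 0 < eps <= 1 -> itg (-1) 1 (wt K eps p) <= M.
Proof.
move=> K1 p1; pose m0 := Num.min 1 (1 + 2 * p).
have m00 : 0 < m0 by rewrite /m0 lt_min; lra.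
exists (2 * expR (`|p| * ln (K + 1)) / m0) => eps eps01.
have cw := ctn_wt K1 eps01 p.
rewrite ler_pdivlMr// mulrC -itgZ; last exact: ctn_itgbl.
have dF := drvM (drv_id (-1) 1) (drv_wt K1 eps01 p).
have crho := ctn_rho K eps.
have c1 : ctn (-1) 1 (fun x => 1 * wt K eps p x + x *
    (p * (2 * x / rho K eps x) * wt K eps p x)).
  apply: ctnD; first by apply: ctnM => //; exact: ctn_cst.
  apply: ctnM; first exact: ctn_id; apply: ctnM => //.
  apply: ctnM; first exact: ctn_cst.
  apply: ctnM; first by apply: ctnM; [exact: ctn_cst|exact: ctn_id].
  by apply: ctnV => // x; rewrite gt_eqF// rho_gt0.
have m11 : (-1 : R) <= 1 by lra.
have cF : ctn (-1) 1 (fun x => x * wt K eps p x).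
  by apply: ctnM => //; exact: ctn_id.
have wE (x : R) : x ^+ 2 = 1 -> wt K eps p x <= expR (`|p| * ln (K + 1)).
  move=> x1; rewrite ler_expR.
  have l0 : 0 <= ln (rho K eps x) <= ln (K + 1).
    have h1 : 1 <= rho K eps x by rewrite /rho x1; case/andP: eps01; nra.
    rewrite ln_ge0//= ler_ln ?posrE; last by lra.
      by rewrite /rho x1; case/andP: eps01; nra.
    by lra.
  case/andP: l0 => l0 l1; have := ler_norm p; have := normr_ge0 p; nra.
have := ftc m11 cF c1 dF; rewrite mulN1r opprK mul1r => e.
apply: (@le_trans _ _ (wt K eps p 1 + wt K eps p (-1))); last first.
  by have := wE 1 ltac:(ring); have := wE (-1) ltac:(ring); lra.
rewrite -e; apply: itg_le; [|exact: ctn_itgbl|].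
  by apply: ctn_itgbl; apply: ctnM => //; exact: ctn_cst.
move=> x xI; have r0 := rho_gt0 K1 eps01 x.
have -> : 1 * wt K eps p x + x * (p * (2 * x / rho K eps x) * wt K eps p x) =
  (1 + 2 * p * (x ^+ 2 / rho K eps x)) * wt K eps p x.
  by field; rewrite gt_eqF.
rewrite ler_pM2r ?wt_gt0//.
have : 0 <= x ^+ 2 / rho K eps x <= 1.
  rewrite divr_ge0 ?sqr_ge0 ?(ltW r0)//= ler_pdivrMr// mul1r /rho.
  by case/andP: eps01; nra.
set t := _ / _ => /andP[t0 t1].
have [p0|p0] := leP 0 p.
  by apply: (@le_trans _ _ 1); [rewrite /m0 ge_min lexx|nra].
by apply: (@le_trans _ _ (1 + 2 * p)); [rewrite /m0 ge_min lexx orbT|nra].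
Qed.

(** * Bounds uniform in eps *)

Section Bounded.
Context {R : realType} (A C F : nat -> R -> R) (m : nat).
Local Notation sol := (sol A C F m).
Implicit Types (Q : R -> (nat -> R -> R) -> R) (d e : R -> (nat -> R -> R) -> R -> R).

(** The bound is chosen before [eps] and the solution; this order of quantifiers is the independence
    of eps claimed for the final constant. *)
Definition ubd (Q : R -> (nat -> R -> R) -> R) : Prop :=
  exists M, forall eps V, sol eps V -> Q eps V <= M.

(** Integrability is included because integrals can be added and compared only with it. *)
Definition bdJ d : Prop :=
  exists M, forall eps V, sol eps V ->
    itgbl (-1) 1 (d eps V) /\ itg (-1) 1 (d eps V) <= M.

Lemma ubd_le Q Q' : ubd Q' -> (forall eps V, sol eps V -> Q eps V <= Q' eps V) ->
  ubd Q.
Proof. by move=> [M h] le; exists M => eps V hs; apply: le_trans (le _ _ hs) (h _ _ hs). Qed.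

Lemma ubdD Q Q' : ubd Q -> ubd Q' -> ubd (fun eps V => Q eps V + Q' eps V).
Proof.
move=> [M h] [M' h']; exists (M + M') => eps V hs.
exact: lerD (h _ _ hs) (h' _ _ hs).
Qed.

Lemma ubdM Q Q' : ubd (fun eps V => `|Q eps V|) -> ubd (fun eps V => `|Q' eps V|) ->
  ubd (fun eps V => `|Q eps V * Q' eps V|).
Proof.
move=> [M h] [M' h']; exists (M * M') => eps V hs; rewrite normrM ler_pM//.
  exact: h.
exact: h'.
Qed.

Lemma ubd_cst c : ubd (fun _ _ => c).
Proof. by exists c. Qed.

Lemma ubd_normD Q Q' : ubd (fun eps V => `|Q eps V|) ->
  ubd (fun eps V => `|Q' eps V|) -> ubd (fun eps V => `|Q eps V + Q' eps V|).
Proof.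
by move=> h h'; apply: ubd_le (ubdD h h') _ => eps V _; exact: ler_normD.
Qed.

Lemma ubd_pos Q : ubd Q ->
  exists2 M : R, 0 <= M & forall eps V, sol eps V -> Q eps V <= M.
Proof.
move=> [M h]; exists (Num.max 0 M); first by rewrite le_max lexx.
by move=> eps V hs; rewrite le_max (h _ _ hs) orbT.
Qed.

Lemma ubd_sum n (Q : nat -> R -> (nat -> R -> R) -> R) :
  (forall j, (j < n)%N -> ubd (Q j)) -> ubd (fun eps V => \sum_(j < n) Q j eps V).
Proof.
elim: n => [|n ihn] h.
  by apply: ubd_le (ubd_cst 0) _ => eps V _; rewrite big_ord0.
have h' : ubd (fun eps V => \sum_(j < n) Q j eps V) by apply: ihn => j /ltnW; exact: h.
by apply: ubd_le (ubdD h' (h n (ltnSn n))) _ => eps V _; rewrite big_ord_recr.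
Qed.

Lemma bdJD d e : bdJ d -> bdJ e -> bdJ (fun eps V x => d eps V x + e eps V x).
Proof.
move=> [M h] [M' h']; exists (M + M') => eps V hs.
have [i1 l1] := h _ _ hs; have [i2 l2] := h' _ _ hs.
by split; [exact: itgblD|rewrite itgD// lerD].
Qed.

Lemma bdJZ (c : R) d : 0 <= c -> bdJ d -> bdJ (fun eps V x => c * d eps V x).
Proof.
move=> c0 [M h]; exists (c * M) => eps V hs.
have [i1 l1] := h _ _ hs.
by split; [exact: itgblZ|rewrite itgZ// ler_wpM2l].
Qed.

Lemma bdJ_cst (c : R) : bdJ (fun _ _ _ => c).
Proof.
exists (c * (1 - (-1))) => eps V hs; split; first exact: itgbl_cst.
by rewrite itg_cst//; lra.
Qed.

Lemma bdJ_le d e : bdJ e ->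
  (forall eps V, sol eps V -> ctn (-1) 1 (d eps V)) ->
  (forall eps V, sol eps V -> forall x, -1 < x < 1 -> d eps V x <= e eps V x) ->
  bdJ d.
Proof.
move=> [M h] cd le; exists M => eps V hs; have [i1 l1] := h _ _ hs.
have i2 := ctn_itgbl (cd _ _ hs).
by split => //; apply: le_trans l1; apply: itg_le => // x; exact: le.
Qed.

Lemma bdJ_sum n (d : nat -> R -> (nat -> R -> R) -> R -> R) :
  (forall j, (j < n)%N -> bdJ (d j)) ->
  bdJ (fun eps V x => \sum_(j < n) d j eps V x).
Proof.
elim: n => [|n ihn] h.
  rewrite (_ : (fun _ => _) = fun _ _ _ => 0); first exact: bdJ_cst.
  by apply/funext => eps; apply/funext => V; apply/funext => x; rewrite big_ord0.
rewrite (_ : (fun _ => _) = fun eps V x => \sum_(j < n) d j eps V x + d n eps V x).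
  by apply: bdJD; [apply: ihn => j /ltnW; exact: h|exact: h].
by apply/funext => eps; apply/funext => V; apply/funext => x; rewrite big_ord_recr.
Qed.

Lemma bdJ_wt K p : 1 <= K -> - 2^-1 < p -> bdJ (fun eps _ => wt K eps p).
Proof.
move=> K1 p1; have [M h] := wt_itg K1 p1; exists M => eps V [e01 _ _ _ _].
by split; [apply/ctn_itgbl/ctn_wt|exact: h].
Qed.

End Bounded.

(** * The differentiated equation and its lower order terms *)

Section Equation.
Context {R : realType} (A C F : nat -> R -> R) (m : nat).
Context (jA : jet m A) (jC : jet m C) (jF : jet m F).
Local Notation sol := (sol A C F m).
Implicit Types (eps x : R) (V : nat -> R -> R) (i : nat).

Definition dcoef i x : R := C 0%N x + i%:R * A 1%N x.

(* The part of the i-th derivative of the equation with derivatives of V of order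
   at least i. *)
Definition gterm i eps V x : R :=
  - eps * V i.+2 x + A 0%N x * V i.+1 x + dcoef i x * V i x.

Definition lower i (T : R -> (nat -> R -> R) -> R -> R) : Prop :=
  exists2 M : R, 0 <= M & forall eps V, sol eps V -> forall x, -1 <= x <= 1 ->
    `|T eps V x| <= M * (1 + \sum_(j < i) `|V j x|).

Lemma lowerD i T T' : lower i T -> lower i T' ->
  lower i (fun eps V x => T eps V x + T' eps V x).
Proof.
move=> [M M0 h] [M' M'0 h']; exists (M + M'); first exact: addr_ge0.
move=> eps V hs x xI; rewrite (le_trans (ler_normD _ _))// mulrDl.
by rewrite lerD ?h ?h'.
Qed.

Lemma lowerN i T : lower i T -> lower i (fun eps V x => - T eps V x).
Proof.
move=> [M M0 h]; exists M => // eps V hs x xI.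
by rewrite normrN h.
Qed.

Lemma lower_sum i n (T : nat -> R -> (nat -> R -> R) -> R -> R) :
  (forall j, (j < n)%N -> lower i (T j)) ->
  lower i (fun eps V x => \sum_(j < n) T j eps V x).
Proof.
elim: n => [|n ihn] h.
  exists 0 => // eps V _ x _; by rewrite big_ord0 normr0 mul0r.
have [M M0 hM] := lowerD (ihn (fun j jn => h j (ltnW jn))) (h n (ltnSn n)).
by exists M => // eps V hs x xI; rewrite big_ord_recr/= hM.
Qed.

Lemma sumabs_ge (i j : nat) V x : (j < i)%N -> `|V j x| <= \sum_(l < i) `|V l x|.
Proof.
move=> ji; rewrite (bigD1 (Ordinal ji))//= lerDl.
by apply: sumr_ge0.
Qed.

Lemma lower_coef i j (f : R -> R) : (j < i)%N -> ctn (-1) 1 f ->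
  lower i (fun eps V x => f x * V j x).
Proof.
move=> ji /ctn_bounded[M M0 h]; exists M => // eps V hs x xI.
rewrite normrM ler_pM// ?h//.
have := sumabs_ge V x ji; lra.
Qed.

Lemma lower_data i (f : R -> R) : ctn (-1) 1 f -> lower i (fun _ _ => f).
Proof.
move=> /ctn_bounded[M M0 h]; exists M => // eps V hs x xI.
rewrite (le_trans (h x xI))// ler_peMr// lerDl.
by apply: sumr_ge0.
Qed.

(** By Leibniz' rule, [gterm] equals the derivative of f minus the terms in which at least two
    derivatives fall on a or at least one falls on c. These contain [V j] with j < i only. *)
Lemma lower_gterm i : (i.+2 <= m)%N -> lower i (gterm i).
Proof.
move=> im.
have cZ n (B : nat -> R -> R) j : jet m B -> (j <= m)%N ->
    ctn (-1) 1 (fun x => n%:R * B j x).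
  by move=> jB jm; apply: ctnM; [exact: ctn_cst|exact: jB.1].
have h1 : lower i (fun eps V x => \sum_(s < i.-1)
    ('C(i, s.+2)%:R * A s.+2 x) * V (i - s.+1)%N x).
  apply: (@lower_sum i i.-1
    (fun s eps V x => ('C(i, s.+2)%:R * A s.+2 x) * V (i - s.+1)%N x)).
  by move=> s si; apply: lower_coef; [lia|apply: (cZ _ _ _ jA); lia].
have h2 : lower i (fun eps V x => \sum_(s < i)
    ('C(i, s.+1)%:R * C s.+1 x) * V (i - s.+1)%N x).
  apply: (@lower_sum i i
    (fun s eps V x => ('C(i, s.+1)%:R * C s.+1 x) * V (i - s.+1)%N x)).
  move=> s si; apply: lower_coef; first lia.
  by apply: (cZ _ _ _ jC); lia.
have h3 : lower i (fun _ _ => F i) by apply: lower_data; apply: jF.1; lia.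
have [M M0 hM] := lowerD (lowerD h3 (lowerN h1)) (lowerN h2).
exists M => // eps V hs x xI; have [_ _ eV _ _] := hs.
have E : gterm i eps V x = F i x - (\sum_(s < i.-1)
    ('C(i, s.+2)%:R * A s.+2 x) * V (i - s.+1)%N x) - \sum_(s < i)
    ('C(i, s.+1)%:R * C s.+1 x) * V (i - s.+1)%N x; last first.
  by have := hM eps V hs x xI; rewrite E.
have := eV i im x xI; rewrite /gterm /dcoef mulNr => ->.
have eC : jmul C V i x = C 0%N x * V i x + \sum_(s < i)
    ('C(i, s.+1)%:R * C s.+1 x) * V (i - s.+1)%N x.
  rewrite /jmul big_ord_recl/= bin0 mul1r subn0; congr (_ + _).
  by apply: eq_bigr => s _; rewrite /bump/= add1n mulrA.
rewrite eC.
have -> : jmul A (fun j => V j.+1) i x = A 0%N x * V i.+1 x +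
    i%:R * A 1%N x * V i x + \sum_(s < i.-1)
    ('C(i, s.+2)%:R * A s.+2 x) * V (i - s.+1)%N x; last ring.
rewrite /jmul big_ord_recl/= bin0 mul1r subn0 -addrA; congr (_ + _).
case: i im {cZ h1 h2 h3 M M0 hM eC} => [|i] im /=.
  by rewrite !big_ord0 !mul0r addr0.
rewrite big_ord_recl/= /bump/= add1n bin1 subn1/= mulrA; congr (_ + _).
apply: eq_bigr => s _; rewrite !add1n mulrA; congr (_ * V _ _).
by have := ltn_ord s; lia.
Qed.

Lemma lower_sqr i T : lower i T ->
  exists2 M : R, 0 <= M & forall eps V, sol eps V -> forall x, -1 <= x <= 1 ->
    T eps V x ^+ 2 <= M * (1 + \sum_(j < i) V j x ^+ 2).
Proof.
move=> [M M0 h].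
have aux (s v t q : R) : 1 <= t -> s ^+ 2 <= t * q ->
    (s + v) ^+ 2 <= 2 * t * (q + v ^+ 2).
  move=> t1 h1; have h2 := ler_wpM2r (sqr_ge0 v) t1.
  by have := sqr_ge0 (s - v); nra.
have key V x : (1 + \sum_(j < i) `|V j x|) ^+ 2 <=
    2 ^+ i * (1 + \sum_(j < i) V j x ^+ 2).
  elim: i {h} => [|i ihi]; first by rewrite !big_ord0 expr0 addr0 expr1n mulr1.
  rewrite !big_ord_recr/= !addrA [2 ^+ i.+1]exprS -[V i x ^+ 2]real_normK ?num_real//.
  by apply: aux => //; rewrite exprn_ege1// ler1n.
exists (M ^+ 2 * 2 ^+ i); first by rewrite mulr_ge0 ?sqr_ge0 ?exprn_ge0.
move=> eps V hs x xI; rewrite -[T eps V x ^+ 2]real_normK ?num_real// -mulrA.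
have hx := h _ _ hs x xI.
apply: (@le_trans _ _ ((M * (1 + \sum_(j < i) `|V j x|)) ^+ 2)).
  rewrite lerXn2r// nnegrE mulr_ge0// addr_ge0//.
  by apply: sumr_ge0.
by rewrite exprMn ler_wpM2l ?sqr_ge0.
Qed.

Lemma ctn_dcoef i : (0 < m)%N -> ctn (-1) 1 (dcoef i).
Proof.
move=> m0; apply: ctnD; first exact: jC.1.
by apply: ctnM; [exact: ctn_cst|exact: jA.1].
Qed.

Lemma ctn_V eps V j : sol eps V -> (j <= m)%N -> ctn (-1) 1 (V j).
Proof. by move=> [_ [h _] _ _ _]; exact: h. Qed.

Lemma ctn_gterm i eps V : sol eps V -> (i.+2 <= m)%N -> ctn (-1) 1 (gterm i eps V).
Proof.
move=> hs im.
apply: ctnD; first apply: ctnD; apply: ctnM.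
- exact: ctn_cst.
- exact: (ctn_V hs).
- exact: jA.1.
- by apply: (ctn_V hs); exact: ltnW.
- by apply: ctn_dcoef; lia.
- by apply: (ctn_V hs); lia.
Qed.

Lemma drv_gterm i eps V : sol eps V -> (i.+3 <= m)%N ->
  drv (-1) 1 (gterm i eps V)
    (fun x => gterm i.+1 eps V x + (C 1%N x + i%:R * A 2 x) * V i x).
Proof.
move=> [_ [_ dV] _ _ _] im.
have h1 := drvM (drv_cst (-1) 1 (- eps)) (dV i.+2 im).
have h2 := drvM (jA.2 0%N ltac:(lia)) (dV i.+1 ltac:(lia)).
have h3 := drvM (drvD (jC.2 0%N ltac:(lia)) (drvZ i%:R (jA.2 1%N ltac:(lia))))
  (dV i ltac:(lia)).
apply: eq_drv (drvD (drvD h1 h2) h3) _ => x _ /=.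
by rewrite /gterm /dcoef -[i.+1]addn1 natrD addn1; ring.
Qed.

Lemma bdJ_gterm K p i : 1 <= K -> (i.+2 <= m)%N ->
  bdJ A C F m (fun eps _ => wt K eps p) ->
  (forall j, (j < i)%N -> bdJ A C F m (fun eps V x => wt K eps p x * V j x ^+ 2)) ->
  bdJ A C F m (fun eps V x => wt K eps p x * gterm i eps V x ^+ 2).
Proof.
move=> K1 im h0 hj; have [M M0 h] := lower_sqr (lower_gterm im).
apply: bdJ_le (bdJZ M0 (bdJD h0 (bdJ_sum hj))) _ _.
  move=> eps V hs; have [e01 _ _ _ _] := hs.
  by apply: ctnM; [exact: ctn_wt|exact/ctnX/ctn_gterm].
move=> eps V hs x /andP[x1 x2].
rewrite -mulr_sumr.
rewrite (_ : M * _ = wt K eps p x * (M * (1 + \sum_(j < i) V j x ^+ 2))); last by ring.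
by rewrite ler_pM2l ?wt_gt0// h// !ltW.
Qed.

End Equation.

(** * Energy estimates uniform in eps; order zero *)

Section Steps.
Context {R : realType} (A C F : nat -> R -> R) (b : R -> R) (m : nat) (gamma : R).
Context (jA : jet m A) (jC : jet m C) (jF : jet m F) (cb : ctn (-1) 1 b).
Context (Ab : forall x : R, -1 <= x <= 1 -> A 0%N x = - x * b x)
  (b0 : forall x : R, -1 <= x <= 1 -> 0 < b x).
Context (gamma0 : 0 < gamma)
  (coer : forall x : R, -1 < x < 1 -> gamma <= C 0%N x - 2^-1 * A 1%N x).
Local Notation sol := (sol A C F m).
Local Notation bdJ := (bdJ A C F m).
Local Notation ubd := (ubd A C F m).
Local Notation gterm := (gterm A C).
Local Notation dcoef := (dcoef A C).
Implicit Types (eps x p K e : R) (V : nat -> R -> R) (i j : nat).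

(** The boundary term of the energy inequality is made of a v^2 and eps v v' at 1 and -1; the two
    bounds cover exactly these products. *)
Definition bd_end i : Prop := forall e, e = 1 \/ e = -1 ->
  ubd (fun eps V => `|V i e|) /\ ubd (fun eps V => `|eps * V i.+1 e * V i e|).

Lemma A1_0 : (0 < m)%N -> A 1%N 0 = - b 0.
Proof.
move=> m0; have m11 : (-1 : R) < 1 by lra.
have I0 : (-1 : R) < (0 : R) < 1 by lra.
have [_ <-] := drvP (jA.2 0%N m0) I0.
have cb0 : {for 0, continuous b}.
  have [h _ _] := (continuous_within_itvP b m11).1 (ctnP cb).
  by apply: h; rewrite in_itv/=.
rewrite /derive; apply/cvg_lim => //.
have cN : - b x @[x --> 0^'] --> - b 0.
  by apply: cvgN; apply: cvg_within_filter; exact: cb0.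
apply: cvg_trans cN; apply: near_eq_cvg.
have /near_in_itvoo h : (0 : R) \in `](-1), 1[ by rewrite in_itv/=.
near=> h0; have h1 : h0 != 0 by near: h0; exact: nbhs_dnbhs_neq.
have h2 : -1 <= h0 <= 1.
  have : h0 \in `](-1), 1[ by near: h0; apply: cvg_within h.
  by rewrite in_itv/= => /andP[? ?]; rewrite !ltW.
rewrite /= addr0 [_%:A]/GRing.scale/= mulr1 !Ab ?lexx//; last by lra.
by rewrite /GRing.scale/= oppr0 mul0r subr0 mulrA mulrN mulVf// mulN1r.
Unshelve. all: by end_near. Qed.

Lemma sol_eps eps V : sol eps V -> 0 < eps <= 1.
Proof. by case. Qed.

Lemma sol_drv eps V j : sol eps V -> (j < m)%N -> drv (-1) 1 (V j) (V j.+1).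
Proof. by move=> [_ [_ h] _ _ _]; exact: h. Qed.

(** The boundary term remains on the left-hand side, because [est_step] also extracts from it the
    bound of [V i] at the end points. *)
Lemma energy_bd kap (d : R -> R) (v v1 v2 g : R -> (nat -> R -> R) -> R -> R)
    (W om q : R -> R -> R) :
  0 < kap -> (1 <= m)%N ->
  (forall eps V, sol eps V -> [/\ ctn (-1) 1 (v eps V), ctn (-1) 1 (v1 eps V),
     ctn (-1) 1 (v2 eps V) & ctn (-1) 1 (g eps V)]) ->
  (forall eps, 0 < eps <= 1 -> [/\ ctn (-1) 1 (W eps), ctn (-1) 1 (om eps),
     ctn (-1) 1 (q eps), (forall x, 0 <= W eps x) &
     drv (-1) 1 (W eps) (fun x => om eps x * W eps x)]) ->
  (forall eps V, sol eps V -> drv (-1) 1 (v eps V) (v1 eps V) /\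
     drv (-1) 1 (v1 eps V) (v2 eps V)) ->
  (forall eps V, sol eps V -> forall x, -1 < x < 1 ->
     - eps * v2 eps V x + A 0%N x * v1 eps V x + d x * v eps V x = g eps V x) ->
  (forall eps x, 0 < eps <= 1 -> -1 < x < 1 ->
     kap <= d x - 2^-1 * A 1%N x - 2^-1 * A 0%N x * om eps x + q eps x) ->
  bdJ (fun eps V x => (2 * kap)^-1 * (W eps x * g eps V x ^+ 2)
    + (2^-1 * eps * om eps x ^+ 2 + q eps x) * (W eps x * v eps V x ^+ 2)) ->
  ubd (fun eps V => itg (-1) 1 (fun x => 2^-1 * (eps * (W eps x * v1 eps V x ^+ 2)
      + kap * (W eps x * v eps V x ^+ 2)))
    + (W eps 1 * (2^-1 * A 0%N 1 * v eps V 1 ^+ 2 - eps * v eps V 1 * v1 eps V 1)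
     - W eps (-1) * (2^-1 * A 0%N (-1) * v eps V (-1) ^+ 2
        - eps * v eps V (-1) * v1 eps V (-1)))).
Proof.
move=> kap0 m1 cv cW dv eqv co [M hM]; exists M => eps V hs.
have [i1 l1] := hM _ _ hs; apply: le_trans l1; rewrite -lerBrDr.
have eps01 := sol_eps hs; have /andP[eps0 _] := eps01.
have [c1 c2 c3 c4] := cv _ _ hs; have [c5 c6 c7 c8 c9] := cW _ eps01.
have [d1 d2] := dv _ _ hs.
apply: (@energy R eps kap (A 0%N) (A 1%N) d (g eps V) (v eps V) (v1 eps V)
  (v2 eps V)) => //.
- exact: jA.1.
- exact: jA.1.
- exact: (jA.2 0%N).
- exact: eqv.
- by move=> x xI; exact: co.
Qed.

Lemma energy_split kap (v v1 : R -> (nat -> R -> R) -> R -> R) (W : R -> R -> R)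
    (Bd : R -> (nat -> R -> R) -> R) :
  0 < kap ->
  (forall eps V, sol eps V -> ctn (-1) 1 (v eps V) /\ ctn (-1) 1 (v1 eps V)) ->
  (forall eps, 0 < eps <= 1 -> ctn (-1) 1 (W eps) /\ (forall x, 0 <= W eps x)) ->
  ubd (fun eps V => itg (-1) 1 (fun x => 2^-1 * (eps * (W eps x * v1 eps V x ^+ 2)
      + kap * (W eps x * v eps V x ^+ 2))) + Bd eps V) ->
  ubd (fun eps V => - Bd eps V) ->
  bdJ (fun eps V x => W eps x * v eps V x ^+ 2) /\
  bdJ (fun eps V x => eps * (W eps x * v1 eps V x ^+ 2)).
Proof.
move=> kap0 cv cW h1 h2.
have c0 eps V : sol eps V -> [/\ ctn (-1) 1 (fun x => W eps x * v eps V x ^+ 2),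
    ctn (-1) 1 (fun x => eps * (W eps x * v1 eps V x ^+ 2)) &
    forall x, 0 <= W eps x * v eps V x ^+ 2 /\
      0 <= eps * (W eps x * v1 eps V x ^+ 2)].
  move=> hs; have [c1 c2] := cv _ _ hs; have [c3 c4] := cW _ (sol_eps hs).
  split; [by apply: ctnM => //; exact: ctnX| |move=> x; split].
  - by apply: ctnM; [exact: ctn_cst|apply: ctnM => //; exact: ctnX].
  - by rewrite mulr_ge0 ?sqr_ge0.
  - have /andP[e0 _] := sol_eps hs.
    by rewrite mulr_ge0 ?(ltW e0)// mulr_ge0 ?sqr_ge0.
have h0 : bdJ (fun eps V x => 2^-1 * (eps * (W eps x * v1 eps V x ^+ 2)
      + kap * (W eps x * v eps V x ^+ 2))).
  have [M hM] := ubdD h1 h2; exists M => eps V hs.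
  have [c1 c2 c3] := c0 _ _ hs; split.
    apply/ctn_itgbl; apply: ctnM; first exact: ctn_cst.
    by apply: ctnD => //; apply: ctnM => //; exact: ctn_cst.
  by apply: le_trans (hM _ _ hs); rewrite addrK.
split.
  apply: (bdJ_le (bdJZ (c := 2 / kap) _ h0)); first by rewrite divr_ge0// ltW.
    by move=> eps V /c0[].
  move=> eps V /c0[_ _ h] x _; have [p1 p2] := h x.
  rewrite (_ : 2 / kap * _ = (eps * (W eps x * v1 eps V x ^+ 2)) / kap
    + W eps x * v eps V x ^+ 2); last by field; rewrite gt_eqF.
  by rewrite lerDr divr_ge0// ltW.
apply: (bdJ_le (bdJZ (c := 2) _ h0)); first lra.
  by move=> eps V /c0[].
move=> eps V /c0[_ _ h] x _; have [p1 p2] := h x.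
rewrite (_ : 2 * _ = eps * (W eps x * v1 eps V x ^+ 2)
  + kap * (W eps x * v eps V x ^+ 2)); last by field.
by rewrite lerDl mulr_ge0// ltW.
Qed.

(** At order 0 the trivial weight suffices: coercivity with [gamma] holds on the whole interval, no
    defects arise, and the boundary terms vanish with u. *)
Lemma est_base : (2 <= m)%N ->
  [/\ bdJ (fun eps V x => V 0%N x ^+ 2), bdJ (fun eps V x => eps * V 1%N x ^+ 2) &
     bd_end 0].
Proof.
move=> m2.
have r1 : bd_end 0.
  by move=> e [->|->]; split; exists 0 => eps V [_ _ _ V1 V2];
    rewrite ?V1 ?V2 ?mulr0 normr0.
have hg : bdJ (fun eps V x => wt 1 eps 0 x * gterm 0 eps V x ^+ 2).
  by apply: (bdJ_gterm jA jC jF) => //; apply: bdJ_wt => //; lra.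
have cV eps V j : sol eps V -> (j <= m)%N -> ctn (-1) 1 (V j).
  by move=> hs; exact: (ctn_V hs).
have m1 : (1 <= m)%N by lia.
have hE := @energy_bd gamma (dcoef 0) (fun _ V => V 0%N) (fun _ V => V 1%N)
  (fun _ V => V 2) (gterm 0) (fun _ _ => 1) (fun _ _ => 0) (fun _ _ => 0) gamma0 m1.
have {}hE := hE (fun eps V hs => And4 (cV _ _ _ hs (leq0n m)) (cV _ _ _ hs m1)
  (cV _ _ _ hs m2) (ctn_gterm jA jC hs m2)).
have [|||r2 r3] := @energy_split gamma (fun _ V => V 0%N) (fun _ V => V 1%N)
  (fun _ _ => 1) (fun eps V =>
   (1 * (2^-1 * A 0%N 1 * V 0%N 1 ^+ 2 - eps * V 0%N 1 * V 1%N 1)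
     - 1 * (2^-1 * A 0%N (-1) * V 0%N (-1) ^+ 2 - eps * V 0%N (-1) * V 1%N (-1))))
  gamma0 (fun eps V hs => conj (cV _ _ _ hs (leq0n m)) (cV _ _ _ hs m1)).
- by move=> eps _; split; [exact: ctn_cst|].
- apply: hE.
  + move=> eps _; split; try exact: ctn_cst; first by [].
    by apply: eq_drv (drv_cst _ _ _) _ => x _; rewrite mul0r.
  + by move=> eps V hs; split; exact: (sol_drv hs).
  + by move=> eps V hs x _.
  + by move=> eps x _ xI; rewrite /dcoef mul0r addr0 mulr0 subr0 addr0; exact: coer.
  + apply: (bdJ_le (bdJZ (c := (2 * gamma)^-1) _ hg)).
    * by rewrite invr_ge0 mulr_ge0 ?(ltW gamma0).
    * move=> eps V hs; apply: ctnD; apply: ctnM; try exact: ctn_cst.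
        by apply: ctnM; [exact: ctn_cst|exact/ctnX/(ctn_gterm jA jC hs)].
      by apply: ctnM; [exact: ctn_cst|exact/ctnX/(cV _ _ _ hs)].
    * by move=> eps V hs x _; rewrite wt0 expr0n/= mulr0 addr0 mul0r addr0.
- exists 0 => eps V [_ _ _ V1 V2].
  by rewrite V1 V2 !(mulr0, mul0r, expr0n, subr0, oppr0).
split => //; first by move: r2; under eq_fun do under eq_fun do under eq_fun do rewrite mul1r.
by move: r3; under eq_fun do under eq_fun do under eq_fun do rewrite mul1r.
Qed.

End Steps.

(** * Weights with the factor exp (beta x^2) *)

Definition bwt (R : realType) (K beta p eps x : R) : R :=
  wt K eps p x * expR (beta * x ^+ 2).

(** The logarithmic derivative of [bwt]. *)
Definition bom (R : realType) (K beta p eps x : R) : R :=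
  p * (2 * x / rho K eps x) + 2 * beta * x.

Section BWeight.
Context {R : realType} (K beta p : R) (K1 : 1 <= K) (beta0 : 0 <= beta).
Implicit Types (eps x : R).

Lemma ctn_bwt eps : 0 < eps <= 1 -> ctn (-1) 1 (bwt K beta p eps).
Proof.
move=> e01; apply: ctnM; first exact: ctn_wt.
by apply: ctn_expR; apply: ctnM; [exact: ctn_cst|exact/ctnX/ctn_id].
Qed.

Lemma ctn_Vrho eps : 0 < eps <= 1 -> ctn (-1) 1 (fun x => (rho K eps x)^-1).
Proof.
by move=> e01; apply: ctnV; [move=> x; rewrite gt_eqF ?rho_gt0|exact: ctn_rho].
Qed.

Lemma ctn_bom eps : 0 < eps <= 1 -> ctn (-1) 1 (bom K beta p eps).
Proof.
move=> e01; apply: ctnD; last first.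
  by apply: ctnM; [exact: ctn_cst|exact: ctn_id].
apply: ctnM; first exact: ctn_cst.
apply: ctnM; last exact: ctn_Vrho.
by apply: ctnM; [exact: ctn_cst|exact: ctn_id].
Qed.

Lemma drv_bwt eps : 0 < eps <= 1 ->
  drv (-1) 1 (bwt K beta p eps) (fun x => bom K beta p eps x * bwt K beta p eps x).
Proof.
move=> e01; have h := drv_expR (drvZ beta (drvX 2 (drv_id (-1 : R) 1))).
apply: (eq_drv (drvM (drv_wt K1 e01 p) h)) => x _.
by rewrite /bom /bwt /=; ring.
Qed.

Lemma bwt_ge0 eps x : 0 <= bwt K beta p eps x.
Proof. by rewrite mulr_ge0 ?expR_ge0. Qed.

Lemma bwt_ge eps x : wt K eps p x <= bwt K beta p eps x.
Proof.
rewrite ler_peMr ?expR_ge0// -expR0 ler_expR.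
by rewrite mulr_ge0 ?sqr_ge0.
Qed.

Lemma bwt_le eps x : -1 <= x <= 1 ->
  bwt K beta p eps x <= expR beta * wt K eps p x.
Proof.
move=> /andP[x1 x2]; rewrite /bwt mulrC ler_pM2r ?wt_gt0// ler_expR.
have x3 : x ^+ 2 <= 1 by nra.
by rewrite ler_piMr.
Qed.

(** The second term is small with eps, the first is not: at x^2 = K eps it equals p^2 / K.
    [est_step] leaves it to the energy of order i - 1, whereas [est_special] makes it small by the
    choice of K. *)
Lemma bom_sqr eps x : 0 < eps <= 1 -> -1 <= x <= 1 ->
  2^-1 * eps * bom K beta p eps x ^+ 2 <=
    4 * p ^+ 2 * (eps * (x ^+ 2 / rho K eps x ^+ 2)) + 4 * beta ^+ 2 * eps.
Proof.
move=> e01 /andP[x1 x2]; have /andP[e0 _] := e01.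
have r0 := rho_gt0 K1 e01 x.
have x3 : x ^+ 2 <= 1 by nra.
have h : bom K beta p eps x ^+ 2 <=
    8 * p ^+ 2 * (x ^+ 2 / rho K eps x ^+ 2) + 8 * beta ^+ 2.
  have -> : 8 * p ^+ 2 * (x ^+ 2 / rho K eps x ^+ 2) =
      2 * (p * (2 * x / rho K eps x)) ^+ 2 by field; rewrite gt_eqF.
  rewrite /bom; set s := p * _.
  have h1 : (2 * beta * x) ^+ 2 <= 4 * beta ^+ 2.
    by rewrite !exprMn -natrX ler_piMr// mulr_ge0 ?sqr_ge0.
  by have := sqr_ge0 (s - 2 * beta * x); nra.
have := ler_wpM2l (ltW e0) h; lra.
Qed.

End BWeight.

(** * From lower orders to order i, with a nonnegative exponent *)

Section Step.
Context {R : realType} (A C F : nat -> R -> R) (b : R -> R) (m : nat).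
Context (jA : jet m A) (jC : jet m C) (jF : jet m F) (cb : ctn (-1) 1 b).
Context (Ab : forall x : R, -1 <= x <= 1 -> A 0%N x = - x * b x)
  (b0 : forall x : R, -1 <= x <= 1 -> 0 < b x).
Local Notation sol := (sol A C F m).
Local Notation bdJ := (bdJ A C F m).
Local Notation ubd := (ubd A C F m).
Local Notation gterm := (gterm A C).
Local Notation dcoef := (dcoef A C).
Local Notation bd_end := (bd_end A C F m).
Implicit Types (eps x p K e : R) (V : nat -> R -> R) (i j : nat).

Lemma endI e : e = 1 \/ e = -1 -> -1 <= e <= 1.
Proof. by move=> [->|->]; rewrite lexx ?andbT; lra. Qed.

Lemma wt_end_ge1 K p eps e : 1 <= K -> 0 <= p -> 0 < eps <= 1 ->
  e = 1 \/ e = -1 -> 1 <= wt K eps p e.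
Proof.
move=> K1 p0 /andP[e0 _] he; rewrite -expR0 ler_expR mulr_ge0// ln_ge0// /rho.
have -> : e ^+ 2 = 1 by case: he => ->; rewrite ?sqrrN expr1n.
by rewrite lerDr mulr_ge0 ?(ltW e0)// (le_trans ler01).
Qed.

(* The equation of order i - 1 at the end points. *)
Lemma robin_bd i : (0 < i)%N -> (i.+1 <= m)%N ->
  (forall j, (j < i)%N -> bd_end j) -> forall e, e = 1 \/ e = -1 ->
  ubd (fun eps V => `|- eps * V i.+1 e + A 0%N e * V i e|).
Proof.
case: i => // i _ im hj e he; have eI := endI he.
have [M M0 hM] := lower_gterm jA jC jF im.
have h1 : ubd (fun eps V => M * (1 + \sum_(j < i) `|V j e|)).
  have [M' M'0 hM'] : exists2 M' : R, 0 <= M' & forall eps V, sol eps V ->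
      1 + \sum_(j < i) `|V j e| <= M'.
    apply: ubd_pos; apply: ubdD; first exact: ubd_cst.
    apply: (@ubd_sum _ _ _ _ _ i (fun j _ V => `|V j e|)) => j ji.
    by have [] := hj j (ltnW ji) e he.
  by exists (M * M') => eps V hs; apply: ler_wpM2l => //; exact: (hM' _ _ hs).
have [M2 hM2] := (hj i (ltnSn i) e he).1.
apply: ubd_le (ubdD h1 (ubd_cst A C F m (`|dcoef i e| * M2))) _ => eps V hs.
rewrite (_ : - eps * _ + _ = gterm i eps V e - dcoef i e * V i e); last first.
  by rewrite /gterm; ring.
apply: le_trans (ler_normB _ _) _; apply: lerD; first exact: (hM _ _ hs e eI).
by rewrite normrM; apply: ler_wpM2l => //; exact: (hM2 _ _ hs).
Qed.

Lemma end_from_robin i : (forall e, e = 1 \/ e = -1 ->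
    ubd (fun eps V => `|- eps * V i.+1 e + A 0%N e * V i e|)) ->
  (forall e, e = 1 \/ e = -1 -> ubd (fun eps V => V i e ^+ 2)) -> bd_end i.
Proof.
move=> hr hV e he.
have h1 : ubd (fun eps V => `|V i e|).
  apply: ubd_le (ubdD (ubd_cst A C F m 1) (hV e he)) _ => eps V _.
  rewrite -[V i e ^+ 2]real_normK ?num_real//.
  have := sqr_ge0 (`|V i e| - 1 : R); have := sqr_ge0 (`|V i e| : R); nra.
split => //.
have h2 : ubd (fun eps V => `|A 0%N e * V i e|).
  have [M hM] := h1; exists (`|A 0%N e| * M) => eps V hs.
  by rewrite normrM; apply: ler_wpM2l => //; exact: (hM _ _ hs).
have h3 : ubd (fun eps V => `|eps * V i.+1 e|).
  apply: ubd_le (ubdD (hr e he) h2) _ => eps V _.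
  set s := - eps * _ + _; set t := A 0%N e * _.
  have -> : eps * V i.+1 e = t - s by rewrite /s /t; ring.
  by apply: le_trans (ler_normB t s) _; rewrite addrC.
exact: (ubdM h3 h1).
Qed.

(** [G0] is coercivity at the turning point. [hd1] and [hd2] are the defects, eps-parts of energies
    of order i - 1: the former stems from [beta], the latter from the power of [rho]. The factor [p]
    in [hd2] makes it void for p = 0, where no bound with exponent -1 is at hand. *)
Lemma est_step i p K : 1 <= K -> (0 < i)%N -> (i.+2 <= m)%N -> 0 <= p ->
  0 < C 0%N 0 - (i%:R - 2^-1) * b 0 + p * b 0 ->
  (forall j, (j < i)%N -> bdJ (fun eps V x => wt K eps p x * V j x ^+ 2)) ->
  (forall j, (j < i)%N -> bd_end j) ->
  bdJ (fun eps V x => eps * (wt K eps p x * V i x ^+ 2)) ->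
  bdJ (fun eps V x => p * (eps * (wt K eps (p - 1) x * V i x ^+ 2))) ->
  [/\ bdJ (fun eps V x => wt K eps p x * V i x ^+ 2),
     bdJ (fun eps V x => eps * (wt K eps p x * V i.+1 x ^+ 2)) & bd_end i].
Proof.
move=> K1 i0 im p0 G0 hlow hend hd1 hd2.
have K0 : 0 <= K by exact: le_trans K1.
have im1 : (i < m)%N := ltnW im.
have im0 : (i <= m)%N := ltnW im1.
have m1 : (1 <= m)%N := leq_ltn_trans (leq0n i) im1.
pose G x := C 0%N x + (i%:R - 2^-1) * A 1%N x + p * b x.
have cG : ctn (-1) 1 G.
  apply: ctnD; last by apply: ctnM => //; exact: ctn_cst.
  by apply: ctnD; [exact: jC.1|apply: ctnM; [exact: ctn_cst|exact: jA.1]].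
have G00 : 0 < G 0 by rewrite /G (A1_0 jA cb Ab m1); lra.
have [beta [kap [beta0 kap0 hG]]] := ctn_pos_near0 cG cb b0 G00.
pose W eps x := bwt K beta p eps x.
pose om eps x := bom K beta p eps x.
(* The weight contributes p b x^2 / rho + beta b x^2 to the zero order coefficient. Since x^2 / rho
   = 1 - K eps / rho, adding [q] replaces the first term by p b, as in [G]. *)
pose q eps x := p * K * eps * (b x * (rho K eps x)^-1).
have cV eps V j : sol eps V -> (j <= m)%N -> ctn (-1) 1 (V j).
  by move=> hs; exact: (ctn_V hs).
have c0 : forall eps V, sol eps V -> [/\ ctn (-1) 1 (V i), ctn (-1) 1 (V i.+1),
    ctn (-1) 1 (V i.+2) & ctn (-1) 1 (gterm i eps V)].
  move=> eps V hs; split; [exact: (cV _ _ _ hs)|exact: (cV _ _ _ hs)|exact: (cV _ _ _ hs)|].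
  exact: (ctn_gterm jA jC hs im).
have cW : forall eps, 0 < eps <= 1 -> [/\ ctn (-1) 1 (W eps), ctn (-1) 1 (om eps),
     ctn (-1) 1 (q eps), (forall x, 0 <= W eps x) &
     drv (-1) 1 (W eps) (fun x => om eps x * W eps x)].
  move=> eps e01; split; [exact: ctn_bwt|exact: ctn_bom| | |exact: drv_bwt].
    apply: ctnM; first exact: ctn_cst.
    by apply: ctnM => //; exact: ctn_Vrho.
  by move=> x; exact: bwt_ge0.
have hg := bdJ_gterm jA jC jF K1 im (bdJ_wt A C F m K1 (ltac:(lra) : - 2^-1 < p)) hlow.
have [Mb Mb0 hMb] := ctn_bounded cb.
have hE := @energy_bd _ A C F m jA kap (dcoef i) (fun _ V => V i)
  (fun _ V => V i.+1) (fun _ V => V i.+2) (gterm i) W om q kap0 m1 c0 cW.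
have {}hE := hE (fun eps V hs => conj (sol_drv hs im1) (sol_drv hs im))
  (fun eps V hs x _ => erefl).
have {hE} [||M hM] := hE.
  move=> eps x e01 /andP[x1 x2]; have r0 := rho_gt0 K1 e01 x.
  have xI : -1 <= x <= 1 by rewrite !ltW.
  apply: le_trans (hG x xI) _; rewrite le_eqVlt; apply/orP; left; apply/eqP.
  rewrite /G /dcoef /om /bom /q Ab// /rho.
  by move: r0; rewrite /rho => r0; field; rewrite gt_eqF.
  apply: (bdJ_le (bdJD (bdJZ (c := expR beta * (2 * kap)^-1) _ hg)
     (bdJD (bdJZ (c := expR beta * (4 * p + K * Mb)) _ hd2)
           (bdJZ (c := expR beta * (4 * beta ^+ 2)) _ hd1)))).
  - by rewrite mulr_ge0 ?expR_ge0// invr_ge0 mulr_ge0// ltW.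
  - by rewrite mulr_ge0 ?expR_ge0// addr_ge0// mulr_ge0.
  - by rewrite !mulr_ge0 ?expR_ge0// sqr_ge0.
  - move=> eps V hs; have [c1 c2 c3 c4] := c0 _ _ hs.
    have [c5 c6 c7 _ _] := cW _ (sol_eps hs).
    apply: ctnD; apply: ctnM.
    + exact: ctn_cst.
    + by apply: ctnM => //; exact: ctnX.
    + by apply: ctnD => //; apply: ctnM; [exact: ctn_cst|exact: ctnX].
    + by apply: ctnM => //; exact: ctnX.
  move=> eps V hs x /andP[x1 x2]; have e01 := sol_eps hs.
  have /andP[e0 _] := e01.
  have xI : -1 <= x <= 1 by rewrite !ltW.
  have r0 := rho_gt0 K1 e01 x.
  have hW := bwt_le K p beta0 eps xI; have W0 := bwt_ge0 K beta p eps x.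
  apply: lerD.
    rewrite (_ : expR beta * _ * _ = (2 * kap)^-1 *
      (expR beta * wt K eps p x * gterm i eps V x ^+ 2)); last by ring.
    apply: ler_wpM2l; first by rewrite invr_ge0 mulr_ge0// ltW.
    by apply: ler_wpM2r => //; exact: sqr_ge0.
  have hq : 2^-1 * eps * om eps x ^+ 2 + q eps x <=
     (4 * p + K * Mb) * (p * (eps * (rho K eps x)^-1)) + 4 * beta ^+ 2 * eps.
    have h1 := bom_sqr beta p K1 e01 xI.
    have h2 : x ^+ 2 / rho K eps x ^+ 2 <= (rho K eps x)^-1.
      rewrite ler_pdivrMr ?exprn_gt0// expr2 mulrA mulVf ?gt_eqF// mul1r /rho.
      by rewrite lerDr mulr_ge0 ?(ltW e0).
    have h3 : b x <= Mb.
      by have := hMb x xI; rewrite ler_norml => /andP[].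
    have h4 : p ^+ 2 * (eps * (x ^+ 2 / rho K eps x ^+ 2)) <=
        p ^+ 2 * (eps * (rho K eps x)^-1).
      by rewrite ler_wpM2l ?sqr_ge0// ler_wpM2l// ltW.
    have h5 : q eps x <= K * Mb * (p * (eps * (rho K eps x)^-1)).
      rewrite /q (_ : K * Mb * _ = p * K * eps * (Mb * (rho K eps x)^-1)); last ring.
      apply: ler_wpM2l; first by rewrite mulr_ge0 ?(ltW e0)// mulr_ge0.
      by apply: ler_wpM2r => //; rewrite invr_ge0 ltW.
    rewrite (_ : (4 * p + K * Mb) * (p * (eps * (rho K eps x)^-1)) =
      4 * (p ^+ 2 * (eps * (rho K eps x)^-1)) +
      K * Mb * (p * (eps * (rho K eps x)^-1))); last by ring.
    rewrite /om [X in _ <= X]addrAC; apply: lerD; last exact: h5.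
    apply: (le_trans h1).
    by apply: lerD => //; rewrite -mulrA; apply: ler_wpM2l.
  have V2 := sqr_ge0 (V i x).
  have hWV : W eps x * V i x ^+ 2 <= expR beta * wt K eps p x * V i x ^+ 2.
    by rewrite ler_wpM2r.
  have WV0 : 0 <= W eps x * V i x ^+ 2 by rewrite mulr_ge0.
  apply: le_trans (ler_wpM2r WV0 hq) _.
  have hc0 : 0 <= (4 * p + K * Mb) * (p * (eps * (rho K eps x)^-1))
      + 4 * beta ^+ 2 * eps.
    rewrite addr_ge0 ?mulr_ge0 ?sqr_ge0 ?invr_ge0 ?(ltW r0) ?(ltW e0)//.
    by rewrite addr_ge0 ?mulr_ge0.
  apply: le_trans (ler_wpM2l hc0 hWV) _.
  have -> : wt K eps p x = wt K eps (p - 1) x * rho K eps x.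
    by rewrite -(wt1 K1 e01) -wtD subrK.
  rewrite le_eqVlt; apply/orP; left; apply/eqP; field; by rewrite gt_eqF.
have hr := robin_bd i0 im1 hend.
pose r e eps V := - eps * V i.+1 e + A 0%N e * V i e.
have I1 : (1 : R) = 1 \/ (1 : R) = -1 by left.
have Im1 : (-1 : R) = 1 \/ (-1 : R) = -1 by right.
have b1 := b0 (endI I1); have bm1 := b0 (endI Im1).
pose Mw := expR beta * expR (p * ln (K + 1)).
have Wle e eps : e = 1 \/ e = -1 -> 0 < eps <= 1 -> 1 <= W eps e <= Mw.
  move=> he e01; apply/andP; split.
    apply: le_trans (bwt_ge K p beta0 eps e); exact: wt_end_ge1.
  apply: le_trans (bwt_le K p beta0 eps (endI he)) _.
  by rewrite ler_wpM2l ?expR_ge0// wt_le// endI.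
pose QB eps V := Mw * (r 1 eps V ^+ 2 / b 1) + Mw * (r (-1) eps V ^+ 2 / b (-1)).
have hr2 e : e = 1 \/ e = -1 -> ubd (fun eps V => Mw * (r e eps V ^+ 2 / b e)).
  move=> he; have [M' hM'] := ubdM (hr e he) (hr e he).
  exists (Mw * (M' / b e)) => eps V hs; apply: ler_wpM2l.
    by rewrite mulr_ge0 ?expR_ge0.
  rewrite ler_pM2r ?invr_gt0 ?b0 ?endI//.
  by apply: le_trans (hM' _ _ hs); rewrite expr2; exact: ler_norm.
have hQB : ubd QB by exact: ubdD (hr2 _ I1) (hr2 _ Im1).
(* In a boundary term, t is the Robin quantity. *)
have aux (w bb v t : R) : 0 < bb -> 1 <= w <= Mw ->
    4^-1 * bb * v ^+ 2 - Mw * (t ^+ 2 / bb) <= w * (2^-1 * bb * v ^+ 2 + t * v).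
  move=> bb0 /andP[w1 w2].
  have h1 : 0 <= t ^+ 2 / bb by rewrite divr_ge0 ?sqr_ge0// ltW.
  have h2 : 0 <= (2^-1 * bb * v + t) ^+ 2 / bb by rewrite divr_ge0 ?sqr_ge0// ltW.
  have h3 : 2^-1 * bb * v ^+ 2 + t * v =
      4^-1 * bb * v ^+ 2 + (2^-1 * bb * v + t) ^+ 2 / bb - t ^+ 2 / bb.
    by field; rewrite gt_eqF.
  have h4 : 0 <= 4^-1 * bb * v ^+ 2.
    by apply: mulr_ge0; [rewrite mulr_ge0// ltW|exact: sqr_ge0].
  have w1' : 0 <= w - 1 by rewrite subr_ge0.
  have w0 : 0 <= w by exact: le_trans w1.
  have w2' : 0 <= Mw - w by rewrite subr_ge0.
  have := mulr_ge0 w1' h4; have := mulr_ge0 w0 h2; have := mulr_ge0 w2' h1.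
  rewrite h3; move: (_ ^+ 2 / bb) (_ ^+ 2 / bb) (4^-1 * _ * _) => X Y Z.
  lra.
pose Bd eps V := (W eps 1 * (2^-1 * A 0%N 1 * V i 1 ^+ 2 - eps * V i 1 * V i.+1 1)
     - W eps (-1) * (2^-1 * A 0%N (-1) * V i (-1) ^+ 2
        - eps * V i (-1) * V i.+1 (-1))).
have hBd eps V : sol eps V ->
    4^-1 * b 1 * V i 1 ^+ 2 + 4^-1 * b (-1) * V i (-1) ^+ 2 - QB eps V <= Bd eps V.
  move=> hs; have e01 := sol_eps hs.
  (* With r = - eps v' + a v, the product a v^2 / 2 - eps v v' becomes - a v^2 / 2 + r v. As a = -b
     at 1 and a = b at -1, and the term at -1 is subtracted, both squares get the factor +b / 2. *)
  have -> : Bd eps V = W eps 1 * (2^-1 * b 1 * V i 1 ^+ 2 + r 1 eps V * V i 1)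
    + W eps (-1) * (2^-1 * b (-1) * V i (-1) ^+ 2 + (- r (-1) eps V) * V i (-1)).
    by rewrite /Bd /r (Ab (endI I1)) (Ab (endI Im1)); field.
  have k1 := aux _ _ (V i 1) (r 1 eps V) b1 (Wle _ _ I1 e01).
  have k2 := aux _ _ (V i (-1)) (- r (-1) eps V) bm1 (Wle _ _ Im1 e01).
  by rewrite sqrrN in k2; rewrite /QB; lra.
have lhs0 : forall eps V, sol eps V -> 0 <= itg (-1) 1
    (fun x => 2^-1 * (eps * (W eps x * V i.+1 x ^+ 2) + kap * (W eps x * V i x ^+ 2))).
  move=> eps V hs; apply: itg_ge0 => x _; have /andP[e0 _] := sol_eps hs.
  have [_ _ _ W0 _] := cW _ (sol_eps hs).
  rewrite mulr_ge0// addr_ge0// mulr_ge0 ?(ltW e0) ?(ltW kap0)//;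
    by rewrite mulr_ge0 ?sqr_ge0.
(* The integral on the left is nonnegative, so the inequality bounds the squares at the end points
   as well. *)
have hV e : e = 1 \/ e = -1 -> ubd (fun eps V => V i e ^+ 2).
  have [MQ hMQ] := hQB.
  have key eps V : sol eps V ->
      4^-1 * b 1 * V i 1 ^+ 2 + 4^-1 * b (-1) * V i (-1) ^+ 2 <= M + MQ.
    move=> hs; have := hBd _ _ hs; have := hMQ _ _ hs; have := lhs0 _ _ hs.
    have := hM _ _ hs; rewrite -/(Bd eps V); lra.
  move=> [->|->]; [exists ((M + MQ) * (4 / b 1))|exists ((M + MQ) * (4 / b (-1)))];
    move=> eps V hs; rewrite mulrA ler_pdivlMr//; have := key _ _ hs;
    have := mulr_ge0 (ltW b1) (sqr_ge0 (V i 1));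
    have := mulr_ge0 (ltW bm1) (sqr_ge0 (V i (-1))); lra.
have [||||hv hv1] := @energy_split _ A C F m kap (fun _ V => V i) (fun _ V => V i.+1)
  W Bd kap0.
- by move=> eps V /c0[].
- by move=> eps /cW[].
- by exists M => eps V hs; exact: (hM _ _ hs).
- apply: ubd_le hQB _ => eps V hs; have := hBd _ _ hs.
  have := mulr_ge0 (ltW b1) (sqr_ge0 (V i 1)).
  have := mulr_ge0 (ltW bm1) (sqr_ge0 (V i (-1))); lra.
have cwV eps V j : sol eps V -> (j <= m)%N ->
    ctn (-1) 1 (fun x => wt K eps p x * V j x ^+ 2).
  move=> hs jm; apply: ctnM; first exact: (ctn_wt K1 (sol_eps hs)).
  exact/ctnX/(cV _ _ _ hs).
split; last exact: end_from_robin.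
- apply: (bdJ_le hv) => eps V hs; first exact: (cwV _ _ _ hs).
  by move=> x _; rewrite ler_wpM2r ?sqr_ge0// bwt_ge.
- apply: (bdJ_le hv1) => eps V hs.
    by apply: ctnM; [exact: ctn_cst|exact: (cwV _ _ _ hs)].
  move=> x _; have /andP[e0 _] := sol_eps hs.
  by rewrite ler_wpM2l ?(ltW e0)// ler_wpM2r ?sqr_ge0// bwt_ge.
Qed.

End Step.

(** * Oscillation bounds by integrals of the derivative *)

Section Oscillation.
Context {R : realType}.
Implicit Types (l r x y : R) (f g : R -> R).

Lemma le_norm_itg l r f : ctn l r f -> `|itg l r f| <= itg l r (fun x => `|f x|).
Proof.
move=> cf; have i1 := ctn_itgbl cf; have i2 := ctn_itgbl (ctn_abs cf).
rewrite ler_norml; apply/andP; split.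
  rewrite -[X in - X]mul1r -mulNr -itgZ//; apply: itg_le => //.
    exact: itgblZ.
  by move=> x _; rewrite mulN1r lerNl -normrN ler_norm.
by apply: itg_le => // x _; exact: ler_norm.
Qed.

Lemma cauchy_schwarz1 l r f : l <= r -> ctn l r f ->
  (itg l r (fun x => `|f x|)) ^+ 2 <= (r - l) * itg l r (fun x => f x ^+ 2).
Proof.
rewrite le_eqVlt => /predU1P[<-|lr] cf; first by rewrite !itg_empty subrr mulr0 expr0n.
set I := itg l r (fun x => `|f x|); set D := itg l r (fun x => f x ^+ 2).
have I0 : 0 <= I by exact: itg_ge0.
have D0 : 0 <= D by apply: itg_ge0 => x _; exact: sqr_ge0.
have i1 := ctn_itgbl (ctn_abs cf); have i2 := ctn_itgbl (ctnX 2 cf).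
have rl : 0 < r - l by rewrite subr_gt0.
have [->|In0] := eqVneq I 0; first by rewrite expr0n mulr_ge0// ltW.
have {}I0 : 0 < I by rewrite lt_neqAle eq_sym In0.
(* Young's inequality |f| <= (t + f^2 / t) / 2 with the mean [t] of |f|: the integral of t / 2 is I
   / 2 and is absorbed on the left. *)
pose t := I / (r - l); have t0 : 0 < t by rewrite divr_gt0.
have h : I <= itg l r (fun x => 2^-1 * (t + t^-1 * f x ^+ 2)).
  apply: itg_le => //.
    by apply: itgblZ; apply: itgblD; [exact: itgbl_cst|exact: itgblZ].
  move=> x _; rewrite -[f x ^+ 2]real_normK ?num_real//.
  set y := `|f x|.
  have : 0 <= t^-1 * (y - t) ^+ 2 by rewrite mulr_ge0 ?sqr_ge0// invr_ge0 ltW.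
  rewrite (_ : t^-1 * (y - t) ^+ 2 = t + t^-1 * y ^+ 2 - 2 * y); first lra.
  by field; rewrite gt_eqF.
move: h; rewrite itgZ; last by apply: itgblD; [exact: itgbl_cst|exact: itgblZ].
rewrite itgD//; [|exact: itgbl_cst|exact: itgblZ].
rewrite itg_cst ?(ltW lr)// itgZ// -/D => h.
have e1 : t * (r - l) = I by rewrite /t divfK// gt_eqF.
have e2 : t^-1 * D = (r - l) * D / I by rewrite /t; field; rewrite !gt_eqF.
move: h; rewrite e1 e2 => h.
have : I <= (r - l) * D / I by lra.
by rewrite ler_pdivlMr// expr2.
Qed.

Lemma osc f f1 x y : ctn (-1) 1 f -> ctn (-1) 1 f1 -> drv (-1) 1 f f1 ->
  -1 <= x -> x <= y -> y <= 1 ->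
  `|f y - f x| <= itg x y (fun x => `|f1 x|).
Proof.
move=> cf cf1 df x1 xy y1.
rewrite -(ftc xy (ctn_sub x1 y1 cf) (ctn_sub x1 y1 cf1) (drv_sub x1 y1 df)).
by apply: le_norm_itg; exact: ctn_sub cf1.
Qed.

Lemma osc_le f f1 x y : ctn (-1) 1 f -> ctn (-1) 1 f1 -> drv (-1) 1 f f1 ->
  -1 <= x <= 1 -> -1 <= y <= 1 ->
  `|f y - f x| <= itg (-1) 1 (fun x => `|f1 x|).
Proof.
move=> cf cf1 df.
have main x' y' : -1 <= x' -> x' <= y' -> y' <= 1 ->
    `|f y' - f x'| <= itg (-1) 1 (fun x => `|f1 x|).
  move=> h1 h2 h3; apply: le_trans (osc cf cf1 df h1 h2 h3) _.
  by apply: itg_sub_le => //; exact/ctn_itgbl/ctn_abs.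
move=> /andP[x1 x2] /andP[y1 y2]; have [xy|/ltW yx] := leP x y; first exact: main.
by rewrite distrC; exact: main.
Qed.

Lemma holder g g1 x : ctn (-1) 1 g -> ctn (-1) 1 g1 -> drv (-1) 1 g g1 ->
  -1 <= x <= 1 ->
  (g x - g 0) ^+ 2 <= `|x| * itg (-1) 1 (fun x => g1 x ^+ 2).
Proof.
move=> cg cg1 dg /andP[x1 x2].
have main l r : -1 <= l -> l <= r -> r <= 1 ->
    (g r - g l) ^+ 2 <= (r - l) * itg (-1) 1 (fun x => g1 x ^+ 2).
  move=> l1 lr r1; have cg1' := ctn_sub l1 r1 cg1.
  have h1 := osc cg cg1 dg l1 lr r1; have h2 := cauchy_schwarz1 lr cg1'.
  have h3 : itg l r (fun x => g1 x ^+ 2) <= itg (-1) 1 (fun x => g1 x ^+ 2).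
    apply: itg_sub_le => //; first exact/ctn_itgbl/ctnX.
    by move=> z _; exact: sqr_ge0.
  rewrite -[_ ^+ 2]real_normK ?num_real//.
  apply: le_trans (_ : _ <= (itg l r (fun x => `|g1 x|)) ^+ 2) _.
    by rewrite lerXn2r// nnegrE// (le_trans _ h1).
  by apply: le_trans h2 _; rewrite ler_wpM2l// subr_ge0.
have [x0|/ltW x0] := leP 0 x.
  by have := main 0 x ltac:(lra) x0 x2; rewrite subr0 ger0_norm.
have := main x 0 x1 x0 ltac:(lra); rewrite sub0r ler0_norm//.
by rewrite -[_ ^+ 2]sqrrN opprB.
Qed.

End Oscillation.

(** * Correcting the n-th derivative at the turning point *)

Section Special.
Context {R : realType} (A C F : nat -> R -> R) (b : R -> R) (m : nat).
Context (jA : jet m A) (jC : jet m C) (jF : jet m F) (cb : ctn (-1) 1 b).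
Context (Ab : forall x : R, -1 <= x <= 1 -> A 0%N x = - x * b x)
  (b0 : forall x : R, -1 <= x <= 1 -> 0 < b x).
Local Notation sol := (sol A C F m).
Local Notation bdJ := (bdJ A C F m).
Local Notation ubd := (ubd A C F m).
Local Notation gterm := (gterm A C).
Local Notation dcoef := (dcoef A C).
Local Notation bd_end := (bd_end A C F m).
Implicit Types (eps x p K e : R) (V : nat -> R -> R) (i j : nat).

Lemma sup_bd j : (j < m)%N ->
  bdJ (fun eps V x => `|V j.+1 x|) -> bd_end j ->
  exists2 M : R, 0 <= M & forall eps V, sol eps V -> forall x, -1 <= x <= 1 ->
    `|V j x| <= M.
Proof.
move=> jm [M1 h1] /(_ 1 (or_introl erefl))[[M2 h2] _].
exists (Num.max 0 (M1 + M2)); first by rewrite le_max lexx.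
move=> eps V hs x xI; rewrite le_max; apply/orP; right.
have jm' := ltnW jm.
have := @osc_le R (V j) (V j.+1) 1 x (ctn_V hs jm') (ctn_V hs jm) (sol_drv hs jm)
  (endI (or_introl erefl)) xI.
have [_ k1] := h1 _ _ hs; have k2 := h2 _ _ hs; move=> k3.
rewrite -(subrK (V j 1) (V j x)); apply: le_trans (ler_normD _ _) _.
by apply: lerD => //; exact: le_trans k1.
Qed.

Lemma bdJ_abs_of_sqr j : (j <= m)%N -> bdJ (fun eps V x => V j x ^+ 2) ->
  bdJ (fun eps V x => `|V j x|).
Proof.
move=> jm h; apply: (bdJ_le (bdJD (bdJ_cst A C F m 1) h)) => eps V hs.
  exact/ctn_abs/(ctn_V hs).
move=> x _; rewrite -[V j x ^+ 2]real_normK ?num_real//; set y := `|V j x|.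
have := sqr_ge0 (y - 1); have := sqr_ge0 y; nra.
Qed.

(* The value of kappa for which the function V n - kappa (1 - x^2) has a right-hand
   side vanishing at 0; this right-hand side is gsub. *)
Definition kappa0 n eps V : R := gterm n eps V 0 / (2 * eps + dcoef n 0).

(** The numerator is a lower order term, and the values of [V j] at 0 for j < n are bounded because
    [V j.+1] is bounded in L^1. The denominator exceeds c(0) - n b(0) > 0. *)
Lemma kappa0_bd n : (n.+2 <= m)%N -> 0 < C 0%N 0 - n%:R * b 0 ->
  (forall j, (j <= n)%N -> bdJ (fun eps V x => V j x ^+ 2)) ->
  (forall j, (j < n)%N -> bd_end j) ->
  exists2 M : R, 0 <= M & forall eps V, sol eps V -> `|kappa0 n eps V| <= M.
Proof.
move=> nm d0 hV hend; have I0 : (-1 : R) <= (0 : R) <= 1 by lra.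
have [M M0 hM] := lower_gterm jA jC jF nm.
have hs0 j : (j < n)%N -> ubd (fun _ V => `|V j 0|).
  move=> jn; have [|||M' _ hM'] := @sup_bd j.
  - lia.
  - by apply: bdJ_abs_of_sqr; [lia|exact: hV].
  - exact: hend.
  by exists M' => eps V hs; exact: (hM' _ _ hs).
have [S S0 hS] := ubd_pos (ubd_sum hs0).
have dE : dcoef n 0 = C 0%N 0 - n%:R * b 0.
  rewrite /dcoef (A1_0 jA cb Ab); last lia.
  by rewrite mulrN.
exists (M * (1 + S) / dcoef n 0).
  have d1 : 0 <= dcoef n 0 by rewrite dE ltW.
  by apply: divr_ge0 => //; rewrite mulr_ge0 ?addr_ge0.
move=> eps V hs; have /andP[e0 _] := sol_eps hs.
have k0 : 0 < 2 * eps + dcoef n 0 by rewrite dE; lra.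
rewrite normrM normfV (gtr0_norm k0).
have k1 : `|gterm n eps V 0| <= M * (1 + S).
  apply: le_trans (hM _ _ hs 0 I0) _; apply: ler_wpM2l => //.
  by apply: lerD => //; exact: (hS _ _ hs).
apply: ler_pM => //; first by rewrite invr_ge0 ltW.
by rewrite lef_pV2 ?posrE ?dE//; lra.
Qed.

(** The bracket is the operator of order n applied to 1 - x^2; at 0 it equals 2 eps + [dcoef n 0],
    the denominator of [kappa0]. *)
Definition gsub n eps V x : R := gterm n eps V x - kappa0 n eps V *
  (2 * eps - 2 * x * A 0%N x + dcoef n x * (1 - x ^+ 2)).

(** The derivative of [gsub] is a lower order term of the equation of order n + 1, up to a multiple
    of [V n] and a bounded function, so it is bounded in L^2. [holder] applies because [gsub]
    vanishes at 0. *)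
Lemma gsub_bd n : (n.+3 <= m)%N -> 0 < C 0%N 0 - n%:R * b 0 ->
  (forall j, (j <= n)%N -> bdJ (fun eps V x => V j x ^+ 2)) ->
  (forall j, (j < n)%N -> bd_end j) ->
  exists2 D : R, 0 <= D & forall eps V, sol eps V -> forall x, -1 <= x <= 1 ->
    gsub n eps V x ^+ 2 <= D * `|x|.
Proof.
move=> nm d0 hV hend.
have m1 : (1 <= m)%N by apply: leq_trans nm.
have m2 : (2 <= m)%N by apply: leq_trans nm.
have n1m : (n < m)%N by apply: leq_trans nm; rewrite ltnS ltnW.
have nm0 := ltnW n1m; have I0 : (-1 : R) <= (0 : R) <= 1 by lra.
have [Mk Mk0 hMk] := kappa0_bd (ltnW nm) d0 hV hend.
have hg : bdJ (fun eps V x => wt 1 eps 0 x * gterm n.+1 eps V x ^+ 2).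
  apply: (bdJ_gterm jA jC jF) => //; first by apply: bdJ_wt => //; lra.
  move=> j; rewrite ltnS => jn; apply: (bdJ_le (hV j jn)) => eps V hs.
    by apply: ctnM; [exact: (ctn_wt (lexx 1) (sol_eps hs))|
      exact: (ctnX 2 (ctn_V hs (leq_trans jn nm0)))].
  by move=> x _; rewrite wt0 mul1r.
pose e1 x := C 1%N x + n%:R * A 2 x.
have ce1 : ctn (-1) 1 e1.
  by apply: ctnD; [exact: jC.1|apply: ctnM; [exact: ctn_cst|exact: jA.1]].
pose h1 x := - (2 * A 0%N x + 2 * x * A 1%N x) +
  (e1 x * (1 - x ^+ 2) + dcoef n x * (- (2 * x))).
have ch : ctn (-1) 1 h1.
  have c2x : ctn (-1) 1 (fun x : R => 2 * x) by apply: ctnM; [exact: ctn_cst|exact: ctn_id].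
  apply: ctnD.
    apply: ctnN; apply: ctnD; apply: ctnM => //; first exact: ctn_cst.
      exact: jA.1.
    exact: jA.1.
  apply: ctnD; apply: ctnM => //.
  - by apply: ctnD; [exact: ctn_cst|apply/ctnN/ctnX/ctn_id].
  - exact: (ctn_dcoef jA jC).
  - exact: ctnN.
have [Me Me0 hMe] := ctn_bounded ce1; have [Mh Mh0 hMh] := ctn_bounded ch.
pose g1 eps V x := gterm n.+1 eps V x + e1 x * V n x - kappa0 n eps V * h1 x.
have cg1 eps V : sol eps V -> ctn (-1) 1 (g1 eps V).
  move=> hs; apply: ctnD; first apply: ctnD.
  - exact: (ctn_gterm jA jC hs).
  - apply: ctnM => //; exact: (ctn_V hs nm0).
  - by apply: ctnN; apply: ctnM => //; exact: ctn_cst.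
have hg1 : bdJ (fun eps V x => g1 eps V x ^+ 2).
  have Me20 : 0 <= 3 * Me ^+ 2 by rewrite mulr_ge0 ?sqr_ge0.
  apply: (bdJ_le (bdJD (bdJD (bdJZ (ler0n R 3) hg) (bdJZ Me20 (hV n (leqnn n))))
     (bdJ_cst A C F m (3 * (Mk * Mh) ^+ 2)))) => eps V hs.
    exact/ctnX/cg1.
  move=> x /andP[x1 x2]; have xI : -1 <= x <= 1 by rewrite !ltW.
  rewrite wt0 mul1r /g1.
  set T1 := gterm _ _ _ _; set T2 := e1 x * _; set T3 := kappa0 _ _ _ * _.
  have k2 : T2 ^+ 2 <= Me ^+ 2 * V n x ^+ 2.
    rewrite exprMn ler_wpM2r ?sqr_ge0// -[_ ^+ 2]real_normK ?num_real//.
    by rewrite lerXn2r// ?nnegrE// hMe.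
  have k3 : T3 ^+ 2 <= (Mk * Mh) ^+ 2.
    rewrite -[T3 ^+ 2]real_normK ?num_real// lerXn2r// ?nnegrE ?mulr_ge0//.
    by rewrite normrM ler_pM// ?hMh// (hMk _ _ hs).
  have k4 : (T1 + T2 - T3) ^+ 2 <= 3 * T1 ^+ 2 + 3 * T2 ^+ 2 + 3 * T3 ^+ 2.
    have := sqr_ge0 (T1 - T2); have := sqr_ge0 (T1 + T3); have := sqr_ge0 (T2 + T3).
    nra.
  lra.
have [D hD] := hg1.
exists (Num.max 0 D); first by rewrite le_max lexx.
move=> eps V hs x xI.
have /andP[eps0 _] := sol_eps hs.
have dE : dcoef n 0 = C 0%N 0 - n%:R * b 0.
  by rewrite /dcoef (A1_0 jA cb Ab m1) mulrN.
have g00 : gsub n eps V 0 = 0.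
  rewrite /gsub /kappa0 expr0n/= mulr0 mul0r !subr0 mulr1 divfK ?subrr// gt_eqF//.
  by rewrite dE; lra.
have dg : drv (-1) 1 (gsub n eps V) (g1 eps V).
  have i1 := jA.2 0%N m1.
  have i2 := drvD (jC.2 0%N m1) (drvZ n%:R (jA.2 1%N m2)).
  have i3 := drvD (drv_cst (-1) 1 1) (drvN (drvX 2 (drv_id (-1 : R) 1))).
  have i4 := drvD (drvD (drv_cst (-1) 1 (2 * eps)) (drvN (drvM (drvZ 2 (drv_id (-1 : R) 1)) i1)))
    (drvM i2 i3).
  apply: (eq_drv (drvD (drv_gterm jA jC hs nm) (drvN (drvZ (kappa0 n eps V) i4)))).
  by move=> x0 _; rewrite /g1 /h1 /e1 /dcoef /=; ring.
have cgs : ctn (-1) 1 (gsub n eps V).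
  apply: ctnD; first exact: (ctn_gterm jA jC hs (ltnW nm)).
  apply: ctnN; apply: ctnM; first exact: ctn_cst.
  apply: ctnD; first apply: ctnD; first exact: ctn_cst.
    apply: ctnN; apply: ctnM; last exact: jA.1.
    by apply: ctnM; [exact: ctn_cst|exact: ctn_id].
  apply: ctnM; first exact: (ctn_dcoef jA jC).
  by apply: ctnD; [exact: ctn_cst|apply/ctnN/ctnX/ctn_id].
have := holder cgs (cg1 _ _ hs) dg xI; rewrite g00 subr0 mulrC => k.
apply: le_trans k _; apply: ler_wpM2r => //; rewrite le_max.
by have [_ ->] := hD _ _ hs; rewrite orbT.
Qed.

End Special.

(** * The energy of order n with a nonpositive exponent *)

Section SpecialStep.
Context {R : realType} (A C F : nat -> R -> R) (b : R -> R) (m : nat).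
Context (jA : jet m A) (jC : jet m C) (jF : jet m F) (cb : ctn (-1) 1 b).
Context (Ab : forall x : R, -1 <= x <= 1 -> A 0%N x = - x * b x)
  (b0 : forall x : R, -1 <= x <= 1 -> 0 < b x).
Local Notation sol := (sol A C F m).
Local Notation bdJ := (bdJ A C F m).
Local Notation ubd := (ubd A C F m).
Local Notation gterm := (gterm A C).
Local Notation dcoef := (dcoef A C).
Local Notation gsub := (gsub A C).
Local Notation kappa0 := (kappa0 A C).
Local Notation bd_end := (bd_end A C F m).
Implicit Types (eps x p K e : R) (V : nat -> R -> R) (i j : nat).

(** By [gsub_bd] the squared right-hand side times rho^p is of the size of rho^(p + 1/2), which
    [wt_itg] admits for every p > -1. Only the eps-part of the energy is kept: it is the defect met
    at order n + 1. *)
Lemma est_special n p : (n.+3 <= m)%N -> -1 < p -> p <= 0 ->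
  0 < C 0%N 0 - (n%:R - 2^-1) * b 0 + p * b 0 ->
  0 < C 0%N 0 - n%:R * b 0 ->
  (forall j, (j <= n)%N -> bdJ (fun eps V x => V j x ^+ 2)) ->
  (forall j, (j <= n)%N -> bd_end j) ->
  exists2 K : R, 1 <= K &
    bdJ (fun eps V x => eps * (wt K eps p x * V n.+1 x ^+ 2)).
Proof.
move=> nm p1 p0 G0 d0 hV hend.
have m1 : (1 <= m)%N by lia.
have nm2 : (n.+2 <= m)%N by lia.
have nm1 : (n.+1 <= m)%N by lia.
have nm0 : (n <= m)%N by lia.
pose G x := C 0%N x + (n%:R - 2^-1) * A 1%N x + p * b x.
have cG : ctn (-1) 1 G.
  apply: ctnD; last by apply: ctnM => //; exact: ctn_cst.
  by apply: ctnD; [exact: jC.1|apply: ctnM; [exact: ctn_cst|exact: jA.1]].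
have G00 : 0 < G 0 by rewrite /G (A1_0 jA cb Ab m1); lra.
have [beta [kap [beta0 kap0 hG]]] := ctn_pos_near0 cG cb b0 G00.
(* The defect 4 p^2 eps x^2 / rho^2 is at most 1 / K, and this choice puts it below kap / 2. *)
pose K := 1 + 2 / kap.
have K1 : 1 <= K by rewrite lerDl divr_ge0// ltW.
have K0 : 0 < K by exact: lt_le_trans K1.
have hK : K^-1 <= kap / 2.
  rewrite -[leRHS]invrK invf_div lef_pV2 ?posrE ?divr_gt0// /K; lra.
have hend' j : (j < n)%N -> bd_end j by move=> /ltnW; exact: hend.
have [Mk Mk0 hMk] := kappa0_bd jA jC jF cb Ab nm2 d0 hV hend'.
have [D D0 hD] := gsub_bd jA jC jF cb Ab nm d0 hV hend'.
exists K => //.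
(* The correction 1 - x^2 vanishes at 1 and -1, so the boundary values of [V n] are unchanged. *)
pose v eps V x := V n x - kappa0 n eps V * (1 - x ^+ 2).
pose v1 eps V x := V n.+1 x + kappa0 n eps V * (2 * x).
pose v2 eps V x := V n.+2 x + 2 * kappa0 n eps V.
pose W eps x := bwt K beta p eps x.
pose om eps x := bom K beta p eps x.
(* Half of the coercivity constant is given up in order to absorb the defect. *)
pose q (eps x : R) := - (kap / 2).
have c1x : ctn (-1) 1 (fun x : R => 1 - x ^+ 2).
  by apply: ctnD; [exact: ctn_cst|apply/ctnN/ctnX/ctn_id].
have c0 : forall eps V, sol eps V -> [/\ ctn (-1) 1 (v eps V), ctn (-1) 1 (v1 eps V),
    ctn (-1) 1 (v2 eps V) & ctn (-1) 1 (gsub n eps V)].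
  move=> eps V hs; split.
  - apply: ctnD; first exact: (ctn_V hs).
    by apply: ctnN; apply: ctnM => //; exact: ctn_cst.
  - apply: ctnD; first exact: (ctn_V hs).
    apply: ctnM; first exact: ctn_cst.
    by apply: ctnM; [exact: ctn_cst|exact: ctn_id].
  - by apply: ctnD; [exact: (ctn_V hs)|exact: ctn_cst].
  - apply: ctnD; first exact: (ctn_gterm jA jC hs).
    apply: ctnN; apply: ctnM; first exact: ctn_cst.
    apply: ctnD; last by apply: ctnM => //; exact: (ctn_dcoef jA jC).
    apply: ctnD; first exact: ctn_cst.
    apply: ctnN; apply: ctnM; last exact: jA.1.
    by apply: ctnM; [exact: ctn_cst|exact: ctn_id].
have cW : forall eps, 0 < eps <= 1 -> [/\ ctn (-1) 1 (W eps), ctn (-1) 1 (om eps),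
     ctn (-1) 1 (q eps), (forall x, 0 <= W eps x) &
     drv (-1) 1 (W eps) (fun x => om eps x * W eps x)].
  move=> eps e01; split; [exact: ctn_bwt|exact: ctn_bom|exact: ctn_cst| |exact: drv_bwt].
  by move=> x; exact: bwt_ge0.
have dv : forall eps V, sol eps V -> drv (-1) 1 (v eps V) (v1 eps V) /\
     drv (-1) 1 (v1 eps V) (v2 eps V).
  move=> eps V hs; split.
    have h := drvD (drv_cst (-1) 1 1) (drvN (drvX 2 (drv_id (-1 : R) 1))).
    apply: (eq_drv (drvD (sol_drv hs nm1) (drvN (drvZ (kappa0 n eps V) h)))).
    by move=> x _; rewrite /v1 /=; ring.
  apply: (eq_drv (drvD (sol_drv hs nm2)
    (drvZ (kappa0 n eps V) (drvZ 2 (drv_id (-1 : R) 1))))).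
  by move=> x _; rewrite /v2 /=; ring.
have eqv : forall eps V, sol eps V -> forall x, -1 < x < 1 ->
     - eps * v2 eps V x + A 0%N x * v1 eps V x + dcoef n x * v eps V x = gsub n eps V x.
  by move=> eps V hs x _; rewrite /v2 /v1 /v /gsub /gterm; ring.
have kap20 : 0 < kap / 2 by rewrite divr_gt0.
have xle eps x : 0 < eps <= 1 -> 0 <= x ^+ 2 / rho K eps x <= 1.
  move=> e01; have r0 := rho_gt0 K1 e01 x; have /andP[e0 _] := e01.
  rewrite divr_ge0 ?sqr_ge0 ?(ltW r0)//= ler_pdivrMr// mul1r /rho lerDr.
  by rewrite mulr_ge0// ltW.
have co : forall eps x, 0 < eps <= 1 -> -1 < x < 1 ->
    kap / 2 <= dcoef n x - 2^-1 * A 1%N x - 2^-1 * A 0%N x * om eps x + q eps x.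
  move=> eps x e01 /andP[x1 x2]; have r0 := rho_gt0 K1 e01 x.
  have xI : -1 <= x <= 1 by rewrite !ltW.
  have /andP[t0 t1] := xle eps x e01.
  have h1 := hG x xI.
  have -> : dcoef n x - 2^-1 * A 1%N x - 2^-1 * A 0%N x * om eps x + q eps x =
    G x + beta * (b x * x ^+ 2) + (- p * b x) * (1 - x ^+ 2 / rho K eps x) - kap / 2.
    by rewrite /G /dcoef /om /bom /q Ab//; field; rewrite gt_eqF.
  (* Because p <= 0, the contribution p b x^2 / rho of the weight is at least the term p b in [G];
     no defect arises here. *)
  have : 0 <= (- p * b x) * (1 - x ^+ 2 / rho K eps x).
    by rewrite mulr_ge0 ?subr_ge0// mulr_ge0 ?oppr_ge0// ltW// b0.
  lra.
pose c1 := expR beta * D / kap.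
pose c2 := 4 * beta ^+ 2 * (expR beta * expR ((p + 1) * ln (K + 1))).
have c10 : 0 <= c1 by rewrite divr_ge0 ?mulr_ge0 ?expR_ge0// ltW.
have c20 : 0 <= c2.
  by rewrite /c2; apply: mulr_ge0; [apply: mulr_ge0 => //; exact: sqr_ge0|
    apply: mulr_ge0; exact: expR_ge0].
have epsW eps x : 0 < eps <= 1 -> -1 <= x <= 1 ->
    eps * W eps x <= expR beta * expR ((p + 1) * ln (K + 1)).
  move=> e01 xI; have /andP[e0 _] := e01.
  apply: le_trans (ler_wpM2l (ltW e0) (bwt_le K p beta0 eps xI)) _.
  rewrite mulrCA; apply: ler_wpM2l; first exact: expR_ge0.
  by apply: epswt_le => //; exact: ltW.
have hv2 eps V x : sol eps V -> -1 <= x <= 1 ->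
    v eps V x ^+ 2 <= 2 * V n x ^+ 2 + 2 * Mk ^+ 2.
  move=> hs /andP[x1 x2]; set t := kappa0 n eps V * (1 - x ^+ 2).
  have ht : t ^+ 2 <= Mk ^+ 2.
    rewrite -[t ^+ 2]real_normK ?num_real// lerXn2r// ?nnegrE//.
    rewrite normrM -[Mk]mulr1; apply: ler_pM => //; first exact: (hMk _ _ hs).
    by rewrite ler_norml; clear - jA jC jF cb Ab b0 x1 x2; nra.
  rewrite /v -/t; move: (V n x) t ht => y t ht.
  by have := sqr_ge0 (y + t); clear - jA jC jF cb Ab b0 ht; nra.
have rhs : bdJ (fun eps V x => (2 * (kap / 2))^-1 * (W eps x * gsub n eps V x ^+ 2)
    + (2^-1 * eps * om eps x ^+ 2 + q eps x) * (W eps x * v eps V x ^+ 2)).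
  have hw := bdJ_wt A C F m K1 (ltac:(clear - jA jC jF cb Ab b0 p1; lra) : - 2^-1 < p + 2^-1).
  apply: (bdJ_le (bdJD (bdJZ c10 hw) (bdJZ c20 (bdJD (bdJZ (ler0n R 2) (hV n (leqnn n)))
     (bdJ_cst A C F m (2 * Mk ^+ 2)))))) => eps V hs.
    have [q1 q2 q3 q4] := c0 _ _ hs; have [q5 q6 q7 _ _] := cW _ (sol_eps hs).
    apply: ctnD; apply: ctnM.
    + exact: ctn_cst.
    + by apply: ctnM => //; exact: ctnX.
    + by apply: ctnD => //; apply: ctnM; [exact: ctn_cst|exact: ctnX].
    + by apply: ctnM => //; exact: ctnX.
  move=> x /andP[x1 x2]; have e01 := sol_eps hs; have /andP[e0 _] := e01.
  have xI : -1 <= x <= 1 by rewrite !ltW.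
  have r0 := rho_gt0 K1 e01 x; have W0 := bwt_ge0 K beta p eps x.
  apply: lerD.
    have xw : `|x| <= wt K eps 2^-1 x.
      rewrite -[leRHS]ger0_norm ?expR_ge0// -ler_sqr ?nnegrE// !real_normK ?num_real//.
      rewrite [leRHS]expr2 -wtD (_ : 2^-1 + 2^-1 = 1 :> R); last by field.
      by rewrite (wt1 K1 e01) /rho lerDr mulr_ge0 ?(ltW e0) ?(ltW K0).
    have k1 : gsub n eps V x ^+ 2 <= D * wt K eps 2^-1 x.
      by apply: le_trans (hD _ _ hs x xI) _; apply: ler_wpM2l.
    have k2 := bwt_le K p beta0 eps xI.
    have -> : c1 * wt K eps (p + 2^-1) x = (2 * (kap / 2))^-1 *
       ((expR beta * wt K eps p x) * (D * wt K eps 2^-1 x)).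
      by rewrite wtD /c1; field; rewrite gt_eqF.
    apply: ler_wpM2l; first by rewrite invr_ge0 mulr_ge0// ltW.
    by apply: ler_pM => //; exact: sqr_ge0.
  have k1 := bom_sqr beta p K1 e01 xI.
  have k2 : eps * (x ^+ 2 / rho K eps x ^+ 2) <= (4 * K)^-1.
    (* The inequality 4 K eps x^2 <= (K eps + x^2)^2, written as an identity. *)
    have k0 : (4 * K)^-1 - eps * (x ^+ 2 / rho K eps x ^+ 2) =
        (K * eps - x ^+ 2) ^+ 2 / (4 * K * rho K eps x ^+ 2).
      by move: r0; rewrite /rho => r0; field; rewrite !gt_eqF.
    rewrite -subr_ge0 k0; apply: divr_ge0; first exact: sqr_ge0.
    by apply: mulr_ge0; [rewrite mulr_ge0// ltW|exact: sqr_ge0].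
  have p2 : p ^+ 2 <= 1 by clear - jA jC jF cb Ab b0 p1 p0; nra.
  have k3 : 2^-1 * eps * om eps x ^+ 2 + q eps x <= 4 * beta ^+ 2 * eps.
    have k4 : 4 * p ^+ 2 * (eps * (x ^+ 2 / rho K eps x ^+ 2)) <= K^-1.
      rewrite (_ : K^-1 = 4 * 1 * (4 * K)^-1); last by field; rewrite gt_eqF.
      apply: ler_pM; [by rewrite mulr_ge0 ?sqr_ge0| |by rewrite ler_wpM2l|by []].
      by rewrite mulr_ge0 ?(ltW e0)// divr_ge0 ?sqr_ge0.
    rewrite /om /q; clear - jA jC jF cb Ab b0 hK e0 k1 k2 k4; lra.
  have k4 := hv2 eps V x hs xI.
  have v20 := sqr_ge0 (v eps V x).
  have Wv0 : 0 <= W eps x * v eps V x ^+ 2 by rewrite mulr_ge0.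
  apply: le_trans (ler_wpM2r Wv0 k3) _.
  rewrite (_ : 4 * beta ^+ 2 * eps * _ =
    4 * beta ^+ 2 * (eps * W eps x) * v eps V x ^+ 2); last by ring.
  have b20 : 0 <= 4 * beta ^+ 2 by apply: mulr_ge0 => //; exact: sqr_ge0.
  apply: ler_pM => //.
    by apply: mulr_ge0 => //; apply: mulr_ge0 => //; exact: ltW.
  by apply: ler_wpM2l => //; exact: epsW.
have hE := @energy_bd _ A C F m jA (kap / 2) (dcoef n) v v1 v2 (gsub n) W om q kap20
  m1 c0 cW dv eqv co rhs.
pose bterm e eps V :=
  W eps e * (2^-1 * A 0%N e * v eps V e ^+ 2 - eps * v eps V e * v1 eps V e).
have hb e : e = 1 \/ e = -1 -> ubd (fun eps V => `|bterm e eps V|).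
  move=> he; have eI := endI he.
  have e2 : e ^+ 2 = 1 by case: he => ->; rewrite ?sqrrN expr1n.
  have [u1 u2] := hend n (leqnn n) e he.
  have vE eps V : v eps V e = V n e by rewrite /v e2 subrr mulr0 subr0.
  have hk : ubd (fun eps V => `|2 * e * (eps * kappa0 n eps V)|).
    exists (2 * (1 * Mk)) => eps V hs; have /andP[e0 e1] := sol_eps hs.
    have ne : `|e| = 1 by case: he => ->; rewrite ?normrN normr1.
    have h : `|eps| * `|kappa0 n eps V| <= 1 * Mk.
      by apply: ler_pM => //; [rewrite gtr0_norm|exact: (hMk _ _ hs)].
    move: (kappa0 n eps V) h => t h.
    by rewrite !normrM ne mulr1 (@ger0_norm _ 2)// ler_wpM2l.
  have hW : ubd (fun eps V => `|W eps e|).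
    exists (expR beta * 1) => eps V hs; have /andP[e0 _] := sol_eps hs.
    rewrite ger0_norm ?bwt_ge0//; apply: le_trans (bwt_le K p beta0 eps eI) _.
    apply: ler_wpM2l; first exact: expR_ge0.
    rewrite -expR0 ler_expR mulr_le0_ge0// ln_ge0// /rho e2 lerDr.
    by rewrite mulr_ge0 ?(ltW e0) ?(ltW K0).
  have hA : ubd (fun eps V => `|2^-1 * A 0%N e|) by exact: ubd_cst.
  have := ubdM hW (ubd_normD (ubdM hA (ubdM u1 u1))
    (ubd_normD (Q := fun eps V => - (eps * V n.+1 e * V n e)) _
       (ubdM (Q := fun eps V => - (2 * e * (eps * kappa0 n eps V))) _ u1))).
  case.
  - by apply: ubd_le u2 _ => eps V _; rewrite normrN.
  - by apply: ubd_le hk _ => eps V _; rewrite normrN.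
  move=> M hM; exists M => eps V hs; apply: le_trans (hM _ _ hs).
  rewrite /bterm vE /v1 (_ : W eps e * _ = W eps e * (2^-1 * A 0%N e * (V n e * V n e) +
    (- (eps * V n.+1 e * V n e) + - (2 * e * (eps * kappa0 n eps V)) * V n e))) //.
  by ring.
have [||||_ hv1] := @energy_split _ A C F m (kap / 2) v v1 W
  (fun eps V => bterm 1 eps V - bterm (-1) eps V) kap20.
- by move=> eps V /c0[].
- by move=> eps /cW[].
- by case: hE => M hM; exists M => eps V hs; exact: (hM _ _ hs).
- apply: ubd_le (ubdD (hb 1 (or_introl erefl)) (hb (-1) (or_intror erefl))) _ => eps V _.
  have := ler_norm (- bterm 1 eps V); have := ler_norm (bterm (-1) eps V).
  by rewrite normrN; move: (bterm _ _ _) (bterm _ _ _) => y z; lra.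
(* Going back from [v1] to [V n.+1] costs a multiple of eps rho^p, which is bounded since p > -1. *)
pose c3 := 8 * Mk ^+ 2 * expR ((p + 1) * ln (K + 1)).
apply: (bdJ_le (bdJD (bdJZ (ler0n R 2) hv1) (bdJ_cst A C F m c3))) => eps V hs.
  apply: ctnM; first exact: ctn_cst.
  by apply: ctnM; [exact: (ctn_wt K1 (sol_eps hs))|exact/ctnX/(ctn_V hs)].
move=> x /andP[x1 x2]; have e01 := sol_eps hs; have /andP[e0 _] := e01.
have xI : -1 <= x <= 1 by rewrite !ltW.
have w0 : 0 <= wt K eps p x by exact: expR_ge0.
have k1 : V n.+1 x ^+ 2 <= 2 * v1 eps V x ^+ 2 + 8 * Mk ^+ 2.
  set t := kappa0 n eps V * (2 * x).
  have ht : t ^+ 2 <= 4 * Mk ^+ 2.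
    rewrite (_ : 4 * Mk ^+ 2 = (Mk * 2) ^+ 2); last by ring.
    rewrite -[t ^+ 2]real_normK ?num_real// lerXn2r// ?nnegrE ?mulr_ge0//.
    rewrite normrM; apply: ler_pM => //; first exact: (hMk _ _ hs).
    by rewrite ler_norml; clear - jA jC jF cb Ab b0 x1 x2; lra.
  have -> : V n.+1 x = v1 eps V x - t by rewrite /v1 /t; ring.
  by move: (v1 eps V x) t ht => y t ht; have := sqr_ge0 (y + t); clear - jA jC jF cb Ab b0 ht; nra.
have k2 := bwt_ge K p beta0 eps x.
have k3 : eps * wt K eps p x <= expR ((p + 1) * ln (K + 1)).
  by apply: epswt_le => //; exact: ltW.
have ew0 : 0 <= eps * wt K eps p x by rewrite mulr_ge0// ltW.
rewrite mulrA; apply: le_trans (ler_wpM2l ew0 k1) _; rewrite mulrDr; apply: lerD.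
  rewrite mulrCA; apply: ler_wpM2l => //; rewrite -mulrA; apply: ler_wpM2l; first exact: ltW.
  by apply: ler_wpM2r => //; exact: sqr_ge0.
rewrite /c3 mulrC; apply: ler_wpM2l => //; by rewrite mulr_ge0 ?sqr_ge0.
Qed.

End SpecialStep.

(** * A priori bounds *)

Section Apriori.
Context {R : realType} (A C F : nat -> R -> R) (b : R -> R) (k : nat) (gamma : R).
(** The equation is differentiated k + 1 times, which involves derivatives of u up to order k +
    3. *)
Let m := k.+3.
Context (jA : jet m A) (jC : jet m C) (jF : jet m F) (cb : ctn (-1) 1 b).
Context (Ab : forall x : R, -1 <= x <= 1 -> A 0%N x = - x * b x)
  (b0 : forall x : R, -1 <= x <= 1 -> 0 < b x).
Context (gamma0 : 0 < gamma)
  (coer : forall x : R, -1 < x < 1 -> gamma <= C 0%N x - 2^-1 * A 1%N x).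
Context (k1 : (1 <= k)%N) (n : nat) (Lam : R) (nk : (n <= k)%N)
  (nL : n%:R <= Lam) (Ln : Lam < n.+1%:R) (L2 : 2^-1 < Lam)
  (Lb : Lam * b 0 < C 0%N 0 + 2^-1 * b 0) (nb : n%:R * b 0 < C 0%N 0).
Local Notation sol := (sol A C F m).
Local Notation bdJ := (bdJ A C F m).
Local Notation ubd := (ubd A C F m).
Local Notation bd_end := (bd_end A C F m).
Implicit Types (eps x p K e : R) (V : nat -> R -> R) (i j : nat).

Lemma b00 : 0 < b 0.
Proof. by apply: b0; lra. Qed.

Lemma bdJ_wtV K p j (d : R -> (nat -> R -> R) -> R -> R) : 1 <= K -> 0 <= p ->
  (forall eps V, sol eps V -> ctn (-1) 1 (d eps V)) ->
  (forall eps V x, sol eps V -> 0 <= d eps V x) ->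
  bdJ d -> bdJ (fun eps V x => wt K eps p x * d eps V x).
Proof.
move=> K1 p0 cd d0 h; apply: (bdJ_le (bdJZ (expR_ge0 (p * ln (K + 1))) h)) => eps V hs.
  by apply: ctnM; [exact: (ctn_wt K1 (sol_eps hs))|exact: cd].
move=> x /andP[x1 x2]; apply: ler_wpM2r; first exact: d0.
by apply: (wt_le K1 (sol_eps hs) p0); rewrite !ltW.
Qed.

(** Exponent 0 is admissible because i <= n < lambda_bar keeps c(0) - (i - 1/2) b(0) positive; the
    defect at order i + 1 is then just the eps-part of the energy of order i. *)
Lemma est_low i : (i <= n)%N ->
  [/\ bdJ (fun eps V x => V i x ^+ 2), bdJ (fun eps V x => eps * V i.+1 x ^+ 2) &
     bd_end i].
Proof.
elim/ltn_ind: i => -[|i] ih ilen.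
  by apply: (est_base jA jC jF gamma0 coer); rewrite /m.
have wt0l (d : R -> (nat -> R -> R) -> R -> R) :
    bdJ d -> bdJ (fun eps V x => wt 1 eps 0 x * d eps V x).
  move=> [M hM]; exists M => eps V hs; rewrite (_ : (fun x => _) = d eps V).
    exact: hM.
  by apply/funext => x; rewrite wt0 mul1r.
have [h1 h2 _] := ih i (ltnSn i) (ltnW ilen).
have [||||||||g1 g2 g3] := @est_step _ A C F b m jA jC jF cb Ab b0 i.+1 0 1 (lexx 1).
- by [].
- by rewrite /m; lia.
- by [].
- have := b00; have hi : (i.+1)%:R <= n%:R :> R by rewrite ler_nat.
  have := ler_wpM2r (ltW b00) hi; have := nb; lra.
- by move=> j ji; apply: wt0l; have [] := ih j ji (leq_trans (ltnW ji) ilen).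
- by move=> j ji; have [] := ih j ji (leq_trans (ltnW ji) ilen).
- apply: (bdJ_le h2) => eps V hs; last by move=> x _; rewrite wt0 mul1r.
  apply: ctnM; first exact: ctn_cst.
  apply: ctnM; first exact: (ctn_wt (lexx 1) (sol_eps hs)).
  by apply/ctnX/(ctn_V hs); rewrite /m; lia.
- apply: (bdJ_le (bdJ_cst A C F m 0)) => eps V hs; last by move=> x _; rewrite mul0r.
  apply: ctnM; first exact: ctn_cst.
  apply: ctnM; first exact: ctn_cst.
  apply: ctnM; first exact: (ctn_wt (lexx 1) (sol_eps hs)).
  by apply/ctnX/(ctn_V hs); rewrite /m; lia.
have un0 (d : R -> (nat -> R -> R) -> R -> R) :
    bdJ (fun eps V x => wt 1 eps 0 x * d eps V x) -> bdJ d.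
  move=> [M hM]; exists M => eps V hs; rewrite (_ : d eps V = fun x => wt 1 eps 0 x * d eps V x).
    exact: hM.
  by apply/funext => x; rewrite wt0 mul1r.
split => //; first exact: un0.
move: g2 => [M hM]; exists M => eps V hs.
rewrite (_ : (fun x => _) = fun x => eps * (wt 1 eps 0 x * V i.+2 x ^+ 2)).
  exact: hM.
by apply/funext => x; rewrite wt0 mul1r.
Qed.

Lemma est_all : exists2 K : R, 1 <= K & forall i q, (i <= k.+1)%N -> 0 <= q ->
  i%:R - Lam <= q -> bdJ (fun eps V x => wt K eps q x * V i x ^+ 2) /\ bd_end i.
Proof.
have [|||||||K K1 hsp] := @est_special _ A C F b m jA jC jF cb Ab b0 n (n%:R - Lam).
- by rewrite /m; lia.
- by move: Ln; rewrite -natr1; lra.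
- by rewrite subr_le0.
- by have := b00; have := Lb; lra.
- by rewrite subr_gt0.
- by move=> j /est_low[].
- by move=> j /est_low[].
exists K => //.
have cv eps V p j : sol eps V -> (j <= m)%N ->
    ctn (-1) 1 (fun x => wt K eps p x * V j x ^+ 2).
  move=> hs jm; apply: ctnM; first exact: (ctn_wt K1 (sol_eps hs)).
  exact/ctnX/(ctn_V hs).
have wtq p q (c : R -> R) j : p <= q -> (forall eps, 0 < eps <= 1 -> 0 <= c eps) ->
    (j <= m)%N -> bdJ (fun eps V x => c eps * (wt K eps p x * V j x ^+ 2)) ->
    bdJ (fun eps V x => c eps * (wt K eps q x * V j x ^+ 2)).
  move=> pq c0 jm h; apply: (bdJ_le (bdJZ (expR_ge0 ((q - p) * ln (K + 1))) h)) => eps V hs.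
    by apply: ctnM; [exact: ctn_cst|exact: cv].
  move=> x /andP[x1 x2]; rewrite [leRHS]mulrCA; apply: ler_wpM2l; first exact/c0/(sol_eps hs).
  rewrite [leRHS]mulrA; apply: ler_wpM2r; first exact: sqr_ge0.
  by apply: (wt_leq K1 (sol_eps hs) pq); rewrite !ltW.
have un1 (d : R -> (nat -> R -> R) -> R -> R) :
    bdJ (fun eps V x => 1 * d eps V x) <-> bdJ d.
  by split => -[M hM]; exists M => eps V hs; have := hM _ _ hs;
    rewrite (_ : (fun x => 1 * d eps V x) = d eps V)//; apply/funext => x; rewrite mul1r.
have low q j : 0 <= q -> (j <= n)%N -> bdJ (fun eps V x => wt K eps q x * V j x ^+ 2).
  move=> q0 jn; have [h _ _] := est_low jn.
  apply: (bdJ_wtV j K1 q0) h.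
    by move=> eps V hs; apply/ctnX/(ctn_V hs); rewrite /m; lia.
  by move=> *; exact: sqr_ge0.
have high i : (n < i)%N -> (i <= k.+1)%N ->
    [/\ bdJ (fun eps V x => wt K eps (i%:R - Lam) x * V i x ^+ 2),
       bdJ (fun eps V x => eps * (wt K eps (i%:R - Lam) x * V i.+1 x ^+ 2)) & bd_end i].
  elim/ltn_ind: i => i ih ni ik.
  have im : (i <= m)%N by exact: leq_trans ik (leqW (leqnSn _)).
  have iR : (i.-1)%:R = i%:R - 1 :> R by case: i ni {ih ik im} => // i _; rewrite -natr1 addrK.
  have p0 : 0 <= i%:R - Lam.
    have : (n.+1)%:R <= i%:R :> R by rewrite ler_nat.
    by have := Ln; lra.
  have hd : bdJ (fun eps V x => eps * (wt K eps (i%:R - Lam - 1) x * V i x ^+ 2)).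
    (* The defect asks for exponent i - 1 - Lam at order i - 1. The induction provides it for i - 1
       > n; for i = n + 1 it is the singular estimate, whose [K] therefore has to be used for all
       weights. *)
    rewrite addrAC -iR; have [->|ni'] := eqVneq i n.+1; first exact: hsp.
    have i0 : (0 < i)%N by exact: leq_ltn_trans ni.
    have h1 : (i.-1 < i)%N by rewrite prednK.
    have h2 : (n < i.-1)%N by rewrite -ltnS prednK// ltn_neqAle eq_sym ni'.
    have [_ + _] := ih i.-1 h1 h2 (leq_trans (leq_pred i) ik).
    by rewrite prednK.
  apply: (@est_step _ A C F b m jA jC jF cb Ab b0 i _ K K1 _ _ p0).
  - exact: leq_ltn_trans ni.
  - exact: ik.
  - by have := b00; have := Lb; lra.
  - move=> j ji; have [jn|nj] := leqP j n; first exact: low.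
    have [h _ _] := ih j ji nj (ltnW (leq_trans ji ik)).
    apply/un1; apply: (wtq (j%:R - Lam)); last exact/un1.
    + by rewrite lerD2r ler_nat ltnW.
    + by [].
    + exact: leq_trans (ltnW ji) im.
  - move=> j ji; have [jn|nj] := leqP j n; first by have [] := est_low jn.
    by have [] := ih j ji nj (ltnW (leq_trans ji ik)).
  - apply: (wtq _ _ (fun eps => eps)) hd; first by lra.
      by move=> eps /andP[/ltW].
    exact: im.
  - exact: bdJZ.
move=> i q ik q0 iq; have [jn|nj] := leqP i n.
  by split; [exact: low|have [] := est_low jn].
have [h _ hb] := high i nj ik; split; last exact: hb.
apply/un1; apply: (wtq _ _ _ _ iq); last exact/un1.
  by [].
exact: leq_trans ik (leqW (leqnSn _)).
Qed.

(** The third bound serves the outer elements and the fourth the inner ones. The first two take over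
    on inner elements where eps is too small for the fourth. *)
Lemma apriori (lam : R) : lam <= Lam -> exists2 S : R, 0 < S &
  forall eps V, sol eps V ->
  [/\ forall x, -1 <= x <= 1 -> `|V 0%N x| <= S,
     forall x, -1 <= x <= 1 -> (eps + x ^+ 2) * V 1%N x ^+ 2 <= S,
     itg (-1) 1 (fun x => (eps + x ^+ 2) ^+ k.+1 * V k.+1 x ^+ 2) <= S &
     itg (-1) 1 (fun x => expR ((k.+1%:R - lam) * ln eps) * V k.+1 x ^+ 2) <= S].
Proof.
move=> lamL; have [K K1 hK] := est_all.
have cv eps V p j : sol eps V -> (j <= m)%N ->
    ctn (-1) 1 (fun x => wt K eps p x * V j x ^+ 2).
  move=> hs jm; apply: ctnM; first exact: (ctn_wt K1 (sol_eps hs)).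
  exact/ctnX/(ctn_V hs).
have m0 : (0 < m)%N by [].
have m1 : (1 < m)%N by [].
have m2 : (2 <= m)%N by [].
have mk : (k.+1 <= m)%N by exact: leqW (leqnSn _).
have hV1 : bdJ (fun eps V x => `|V 1%N x|).
  (* Lam > 1/2 gives p < 1/2, so that rho^(-p) is integrable uniformly in eps; then 2 |u'| <=
     rho^(-p) + rho^p u'^2 bounds u' in L^1. *)
  pose p := Num.max 0 (1 - Lam).
  have p0 : 0 <= p by rewrite /p le_max lexx.
  have p1 : 1 - Lam <= p by rewrite /p le_max lexx orbT.
  have p2 : - 2^-1 < - p by rewrite ltrN2 /p gt_max; have := L2; lra.
  have [h _] := hK 1%N p (ltn0Sn k) p0 p1.
  apply: (bdJ_le (bdJD (bdJ_wt A C F m K1 p2) h)) => eps V hs.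
    exact/ctn_abs/(ctn_V hs).
  move=> x _; have w0 := wt_gt0 K eps p x.
  have -> : wt K eps (- p) x = (wt K eps p x)^-1.
    by rewrite /wt mulNr expRN.
  move: (wt _ _ _ _) w0 => w w0; rewrite -[V _ x ^+ 2]real_normK ?num_real//.
  set y := `|_|; have y0 : 0 <= y by exact: normr_ge0.
  have : 0 <= w^-1 * (w * y - 1) ^+ 2 by rewrite mulr_ge0 ?sqr_ge0// invr_ge0 ltW.
  rewrite (_ : w^-1 * _ = w^-1 + w * y ^+ 2 - 2 * y); first lra.
  by field; rewrite gt_eqF.
have [S1 S10 hS1] := sup_bd m0 hV1 (let: And3 _ _ h := est_low (leq0n n) in h).
have [e1 hb1] : bdJ (fun eps V x => wt K eps 2^-1 x * V 1%N x ^+ 2) /\ bd_end 1.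
  by apply: hK => //; have := L2; lra.
have [e2 _] : bdJ (fun eps V x => wt K eps (1 + 2^-1) x * V 2 x ^+ 2) /\ bd_end 2.
  by apply: hK => //; have := L2; lra.
(* This is the derivative of rho u'^2. It is bounded in L^1 by |x| <= rho^(1/2) and Young's
   inequality, and together with the value at 1 this bounds rho u'^2 pointwise. *)
have dz : bdJ (fun eps V x => `|2 * x * V 1%N x ^+ 2 +
    rho K eps x * (2 * V 1%N x * V 2 x)|).
  apply: (bdJ_le (bdJD (bdJZ (ler0n R 3) e1) e2)) => eps V hs.
    apply/ctn_abs/ctnD; apply: ctnM.
    - by apply: ctnM; [exact: ctn_cst|exact: ctn_id].
    - exact/ctnX/(ctn_V hs).
    - exact: ctn_rho.
    - apply: ctnM; last exact: (ctn_V hs).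
      by apply: ctnM; [exact: ctn_cst|exact: (ctn_V hs)].
  move=> x _; have e01 := sol_eps hs; have /andP[e0 _] := e01.
  have rE : rho K eps x = wt K eps 2^-1 x ^+ 2.
    by rewrite expr2 -wtD (_ : 2^-1 + 2^-1 = 1 :> R) ?(wt1 K1 e01)//; field.
  rewrite wtD (wt1 K1 e01) rE; have s0 := wt_gt0 K eps 2^-1 x.
  have xs : `|x| <= wt K eps 2^-1 x.
    rewrite -[leRHS]ger0_norm ?expR_ge0// -ler_sqr ?nnegrE// !real_normK ?num_real//.
    by rewrite -rE /rho lerDr mulr_ge0 ?(ltW e0)// (le_trans ler01).
  move: (wt _ _ _ _) s0 xs => s s0; rewrite ler_norml => /andP[x1 x2].
  move: (V 1%N x) (V 2 x) => v w.
  have h1 : 0 <= (s - x) * v ^+ 2 by rewrite mulr_ge0 ?sqr_ge0// subr_ge0.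
  have h2 : 0 <= (s + x) * v ^+ 2 by rewrite mulr_ge0 ?sqr_ge0//; lra.
  have h3 : 0 <= s * (v - s * w) ^+ 2 by rewrite mulr_ge0 ?sqr_ge0// ltW.
  have h4 : 0 <= s * (v + s * w) ^+ 2 by rewrite mulr_ge0 ?sqr_ge0// ltW.
  by rewrite ler_norml; apply/andP; split; lra.
have [S2 hS2] := dz; have [S3 hS3] := (hb1 1 (or_introl erefl)).1.
have S20 : 0 <= k.+1%:R - Lam.
  have : n.+1%:R <= k.+1%:R :> R by rewrite ler_nat.
  by have := Ln; lra.
have [e3 _] := hK k.+1 (k.+1%:R - Lam) (leqnn _) S20 (lexx _).
have [S4 hS4] := e3.
have [e4 _] := hK k.+1 k.+1%:R (leqnn _) (ler0n _ _) ltac:(have := L2; lra).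
have [S5 hS5] := e4.
exists (1 + `|S1| + `|S2 + (K + 1) * S3 ^+ 2| + `|S4| + `|S5|).
  by rewrite -!addrA ltr_pwDl// !addr_ge0.
move=> eps V hs; have e01 := sol_eps hs; have /andP[eps0 eps1] := e01.
have n1 := ler_norm S1; have n2 := ler_norm (S2 + (K + 1) * S3 ^+ 2).
have n3 := ler_norm S4; have n4 := ler_norm S5.
have n5 := normr_ge0 S1; have n6 := normr_ge0 (S2 + (K + 1) * S3 ^+ 2).
have n7 := normr_ge0 S4; have n8 := normr_ge0 S5.
have er (x : R) : eps + x ^+ 2 <= rho K eps x by rewrite lerD2r ler_peMl// ltW.
split.
- by move=> x xI; have := hS1 _ _ hs x xI; lra.
- move=> x xI; apply: le_trans (ler_wpM2r (sqr_ge0 _) (er x)) _.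
  have cz : ctn (-1) 1 (fun x => rho K eps x * V 1%N x ^+ 2).
    by apply: ctnM; [exact: ctn_rho|exact/ctnX/(ctn_V hs)].
  have cdz : ctn (-1) 1 (fun x => 2 * x * V 1%N x ^+ 2 +
    rho K eps x * (2 * V 1%N x * V 2 x)).
    apply: ctnD; apply: ctnM.
    - by apply: ctnM; [exact: ctn_cst|exact: ctn_id].
    - exact/ctnX/(ctn_V hs).
    - exact: ctn_rho.
    - apply: ctnM; last exact: (ctn_V hs).
      by apply: ctnM; [exact: ctn_cst|exact: (ctn_V hs)].
  have ddz : drv (-1) 1 (fun x => rho K eps x * V 1%N x ^+ 2)
     (fun x => 2 * x * V 1%N x ^+ 2 + rho K eps x * (2 * V 1%N x * V 2 x)).
    apply: (eq_drv (drvM (drv_rho K eps) (drvX 2 (sol_drv hs m1)))).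
    by move=> y _ /=; ring.
  have := osc_le cz cdz ddz (endI (or_introl erefl)) xI.
  have [_ h1] := hS2 _ _ hs; rewrite ler_norml => /andP[_ h2].
  have h3 := hS3 _ _ hs.
  have h4 : rho K eps 1 * V 1%N 1 ^+ 2 <= (K + 1) * S3 ^+ 2.
    apply: ler_pM; [exact/ltW/(rho_gt0 K1 e01)|exact: sqr_ge0| |].
      exact: (rho_le K1 e01 (endI (or_introl erefl))).
    rewrite -[_ ^+ 2]real_normK ?num_real// lerXn2r// nnegrE//.
    exact: le_trans h3.
  by lra.
- have [h1 h2] := hS5 _ _ hs.
  apply: (@le_trans _ _ S5); last lra; apply: le_trans h2.
  apply: itg_le => //.
    apply/ctn_itgbl/ctnM; last exact/ctnX/(ctn_V hs).
    by apply: ctnX; apply: ctnD; [exact: ctn_cst|exact/ctnX/ctn_id].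
  move=> x _; apply: ler_wpM2r; first exact: sqr_ge0.
  rewrite (wtn K1 e01); apply: lerXn2r; rewrite ?nnegrE ?er//.
    by rewrite addr_ge0 ?sqr_ge0// ltW.
  exact/ltW/(rho_gt0 K1 e01).
- have [h1 h2] := hS4 _ _ hs.
  apply: (@le_trans _ _ S4); last lra; apply: le_trans h2.
  apply: itg_le => //.
    by apply/ctn_itgbl/ctnM; [exact: ctn_cst|exact/ctnX/(ctn_V hs)].
  move=> x _; apply: ler_wpM2r; first exact: sqr_ge0.
  rewrite ler_expR.
  have l0 : ln eps <= 0 by rewrite -ln1 ler_ln ?posrE.
  have l1 : ln eps <= ln (rho K eps x).
    rewrite ler_ln ?posrE ?rho_gt0//; exact: (eps_rho K1 e01).
  (* For eps <= 1 and lam <= Lam one has eps^(k+1-lam) <= eps^(k+1-Lam) <= rho^(k+1-Lam). *)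
  apply: (@le_trans _ _ ((k.+1%:R - Lam) * ln eps)).
    by rewrite ler_wnM2r// lerD2l lerN2.
  exact: ler_wpM2l.
Qed.

End Apriori.

(** * The mesh and interpolation *)

Section Mesh.
Context {R : realType} (K N : nat) (N0 : (0 < N)%N) (KN : (K.+1 %| N)%N).
Local Notation n := (N %/ K.+1)%N.
Local Notation bp := (breakpoint R K).
Local Notation P := (pos_mesh_point R K N).
Local Notation H := (K.+1%:R / N%:R : R).
Local Notation s := (10 ^- K : R).

(** Shifting the index by N numbers the mesh points by the natural numbers from 0 to 2N. *)
Definition node (i : nat) : R := mesh_point R K N (i%:Z - N%:Z).

Lemma nE : (N = n * K.+1)%N.
Proof. by rewrite divnK. Qed.

Lemma n_gt0 : (0 < n)%N.
Proof. by rewrite divn_gt0// dvdn_leq. Qed.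

Lemma HE : H = n%:R^-1.
Proof.
have n0 := n_gt0.
have -> : N%:R = n%:R * K.+1%:R :> R by rewrite -natrM -nE.
by field; rewrite nat1r !pnatr_eq0 -lt0n n0.
Qed.

Lemma H_gt0 : 0 < H.
Proof. by rewrite HE invr_gt0 ltr0n n_gt0. Qed.

Lemma H_le1 : H <= 1.
Proof. by rewrite HE invf_le1 ?ltr0n ?n_gt0// ler1n n_gt0. Qed.

Lemma H_geV : N%:R^-1 <= H.
Proof. by rewrite -[leLHS]mul1r ler_pM2r ?invr_gt0 ?ltr0n// ler1n. Qed.

Lemma s_gt0 : 0 < s.
Proof. by rewrite invr_gt0 exprn_gt0. Qed.

Lemma bp0 : bp 0 = 0. Proof. by []. Qed.

Lemma bp1 : bp 1 = s.
Proof. by rewrite /breakpoint subSS subn0. Qed.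

Lemma bpS j : (0 < j)%N -> (j <= K)%N -> bp j.+1 = 10 * bp j.
Proof.
case: j => // j _ jK; rewrite /breakpoint.
have -> : (K.+1 - j.+1 = (K.+1 - j.+2).+1)%N by lia.
have : 10 ^+ (K.+1 - j.+2) != 0 :> R by rewrite expf_neq0.
by rewrite exprS /=; move: (10 ^+ _) => t t0; field.
Qed.

Lemma bp_last : bp K.+1 = 1.
Proof. by rewrite /breakpoint/= subnn expr0 invr1. Qed.

Lemma bp_ge_s j : (0 < j)%N -> s <= bp j.
Proof.
case: j => // j _; rewrite /breakpoint/= lef_pV2 ?posrE ?exprn_gt0//.
by rewrite ler_eXn2l ?ltr1n// subSS leq_subr.
Qed.

Lemma P0 : P 0 = 0.
Proof. by rewrite /pos_mesh_point div0n mod0n !mul0r addr0. Qed.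

Lemma P_last : P N = 1.
Proof.
have e1 : (N %/ n = K.+1)%N by rewrite {1}nE mulKn ?n_gt0.
have e2 : (N %% n = 0)%N by rewrite {1}nE modnMr.
by rewrite /pos_mesh_point e1 e2 !mul0r addr0 bp_last.
Qed.

Lemma PS i : P i.+1 - P i = (bp (i %/ n).+1 - bp (i %/ n)) * H.
Proof.
have n0 := n_gt0; have n1 : n%:R != 0 :> R by rewrite pnatr_eq0 -lt0n.
rewrite HE /pos_mesh_point.
(* In the last element of a subinterval, the right end point is already computed from the next
   subinterval. *)
have [e|e] := eqVneq (i %% n).+1 n.
  have -> : (i.+1 = ((i %/ n).+1) * n)%N.
    by rewrite {1}(divn_eq i n) mulSn addnC -{3}e; lia.
  rewrite mulnK// modnMl mul0r mul0r addr0.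
  have -> : (i %% n)%:R = n%:R - 1 :> R by rewrite -{2}e -natr1 addrK.
  by field.
have lt : ((i %% n).+1 < n)%N by rewrite ltn_neqAle e ltn_pmod.
have -> : (i.+1 = (i %/ n) * n + (i %% n).+1)%N by rewrite {1}(divn_eq i n) addnS.
rewrite divnMDl// (divn_small lt) addn0 modnMDl (modn_small lt).
by rewrite -natr1; field.
Qed.

Lemma divn_le i : (i < N)%N -> (i %/ n <= K)%N.
Proof. by move=> iN; rewrite -ltnS ltn_divLR ?n_gt0// mulnC -nE. Qed.

Lemma P_ge i : (i < N)%N -> bp (i %/ n) <= P i.
Proof.
move=> iN; rewrite /pos_mesh_point lerDl.
apply: mulr_ge0; first by rewrite divr_ge0.
have jK := divn_le iN; case: (posnP (i %/ n)%N) => [->|j0].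
  by rewrite bp0 bp1 subr0 ltW// s_gt0.
by rewrite bpS//; have := bp_ge_s j0; have := s_gt0; lra.
Qed.

Lemma P_inner i : (i <= n)%N -> P i = i%:R * s * H.
Proof.
have n0 := n_gt0; rewrite HE leq_eqVlt => /predU1P[->|lt].
  rewrite /pos_mesh_point divnn n0 modnn !mul0r addr0 [true : nat]/= bp1.
  by rewrite mulrAC mulfV ?mul1r// pnatr_eq0 -lt0n.
by rewrite /pos_mesh_point divn_small// modn_small// bp0 bp1 subr0 add0r; ring.
Qed.

(** Breakpoints grow by the factor 10, so the subinterval starting at [bp j] with j > 0 has length 9
    [bp j]; this is the origin of the 9. *)
Lemma P_outer i : (n <= i)%N -> (i < N)%N ->
  [/\ s <= P i, P i < P i.+1 & P i.+1 - P i <= 9 * H * P i].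
Proof.
move=> ni iN; have jK := divn_le iN.
have j0 : (0 < i %/ n)%N by rewrite divn_gt0 ?n_gt0.
have h1 := bp_ge_s j0; have h2 := P_ge iN; have h3 := PS i; have h4 := s_gt0.
have h5 := H_gt0; rewrite bpS// in h3.
have h6 : (10 * bp (i %/ n) - bp (i %/ n)) * H = 9 * H * bp (i %/ n) by ring.
have h7 := ler_wpM2l (ltW (mulr_gt0 (ltr0n R 9) h5)) h2.
have h8 : 0 < 9 * H * bp (i %/ n).
  have h0 : 0 < bp (i %/ n) by exact: lt_le_trans h1.
  by apply: mulr_gt0 => //; apply: mulr_gt0.
rewrite h6 in h3; split; [exact: le_trans h2| |by rewrite h3].
by rewrite -subr_gt0 h3.
Qed.

Lemma nodeE_pos i : node (N + i)%N = P i.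
Proof.
rewrite /node PoszD addrAC subrr add0r /mesh_point absz_nat.
by case: i => [|i]; rewrite ?P0 ?mulr0//= /sgz/= mul1r.
Qed.

Lemma nodeE_neg i : (i <= N)%N -> node (N - i)%N = - P i.
Proof.
move=> iN; rewrite /node -subzn// addrAC subrr add0r /mesh_point abszN absz_nat.
by rewrite sgzN; case: i iN => [|i] _; rewrite ?P0 ?mulr0 ?oppr0//= /sgz/= mulN1r.
Qed.

Lemma node0 : node 0 = -1.
Proof. by rewrite -(subnn N) nodeE_neg// P_last. Qed.

Lemma node_last : node (N + N) = 1.
Proof. by rewrite nodeE_pos P_last. Qed.

(* With s = 10^-K and H = (K+1)/N: outer elements are short relative to |x|, the
   inner ones all have length s H; the last case is the pair of elements at 0. *)
Definition elt_outer (l r : R) : Prop :=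
  (r <= - s \/ s <= l) /\ forall x, l < x < r -> r - l <= 9 * H * `|x|.
Definition elt_inner (l r : R) : Prop :=
  [/\ - s <= l, r <= s, r - l = s * H &
    (forall x, l < x < r -> r - l <= `|x|) \/ (forall x, l < x < r -> `|x| <= r - l)].

Lemma pos_elt i : (i < N)%N -> P i < P i.+1 /\
  ((s <= P i /\ forall x, P i < x < P i.+1 -> P i.+1 - P i <= 9 * H * x) \/
   [/\ 0 <= P i, P i.+1 <= s, P i.+1 - P i = s * H &
    (forall x, P i < x < P i.+1 -> P i.+1 - P i <= x) \/
    (forall x, P i < x < P i.+1 -> x <= P i.+1 - P i)]).
Proof.
move=> iN; have s0 := s_gt0; have H0 := H_gt0; have n0 := n_gt0.
have [ni|lt] := leqP n i.
  have [h1 h2 h3] := P_outer ni iN; split => //; left; split => // x /andP[x1 x2].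
  apply: le_trans h3 _; apply: ler_wpM2l; last exact: ltW.
  by apply: mulr_ge0 => //; exact: ltW.
have e1 := P_inner (ltnW lt); have e2 := P_inner lt.
have sH : 0 < s * H by rewrite mulr_gt0.
have eh : P i.+1 - P i = s * H by rewrite e1 e2 -natr1; ring.
split; first by lra.
right; split => //.
- by rewrite e1 !mulr_ge0// ltW.
- rewrite e2 mulrAC ler_piMl ?(ltW s0)// HE ler_pdivrMr ?ltr0n// mul1r ler_nat.
  exact: lt.
case: i lt {iN} e1 e2 eh => [|i] lt e1 e2 eh; [right|left] => x /andP[x1 x2].
  by rewrite P0 subr0 ltW.
rewrite eh; apply: le_trans (ltW x1); rewrite e1 -mulrA ler_peMl ?(ltW sH)//.
by rewrite ler1n.
Qed.

Lemma node_elt i : (i < N + N)%N -> node i < node i.+1 /\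
  (elt_outer (node i) (node i.+1) \/ elt_inner (node i) (node i.+1)).
Proof.
move=> iN; have s0 := s_gt0.
have [Ni|lt] := leqP N i.
  have [j jN ->] : exists2 j, (j < N)%N & i = (N + j)%N.
    by exists (i - N)%N; lia.
  rewrite -addnS !nodeE_pos; have [h1 h2] := pos_elt jN; split => //.
  case: h2 => [[h2 h3]|[h2 h3 h4 h5]]; [left|right].
    split; first by right.
    move=> x xI; rewrite gtr0_norm; first exact: h3.
    by case/andP: xI => x1 _; lra.
  split => //; first by lra.
  by case: h5 => h5; [left|right] => x xI; (rewrite gtr0_norm; first exact: h5);
    case/andP: xI => x1 _; lra.
have [j jN [-> ->]] : exists2 j, (j < N)%N & i = (N - j.+1)%N /\ i.+1 = (N - j)%N.
  by exists (N - i.+1)%N; [|split]; lia.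
rewrite !nodeE_neg//; last exact: ltnW.
have [h1 h2] := pos_elt jN; split; first by lra.
have e : - P j - - P j.+1 = P j.+1 - P j by ring.
have xI' x : - P j.+1 < x < - P j -> P j < - x < P j.+1.
  by move=> /andP[? ?]; apply/andP; split; lra.
have nx x : - P j.+1 < x < - P j -> 0 <= P j -> `|x| = - x.
  by move=> /andP[_ ?] ?; rewrite ltr0_norm//; lra.
case: h2 => [[h2 h3]|[h2 h3 h4 h5]]; [left|right].
  split; first by left; lra.
  by move=> x xI; rewrite e nx//; [exact/h3/xI'|lra].
split; rewrite ?e//; try lra.
by case: h5 => h5; [left|right] => x xI; rewrite nx//; exact/h5/xI'.
Qed.

Lemma nodes_node : nodes node (N + N).
Proof. by move=> i /node_elt[]. Qed.

Lemma fe_elt k v i : fe_space k K N v -> (i < N + N)%N ->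
  exists2 p : {poly R}, (size p <= k.+1)%N &
    forall x, node i < x < node i.+1 -> v x = p.[x].
Proof.
move=> [_ _ _ h] iN; have [|p [sp hp]] := h (i.+1%:Z - N%:Z); first by lia.
exists p => // x; move: (hp x); rewrite /node.
by rewrite (_ : i.+1%:Z - N%:Z - 1 = i%:Z - N%:Z)//; lia.
Qed.

Lemma elt_fe k v : ctn (-1) 1 v -> v (-1) = 0 -> v 1 = 0 ->
  (forall i, (i < N + N)%N -> exists2 p : {poly R}, (size p <= k.+1)%N &
    forall x, node i < x < node i.+1 -> v x = p.[x]) ->
  fe_space k K N v.
Proof.
move=> [cv] v1 v2 h; split => // i iI.
have [j jN ->] : exists2 j : nat, (j < N + N)%N & i = (j.+1%:Z - N%:Z)%R.
  by exists `|(i + N%:Z - 1)%R|%N; lia.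
have [p sp hp] := h j jN; exists p; split => // x.
rewrite (_ : j.+1%:Z - N%:Z - 1 = j%:Z - N%:Z); last by lia.
exact: hp.
Qed.

End Mesh.

(** * Local polynomial approximation in L^2 *)

Section Interpolation.
Context {R : realType}.
Implicit Types (l r x y d : R) (f g : R -> R) (p q : {poly R}).

Lemma poly_antiderivative p : exists2 q, q^`() = p & (size q <= (size p).+1)%N.
Proof.
exists (\poly_(i < (size p).+1) (p`_i.-1 / i%:R)); last exact: size_poly.
apply/polyP => i; rewrite coef_deriv coef_poly ltnS.
case: ltnP => [ip|pi]; last by rewrite mul0rn nth_default.
by rewrite -[LHS]mulr_natr divfK ?pnatr_eq0.
Qed.

(** The function (x - r) g^2 vanishes at both ends, so the integral of g^2 equals that of -2 (x - r)
    g g'. Young's inequality then absorbs half of g^2. *)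
Lemma poincare l r g g1 : l <= r -> ctn l r g -> ctn l r g1 -> drv l r g g1 ->
  g l = 0 ->
  itg l r (fun x => g x ^+ 2) <= 4 * (r - l) ^+ 2 * itg l r (fun x => g1 x ^+ 2).
Proof.
move=> lr cg cg1 dg gl.
have cx : ctn l r (fun x => x - r) by apply: ctnD; [exact: ctn_id|exact: ctn_cst].
have c1 : ctn l r (fun x => (x - r) * g x ^+ 2) by apply: ctnM => //; exact: ctnX.
have c2 : ctn l r (fun x => g x ^+ 2 + (x - r) * (2 * g x * g1 x)).
  apply: ctnD; first exact: ctnX.
  by do 2![apply: ctnM => //]; apply: ctnM => //; exact: ctn_cst.
have d1 : drv l r (fun x => (x - r) * g x ^+ 2)
    (fun x => g x ^+ 2 + (x - r) * (2 * g x * g1 x)).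
  apply: (eq_drv (drvM (drvD (drv_id l r) (drv_cst l r (- r))) (drvX 2 dg))).
  by move=> x _ /=; ring.
have := ftc lr c1 c2 d1; rewrite gl subrr expr0n/= mulr0 mul0r subr0 => e.
have ig := ctn_itgbl (ctnX 2 cg); have ig1 := ctn_itgbl (ctnX 2 cg1).
have h : itg l r (fun x => 2^-1 * g x ^+ 2) <=
    itg l r (fun x => (g x ^+ 2 + (x - r) * (2 * g x * g1 x)) +
      2 * (r - l) ^+ 2 * g1 x ^+ 2).
  apply: itg_le.
  - exact: itgblZ.
  - by apply: itgblD; [exact: ctn_itgbl|exact: itgblZ].
  move=> x /andP[x1 x2].
  have h1 : (x - r) ^+ 2 * g1 x ^+ 2 <= (r - l) ^+ 2 * g1 x ^+ 2.
    by apply: ler_wpM2r; [exact: sqr_ge0|nra].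
  by have := sqr_ge0 (g x + 2 * ((x - r) * g1 x)); nra.
move: h; rewrite itgZ// itgD ?itgZ//; [|exact: ctn_itgbl|exact: itgblZ].
by rewrite e; lra.
Qed.

(** The polynomial found for [F 1] is integrated, with the constant that makes the error vanish at
    [l]; each step thus costs one use of [poincare]. The result is the Taylor polynomial at [l]. *)
Lemma taylor_poly (k : nat) l r (F : nat -> R -> R) : l <= r ->
  (forall j, (j <= k)%N -> ctn l r (F j)) ->
  (forall j, (j < k)%N -> drv l r (F j) (F j.+1)) ->
  exists2 p : {poly R}, (size p <= k)%N &
    itg l r (fun x => (F 0%N x - p.[x]) ^+ 2) <=
      (4 * (r - l) ^+ 2) ^+ k * itg l r (fun x => F k x ^+ 2).
Proof.
move=> lr; elim: k F => [|k ihk] F cF dF.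
  exists 0; first by rewrite size_poly0.
  rewrite expr0 mul1r (@eq_itg _ l r _ (fun x => F 0%N x ^+ 2))// => x _.
  by rewrite horner0 subr0.
have [|j|T sT hT] := ihk (fun j => F j.+1).
- by move=> j jk; exact: cF.
- by move=> jk; exact: dF.
have [q qE sq] := poly_antiderivative T.
exists (q + (F 0%N l - q.[l])%:P).
  rewrite (leq_trans (size_polyD _ _))// geq_max (leq_trans sq)//=.
  by rewrite (leq_trans (size_polyC_leq1 _)).
apply: le_trans (poincare (g1 := fun x => F 1%N x - T.[x]) lr _ _ _ _) _.
- by apply: ctnD; [exact: cF|apply: ctnN; exact: ctn_horner].
- by apply: ctnD; [exact: cF|apply: ctnN; exact: ctn_horner].
- apply: (eq_drv (drvD (dF 0%N (ltn0Sn k)) (drvN (drv_horner l r _)))) => x _.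
  by rewrite derivD derivC addr0 qE.
- by rewrite hornerD hornerC; ring.
rewrite [_ ^+ k.+1]exprS -[leRHS]mulrA; apply: ler_wpM2l; last exact: hT.
by rewrite mulr_ge0 ?sqr_ge0.
Qed.

(** An antiderivative of [T] is corrected by a linear function so as to match [f] at both ends. Its
    slope [d] is forced to be the mean of f' - T, and subtracting the mean cannot increase the L^2
    norm. For T = 0 this is linear interpolation. *)
Lemma interp (k : nat) l r f f1 (T : {poly R}) : l < r -> ctn l r f -> ctn l r f1 ->
  drv l r f f1 -> (0 < k)%N -> (size T <= k)%N ->
  exists q : {poly R}, [/\ (size q <= k.+1)%N, q.[l] = f l, q.[r] = f r,
    itg l r (fun x => (f1 x - q^`().[x]) ^+ 2) <=
      itg l r (fun x => (f1 x - T.[x]) ^+ 2) &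
    T = 0 -> let d := (f r - f l) / (r - l) in
      q^`() = d%:P /\ forall x, q.[x] = f l + d * (x - l)].
Proof.
move=> lr cf cf1 df k0 sT.
have [q0 q0E sq0] := poly_antiderivative T.
have rl : r - l != 0 by rewrite subr_eq0 gt_eqF.
pose d := ((f r - q0.[r]) - (f l - q0.[l])) / (r - l).
pose q := q0 + d *: 'X + (f l - q0.[l] - d * l)%:P.
have qE : q^`() = T + d%:P.
  by rewrite /q !derivD derivZ derivX derivC addr0 q0E alg_polyC.
exists q; split.
- rewrite (leq_trans (size_polyD _ _))// geq_max; apply/andP; split.
    rewrite (leq_trans (size_polyD _ _))// geq_max (leq_trans sq0)//=.
    by rewrite (leq_trans (size_scale_leq _ _))// size_polyX.
  by rewrite (leq_trans (size_polyC_leq1 _)).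
- by rewrite /q !hornerD hornerZ hornerX hornerC; ring.
- by rewrite /q !hornerD hornerZ hornerX hornerC /d; field.
- have cg : ctn l r (fun x => f1 x - T.[x]).
    by apply: ctnD => //; apply: ctnN; exact: ctn_horner.
  have e1 : itg l r (fun x => f1 x - T.[x]) = d * (r - l).
    rewrite (@ftc _ l r (fun x => f x - q0.[x]) _ (ltW lr))//.
    + by rewrite /d; field.
    + by apply: ctnD => //; apply: ctnN; exact: ctn_horner.
    + apply: (eq_drv (drvD df (drvN (drv_horner l r q0)))) => x _.
      by rewrite q0E.
  have e2 : itg l r (fun x => (f1 x - q^`().[x]) ^+ 2) =
      itg l r (fun x => (f1 x - T.[x]) ^+ 2 +
        (- (2 * d) * (f1 x - T.[x]) + d ^+ 2)).
    by apply: eq_itg => x _; rewrite qE hornerD hornerC; ring.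
  have i1 := ctn_itgbl cg; have i2 := ctn_itgbl (ctnX 2 cg).
  rewrite e2 itgD//; last by apply: itgblD; [exact: itgblZ|exact: itgbl_cst].
  rewrite itgD; [|exact: itgblZ|exact: itgbl_cst].
  rewrite itgZ// itg_cst ?(ltW lr)// e1 gerDl.
  rewrite (_ : _ + _ = - (d ^+ 2 * (r - l))); last by ring.
  by rewrite oppr_le0 mulr_ge0 ?sqr_ge0// subr_ge0 ltW.
- move=> T0; have h : q0^`() = 0 by rewrite q0E.
  have [c qc] : exists c, q0 = c%:P.
    exists q0`_0; apply/polyP => -[|i]; rewrite coefC//=.
    have : (q0^`())`_i = 0 by rewrite h coef0.
    by rewrite coef_deriv => /eqP; rewrite mulrn_eq0 => /orP[//|/eqP].
  have dE : (f r - f l) / (r - l) = d by rewrite /d qc !hornerC opprB addrA subrK.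
  split=> [|x]; first by rewrite qE T0 add0r dE.
  by rewrite dE /q qc !hornerD hornerZ hornerX !hornerC; ring.
Qed.

End Interpolation.

(** The increment of [clamp s] over an element is the length of its part inside [-s, s]. In this
    form the lengths of the inner elements telescope over the whole mesh. *)
Definition clamp (R : realType) (s x : R) : R := Num.max (- s) (Num.min s x).

(** * The interpolation error on one element *)

Section Element.
Context {R : realType}.
Implicit Types (l r x y s : R).

Lemma clamp_id s x : - s <= x -> x <= s -> clamp s x = x.
Proof. by move=> h1 h2; rewrite /clamp min_r// max_r. Qed.

Lemma clamp_le s x y : x <= y -> clamp s x <= clamp s y.
Proof.
move=> xy; rewrite /clamp ge_max le_max lexx/= le_max; apply/orP; right.
by rewrite le_min !ge_min lexx/= xy orbT.
Qed.

Lemma clamp_itv s x : 0 <= s -> - s <= clamp s x <= s.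
Proof. by move=> s0; rewrite /clamp le_max lexx/= ge_max ge_min lexx/= andbT; lra. Qed.

Lemma norm_itv_le l r x : l < x < r -> `|x| <= Num.max `|l| `|r|.
Proof.
move=> /andP[x1 x2]; rewrite le_max ler_norml.
have h1 := ler_norm r; have h2 := ler_norm (- l); rewrite normrN in h2.
have [x0|x0] := leP 0 x.
  by apply/orP; right; rewrite ger0_norm//; lra.
by apply/orP; left; apply/andP; split; lra.
Qed.

Lemma norm_end_le l r x : l < x < r -> Num.max `|l| `|r| <= `|x| + (r - l).
Proof.
move=> /andP[x1 x2]; have h1 := ler_norm x; have h2 := ler_norm (- x).
rewrite normrN in h2; rewrite ge_max !ler_norml.
by apply/andP; split; apply/andP; split; lra.
Qed.

(** The density that bounds the Galerkin error, for an approximation given by [q] on the element. *)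
Definition edens (eps : R) (f f1 : R -> R) (q : {poly R}) x : R :=
  (eps + x ^+ 2) * (f1 x - q^`().[x]) ^+ 2 + (f x - q.[x]) ^+ 2.

Lemma ctn_edens l r eps f f1 q : ctn l r f -> ctn l r f1 ->
  ctn l r (edens eps f f1 q).
Proof.
move=> cf cf1; apply: ctnD; last first.
  by apply: ctnX; apply: ctnD => //; apply: ctnN; exact: ctn_horner.
apply: ctnM; first by apply: ctnD; [exact: ctn_cst|exact/ctnX/ctn_id].
by apply: ctnX; apply: ctnD => //; apply: ctnN; exact: ctn_horner.
Qed.

Lemma edens_le l r eps f f1 q X : l < r -> 0 < eps -> ctn l r f -> ctn l r f1 ->
  drv l r f f1 -> q.[l] = f l -> (forall x, l < x < r -> `|x| <= X) ->
  itg l r (edens eps f f1 q) <=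
    (eps + X ^+ 2 + 4 * (r - l) ^+ 2) * itg l r (fun x => (f1 x - q^`().[x]) ^+ 2).
Proof.
move=> lr eps0 cf cf1 df ql hX.
have cg : ctn l r (fun x => f x - q.[x]).
  by apply: ctnD => //; apply: ctnN; exact: ctn_horner.
have cg1 : ctn l r (fun x => f1 x - q^`().[x]).
  by apply: ctnD => //; apply: ctnN; exact: ctn_horner.
have dg : drv l r (fun x => f x - q.[x]) (fun x => f1 x - q^`().[x]).
  exact: (drvD df (drvN (drv_horner l r q))).
have hp := poincare (ltW lr) cg cg1 dg (_ : f l - q.[l] = 0).
have {}hp := hp ltac:(by rewrite ql subrr).
have i1 := ctn_itgbl (ctnX 2 cg); have i2 := ctn_itgbl (ctnX 2 cg1).
apply: (@le_trans _ _ (itg l r (fun x => (eps + X ^+ 2) * (f1 x - q^`().[x]) ^+ 2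
   + (f x - q.[x]) ^+ 2))).
  apply: itg_le; [exact/ctn_itgbl/ctn_edens|by apply: itgblD => //; exact: itgblZ|].
  move=> x xI; rewrite lerD2r; apply: ler_wpM2r; first exact: sqr_ge0.
  rewrite lerD2l -[x ^+ 2]real_normK ?num_real// lerXn2r// ?nnegrE ?hX//.
  exact: le_trans (hX x xI).
rewrite itgD ?itgZ//; last exact: itgblZ.
by rewrite [leRHS]mulrDl lerD2l.
Qed.

(* The constants come from |x| <= 10 |y| and r - l <= 9 H |y| for x, y in an outer
   element: 324 = 4 * 9^2 and 424 = 10^2 + 324.  They are hidden behind variables
   because numerals of this size are slow to compute with. *)
Lemma elt_est (k : nat) eps (V : nat -> R -> R) (H s sg E S l r cA cB : R) (lin : bool) :
  424 <= cA -> 324 <= cB ->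
  (0 < k)%N -> 0 < eps <= 1 -> -1 <= l -> l < r -> r <= 1 ->
  (forall j, (j <= k.+1)%N -> ctn (-1) 1 (V j)) ->
  (forall j, (j < k.+1)%N -> drv (-1) 1 (V j) (V j.+1)) ->
  0 < H -> H <= 1 -> 0 < s -> 0 < S -> 0 <= E ->
  ((r <= - s \/ s <= l) /\ forall x, l < x < r -> r - l <= 9 * H * `|x|) \/
  [/\ - s <= l, r <= s, r - l = s * H &
    (forall x, l < x < r -> r - l <= `|x|) \/ (forall x, l < x < r -> `|x| <= r - l)] ->
  (~~ lin -> [/\ s <= sg, eps <= sg ^+ 2 & sg ^+ 2 ^+ k.+1 <= E]) ->
  (forall x, -1 <= x <= 1 -> `|V 0%N x| <= S) ->
  (forall x, -1 <= x <= 1 -> (eps + x ^+ 2) * V 1%N x ^+ 2 <= S) ->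
  exists q : {poly R}, [/\ (size q <= k.+1)%N, q.[l] = V 0%N l, q.[r] = V 0%N r &
    itg l r (edens eps (V 0%N) (V 1%N) q) <=
      cA * cB ^+ k * H ^+ 2 ^+ k * itg l r (fun x =>
         (eps + x ^+ 2) ^+ k.+1 * V k.+1 x ^+ 2 + E * V k.+1 x ^+ 2) +
      (if lin then (8 * S + 24 * S ^+ 2) * (clamp s r - clamp s l) else 0)].
Proof.
move=> hA hB k0 /andP[eps0 eps1] l1 lr r1 cV dV H0 H1 s0 S0 E0 helt hlin hS0 hS1.
have cv j : (j <= k.+1)%N -> ctn l r (V j) by move=> /cV; exact: ctn_sub.
have dv j : (j < k.+1)%N -> drv l r (V j) (V j.+1) by move=> /dV; exact: drv_sub.
have xI x : l < x < r -> -1 <= x <= 1.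
  by move=> /andP[x1 x2]; rewrite (le_trans l1 (ltW x1)) (le_trans (ltW x2) r1).
have rl : 0 < r - l by rewrite subr_gt0.
pose w x := V k.+1 x ^+ 2.
have cw : ctn l r w by apply/ctnX/cv.
have w0 x : 0 <= w x by exact: sqr_ge0.
have cex m : ctn l r (fun x => (eps + x ^+ 2) ^+ m).
  by apply: ctnX; apply: ctnD; [exact: ctn_cst|exact/ctnX/ctn_id].
pose Psi x := (eps + x ^+ 2) ^+ k.+1 * w x + E * w x.
have cPsi : ctn l r Psi by apply: ctnD; apply: ctnM => //; exact: ctn_cst.
have ex0 x : 0 <= eps + x ^+ 2 by rewrite addr_ge0 ?sqr_ge0// ltW.
have Psi0 x : 0 <= Psi x.
  apply: addr_ge0; apply: mulr_ge0 => //; exact: exprn_ge0.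
have A0 : 0 <= cA by apply: le_trans hA; exact: ler0n.
have B0 : 0 <= cB by apply: le_trans hB; exact: ler0n.
have C1 : 0 <= cA * cB ^+ k * H ^+ 2 ^+ k.
  by apply: mulr_ge0; [apply: mulr_ge0 => //|]; apply: exprn_ge0 => //; exact: sqr_ge0.
have cl0 : 0 <= clamp s r - clamp s l by rewrite subr_ge0 clamp_le// ltW.
have C20 : 0 <= 8 * S + 24 * S ^+ 2.
  by rewrite addr_ge0 ?mulr_ge0 ?sqr_ge0// ltW.
have lin0 : 0 <= (if lin then (8 * S + 24 * S ^+ 2) * (clamp s r - clamp s l) else 0).
  by case: lin {hlin} => //; rewrite mulr_ge0.
have Psii : 0 <= cA * cB ^+ k * H ^+ 2 ^+ k * itg l r Psi.
  by rewrite mulr_ge0// itg_ge0.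
(* This reduces an element to a pointwise comparison of weights; [X] bounds |x| on it. *)
have taylor X : (forall x, l < x < r -> `|x| <= X) ->
    (forall x, l < x < r -> (eps + X ^+ 2 + 4 * (r - l) ^+ 2) *
      (4 * (r - l) ^+ 2) ^+ k * w x <= cA * cB ^+ k * H ^+ 2 ^+ k * Psi x) ->
    exists q : {poly R}, [/\ (size q <= k.+1)%N, q.[l] = V 0%N l, q.[r] = V 0%N r &
    itg l r (edens eps (V 0%N) (V 1%N) q) <=
      cA * cB ^+ k * H ^+ 2 ^+ k * itg l r Psi +
      (if lin then (8 * S + 24 * S ^+ 2) * (clamp s r - clamp s l) else 0)].
  move=> hX hP.
  have [|j|T sT hT] := @taylor_poly R k l r (fun j => V j.+1) (ltW lr).
  - by move=> j jk; exact: cv.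
  - by move=> jk; exact: dv.
  have [q [sq ql qr hq _]] := interp lr (cv 0%N isT) (cv 1%N isT) (dv 0%N isT) k0 sT.
  exists q; split => //.
  apply: (le_trans (edens_le lr eps0 (cv 0%N isT) (cv 1%N isT) (dv 0%N isT) ql hX)).
  set c := eps + _ + _ in hP *.
  have c0 : 0 <= c by rewrite /c; apply: addr_ge0; [apply: addr_ge0; [exact: ltW|exact: sqr_ge0]|
      apply: mulr_ge0 => //; exact: sqr_ge0].
  apply: (le_trans (ler_wpM2l c0 (le_trans hq hT))).
  apply: (@le_trans _ _ (cA * cB ^+ k * H ^+ 2 ^+ k * itg l r Psi)); last by rewrite lerDl.
  rewrite mulrA -!itgZ; [|exact: ctn_itgbl|exact: ctn_itgbl].
  by apply: itg_le hP; apply: ctn_itgbl; apply: ctnM => //; exact: ctn_cst.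
case: helt => [[_ hout]|[ls rs hE hin]].
  have H9 : 9 * H <= 9 by rewrite -[leRHS]mulr1 ler_wpM2l.
  pose X := Num.max `|l| `|r|.
  have hX x : l < x < r -> `|x| <= X by exact: norm_itv_le.
  apply: (taylor X hX) => y yI; have hy := hout y yI.
  have y0 : 0 <= `|y| by [].
  have hy9 : r - l <= 9 * `|y| by apply: le_trans hy _; exact: ler_wpM2r.
  have Xy : X <= 10 * `|y| by have := norm_end_le yI; rewrite -/X; clear - hy9; lra.
  have X0 : 0 <= X by rewrite /X le_max normr_ge0.
  have y2 : `|y| ^+ 2 = y ^+ 2 by rewrite real_normK ?num_real.
  have k1 : eps + X ^+ 2 + 4 * (r - l) ^+ 2 <= cA * (eps + y ^+ 2).
    have e1 : X ^+ 2 <= 100 * y ^+ 2 by rewrite -y2; clear - X0 y0 Xy; nra.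
    have e2 : (r - l) ^+ 2 <= 81 * y ^+ 2 by rewrite -y2; clear - rl y0 hy9; nra.
    have e3 := ler_wpM2r (ex0 y) hA; have e4 := sqr_ge0 y; clear - e1 e2 e3 e4 eps0; lra.
  have k2 : 4 * (r - l) ^+ 2 <= cB * H ^+ 2 * (eps + y ^+ 2).
    have e1 : (r - l) ^+ 2 <= (9 * H * `|y|) ^+ 2 by apply: lerXn2r; rewrite ?nnegrE ?mulr_ge0// ltW.
    have e2 : (9 * H * `|y|) ^+ 2 = 81 * H ^+ 2 * y ^+ 2 by rewrite -y2; ring.
    have e3 : 0 <= H ^+ 2 * eps by rewrite mulr_ge0 ?sqr_ge0// ltW.
    have e4 : 324 * (H ^+ 2 * (eps + y ^+ 2)) <= cB * (H ^+ 2 * (eps + y ^+ 2)).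
      by apply: ler_wpM2r => //; apply: mulr_ge0 => //; exact: sqr_ge0.
    by clear - e1 e2 e3 e4; lra.
  have q0 : 0 <= 4 * (r - l) ^+ 2 by rewrite mulr_ge0 ?sqr_ge0.
  have k3 : (4 * (r - l) ^+ 2) ^+ k <= (cB * H ^+ 2 * (eps + y ^+ 2)) ^+ k.
    by apply: lerXn2r; rewrite ?nnegrE// (le_trans q0).
  apply: (@le_trans _ _ (cA * (eps + y ^+ 2) *
    (cB * H ^+ 2 * (eps + y ^+ 2)) ^+ k * w y)).
    apply: ler_wpM2r => //; apply: ler_pM => //; last exact: exprn_ge0.
    by have := sqr_ge0 (r - l); have := sqr_ge0 X; clear - eps0; lra.
  rewrite [(cB * H ^+ 2 * (eps + y ^+ 2)) ^+ k]exprMn [(cB * H ^+ 2) ^+ k]exprMn.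
  rewrite /Psi [_ ^+ k.+1]exprS.
  rewrite (_ : cA * (eps + y ^+ 2) * _ * w y = cA * cB ^+ k * H ^+ 2 ^+ k *
    ((eps + y ^+ 2) * (eps + y ^+ 2) ^+ k * w y)); last first.
    by move: (cB ^+ k) (H ^+ 2 ^+ k) ((eps + y ^+ 2) ^+ k) => u1 u2 u3; ring.
  by apply: ler_wpM2l => //; rewrite lerDl mulr_ge0.
have hcl : clamp s r - clamp s l = r - l.
  by rewrite !clamp_id//; clear - ls rs lr; lra.
have hX x : l < x < r -> `|x| <= s.
  by move=> /andP[x1 x2]; rewrite ler_norml; clear - x1 x2 ls rs; apply/andP; split; lra.
case: lin hlin lin0 taylor => hlin _ taylor; last first.
  (* Here s, r - l and the square root of eps are all at most [sg]. The weights add up to at most 6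
     sg^2 and the Taylor factor to at most (4 H^2 sg^2)^k; [E] absorbs the power sg^(2(k+1)). *)
  have [h1 h2 h3] := hlin isT.
  apply: (taylor s hX) => y yI.
  have e1 : s ^+ 2 <= sg ^+ 2 by rewrite lerXn2r// ?nnegrE ?(ltW s0)// (le_trans (ltW s0)).
  have e2 : (r - l) ^+ 2 = s ^+ 2 * H ^+ 2 by rewrite hE exprMn.
  have e3 : H ^+ 2 <= 1 by rewrite expr_le1// ltW.
  have e4 : (r - l) ^+ 2 <= sg ^+ 2.
    by rewrite e2; apply: le_trans e1; rewrite ler_piMr// sqr_ge0.
  have k1 : eps + s ^+ 2 + 4 * (r - l) ^+ 2 <= 6 * sg ^+ 2 by clear - h2 e1 e4; lra.
  have k2 : 4 * (r - l) ^+ 2 <= 4 * H ^+ 2 * sg ^+ 2.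
    by rewrite e2 -mulrA ler_wpM2l// mulrC ler_wpM2l// sqr_ge0.
  have q0 : 0 <= 4 * (r - l) ^+ 2 by rewrite mulr_ge0 ?sqr_ge0.
  have k3 : (4 * (r - l) ^+ 2) ^+ k <= (4 * H ^+ 2 * sg ^+ 2) ^+ k.
    by apply: lerXn2r; rewrite ?nnegrE// (le_trans q0).
  apply: (@le_trans _ _ (6 * sg ^+ 2 * (4 * H ^+ 2 * sg ^+ 2) ^+ k * w y)).
    apply: ler_wpM2r => //; apply: ler_pM => //; last exact: exprn_ge0.
    by have := sqr_ge0 (r - l); have := sqr_ge0 s; clear - eps0; lra.
  rewrite [(4 * H ^+ 2 * sg ^+ 2) ^+ k]exprMn [(4 * H ^+ 2) ^+ k]exprMn.
  rewrite (_ : 6 * sg ^+ 2 * _ * w y = 6 * 4 ^+ k * H ^+ 2 ^+ k *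
    (sg ^+ 2 ^+ k.+1 * w y)); last first.
    rewrite [_ ^+ k.+1]exprS.
    by move: (4 ^+ k) (H ^+ 2 ^+ k) (sg ^+ 2 ^+ k) => u1 u2 u3; ring.
  have Hk0 : 0 <= H ^+ 2 ^+ k by rewrite exprn_ge0// sqr_ge0.
  apply: ler_pM.
  - by rewrite mulr_ge0// mulr_ge0// exprn_ge0.
  - by rewrite mulr_ge0// exprn_ge0// sqr_ge0.
  - apply: ler_wpM2r => //; apply: ler_pM; [by []|by rewrite exprn_ge0| |].
      by apply: le_trans hA; rewrite ler_nat.
    by apply: lerXn2r; rewrite ?nnegrE//; apply: le_trans hB; rewrite ler_nat.
  - rewrite /Psi; apply: (@le_trans _ _ (E * w y)); first exact: ler_wpM2r.
    by rewrite lerDr mulr_ge0// exprn_ge0.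
(* In the remaining case V k.+1 cannot be used, and q is linear. *)
have [q [sq ql qr hq hq0]] :=
  interp (T := 0) lr (cv 0%N isT) (cv 1%N isT) (dv 0%N isT) k0 ltac:(by rewrite size_poly0).
exists q; split => //; rewrite hcl.
apply: (@le_trans _ _ ((8 * S + 24 * S ^+ 2) * (r - l))); last by rewrite lerDr.
have iV := ctn_itgbl (ctnX 2 (cv 1%N isT)).
have {}hq : itg l r (fun x => (V 1%N x - q^`().[x]) ^+ 2) <=
    itg l r (fun x => V 1%N x ^+ 2).
  rewrite (@eq_itg _ l r (fun x => V 1%N x ^+ 2) (fun x => (V 1%N x - (0 : {poly R}).[x]) ^+ 2))//.
  by move=> x _; rewrite horner0 subr0.
case: hin => hin.
  (* Not adjacent to 0: the element is no longer than |y| at any of its points y, so all weights are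
     at most 8 (eps + y^2) and the bound of (eps + x^2) u'^2 suffices. *)
  pose X := Num.max `|l| `|r|.
  have hX' x : l < x < r -> `|x| <= X by exact: norm_itv_le.
  apply: (le_trans (edens_le lr eps0 (cv 0%N isT) (cv 1%N isT) (dv 0%N isT) ql hX')).
  set c := eps + _ + _.
  have c0 : 0 <= c by rewrite /c; apply: addr_ge0; [apply: addr_ge0; [exact: ltW|exact: sqr_ge0]|
      apply: mulr_ge0 => //; exact: sqr_ge0].
  apply: (le_trans (ler_wpM2l c0 hq)); rewrite -itgZ//.
  apply: (@le_trans _ _ (itg l r (fun _ => 8 * S))); last first.
    by rewrite itg_cst ?(ltW lr)// ler_wpM2r ?(ltW rl)// lerDl mulr_ge0// sqr_ge0.
  apply: itg_le; [exact: itgblZ|exact: itgbl_cst|] => y yI.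
  have hy := hin y yI; have /andP[y1 y2] := yI.
  have Xy : X <= 2 * `|y| by have := norm_end_le yI; rewrite -/X; clear - hy; lra.
  have X0 : 0 <= X by rewrite /X le_max normr_ge0.
  have yy : `|y| ^+ 2 = y ^+ 2 by rewrite real_normK ?num_real.
  have k1 : c <= 8 * (eps + y ^+ 2).
    have e1 : X ^+ 2 <= 4 * y ^+ 2 by rewrite -yy; clear - X0 Xy; nra.
    have e2 : (r - l) ^+ 2 <= y ^+ 2 by rewrite -yy lerXn2r// nnegrE// ltW.
    by rewrite /c; clear - e1 e2 eps0; lra.
  apply: (le_trans (ler_wpM2r (sqr_ge0 (V 1%N y)) k1)).
  by rewrite -mulrA ler_wpM2l// hS1// xI.
(* Adjacent to 0 the weight may be far below (r - l)^2, so [poincare] is of no use. Instead |x| <= r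
   - l bounds x d by the increment of u, and u - q is bounded by the size of u. *)
pose d := (V 0%N r - V 0%N l) / (r - l).
have [dqE qx] := hq0 erefl; rewrite -/d in dqE qx.
have lI : -1 <= l <= 1 by rewrite l1 (le_trans (ltW lr)).
have rI : -1 <= r <= 1 by rewrite r1 (le_trans l1 (ltW lr)).
have dh : `|d * (r - l)| <= 2 * S.
  rewrite /d divfK ?gt_eqF//; apply: le_trans (ler_normB _ _) _.
  by have := hS0 l lI; have := hS0 r rI; clear; lra.
have dh2 : (d * (r - l)) ^+ 2 <= 4 * S ^+ 2.
  rewrite -[_ ^+ 2]real_normK ?num_real// (_ : 4 * S ^+ 2 = (2 * S) ^+ 2); last by ring.
  by rewrite lerXn2r// ?nnegrE// mulr_ge0// ltW.
have cq1 : ctn l r (fun x => (V 1%N x - q^`().[x]) ^+ 2).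
  by apply: ctnX; apply: ctnD; [exact: cv|apply: ctnN; exact: ctn_horner].
have iq1 := ctn_itgbl cq1.
apply: (@le_trans _ _ (itg l r (fun x => eps * (V 1%N x - q^`().[x]) ^+ 2 +
   (2 * S + 24 * S ^+ 2)))).
  apply: itg_le.
  - exact/ctn_itgbl/ctn_edens/cv/isT/cv.
  - by apply: itgblD; [exact: itgblZ|exact: itgbl_cst].
  move=> x xlr; have xh := hin x xlr; have xx := xI x xlr; have /andP[x1 x2] := xlr.
  rewrite /edens mulrDl -addrA lerD2l.
  have h1 : x ^+ 2 * V 1%N x ^+ 2 <= S.
    apply: le_trans (hS1 x xx); apply: ler_wpM2r; first exact: sqr_ge0.
    by rewrite lerDr ltW.
  have h2 : (x * d) ^+ 2 <= 4 * S ^+ 2.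
    have xr2 : x ^+ 2 <= (r - l) ^+ 2.
      by rewrite -[x ^+ 2]real_normK ?num_real// lerXn2r// ?nnegrE ?(ltW rl).
    apply: le_trans dh2; rewrite [leRHS]exprMn (_ : (x * d) ^+ 2 = d ^+ 2 * x ^+ 2); last by ring.
    by apply: ler_wpM2l xr2; exact: sqr_ge0.
  have h3 : x ^+ 2 * (V 1%N x - q^`().[x]) ^+ 2 <= 2 * S + 8 * S ^+ 2.
    rewrite dqE hornerC.
    have := sqr_ge0 (x * V 1%N x + x * d); clear - h1 h2; nra.
  have h4 : `|V 0%N x - q.[x]| <= 4 * S.
    rewrite qx; apply: le_trans (ler_normB _ _) _.
    have k1 := ler_normD (V 0%N l) (d * (x - l)).
    have k2 : `|d * (x - l)| <= 2 * S.
      apply: le_trans dh; rewrite !normrM ler_wpM2l// !ger0_norm; clear - x1 x2 lr; lra.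
    by have := hS0 x xx; have := hS0 l lI; clear - k1 k2; lra.
  have h5 : (V 0%N x - q.[x]) ^+ 2 <= 16 * S ^+ 2.
    rewrite -[_ ^+ 2]real_normK ?num_real// (_ : 16 * S ^+ 2 = (4 * S) ^+ 2); last by ring.
    by rewrite lerXn2r// ?nnegrE// mulr_ge0// ltW.
  by clear - h3 h5; lra.
rewrite itgD; [|exact: itgblZ|exact: itgbl_cst].
rewrite itg_cst ?(ltW lr)// itgZ//.
have : eps * itg l r (fun x => (V 1%N x - q^`().[x]) ^+ 2) <= S * (r - l).
  apply: (le_trans (ler_wpM2l (ltW eps0) hq)); rewrite -itgZ// -(itg_cst S (ltW lr)).
  apply: itg_le; [exact: itgblZ|exact: itgbl_cst|] => x xlr.
  apply: le_trans (hS1 x (xI x xlr)); apply: ler_wpM2r; first exact: sqr_ge0.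
  by rewrite lerDl sqr_ge0.
have := mulr_ge0 (ltW S0) (ltW rl); clear; nra.
Qed.

End Element.

(** * The Galerkin error *)

Section Galerkin.
Context {R : realType}.
Implicit Types (t : nat -> R) (n : nat) (f g v w : R -> R).

Definition pwpoly t n v : Prop := forall i, (i < n)%N ->
  exists p : {poly R}, forall x, t i < x < t i.+1 -> v x = p.[x].

Lemma pwpoly_drv t n v i : pwpoly t n v -> (i < n)%N ->
  drv (t i) (t i.+1) v (derive1 v).
Proof.
move=> h /h[p hp]; have d1 : drv (t i) (t i.+1) v (horner p^`()).
  by apply: (drv_ext (f := horner p)) (drv_horner _ _ p) => x /hp ->.
by apply: (eq_drv d1) => x xI; have [_ ->] := drv_derive1 d1 xI.
Qed.

Lemma pwpoly_derive1 t n v i (p : {poly R}) : pwpoly t n v -> (i < n)%N ->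
  (forall x, t i < x < t i.+1 -> v x = p.[x]) ->
  forall x, t i < x < t i.+1 -> derive1 v x = p^`().[x].
Proof.
move=> h ni hp; have d1 : drv (t i) (t i.+1) v (horner p^`()).
  by apply: (drv_ext (f := horner p)) (drv_horner _ _ p) => x /hp ->.
by move=> x xI; have [_ ->] := drv_derive1 d1 xI.
Qed.

Lemma pwpoly_pwc t n v : pwpoly t n v -> pwc t n v /\ pwc t n (derive1 v).
Proof.
move=> h; split => i ni; have [p hp] := h i ni.
  by exists (horner p); split; [exact: ctn_horner|exact: hp].
exists (horner p^`()); split; first exact: ctn_horner.
exact: pwpoly_derive1 h ni hp.
Qed.

Lemma pwpolyB t n v w : pwpoly t n v -> pwpoly t n w ->
  pwpoly t n (fun x => v x - w x).
Proof.
move=> hv hw i ni; have [p hp] := hv i ni; have [q hq] := hw i ni.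
by exists (p - q) => x xI; rewrite hp// hq// hornerD hornerN.
Qed.

Lemma derive1B_elt t n v dv w i : (i < n)%N -> drv (t i) (t i.+1) v dv ->
  pwpoly t n w -> forall x, t i < x < t i.+1 ->
  derive1 (fun x => v x - w x) x = dv x - derive1 w x.
Proof.
move=> ni dv' hw x xI.
by have [_ ->] := drv_derive1 (drvD dv' (drvN (pwpoly_drv hw ni))) xI.
Qed.

Lemma pwcN t n f : pwc t n f -> pwc t n (fun x => - f x).
Proof.
move=> hf i ni; have [f' [cf ef]] := hf i ni.
exists (fun x => - f' x); split; first exact: ctnN.
by move=> x xi; rewrite ef.
Qed.

Lemma itg_pw_le t n f g : nodes t n -> pwc t n f -> pwc t n g ->
  (forall i, (i < n)%N -> forall x, t i < x < t i.+1 -> f x <= g x) ->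
  itg (t 0%N) (t n) f <= itg (t 0%N) (t n) g.
Proof.
move=> ht hf hg h; rewrite (itg_sum ht (pwc_itgbl ht hf)) (itg_sum ht (pwc_itgbl ht hg)).
apply: ler_sum => -[i ni] _ /=.
have [f' [cf ef]] := hf i ni; have [g' [cg eg]] := hg i ni.
rewrite (eq_itg ef) (eq_itg eg); apply: itg_le; try exact: ctn_itgbl.
by move=> x xI; rewrite -ef// -eg//; exact: (h i ni).
Qed.

(** Here e = uN - uI and y = u - uI, with derivatives [de] and [z]. The second bracket has integral
    0 by Galerkin orthogonality and integration by parts. The convection term a z e enters through
    a^2 <= C0 x^2, hence the weight x^2 on z. The right-hand side minus the left-hand side is a sum
    of nonnegative terms. *)
Lemma galerkin_pointwise (eps gam a a1 c z y de e C0 x : R) :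
  0 < eps -> 0 < gam -> gam <= c - 2^-1 * a1 ->
  a ^+ 2 <= C0 * x ^+ 2 -> c ^+ 2 <= C0 ->
  2^-1 * (eps * de ^+ 2) + 2^-1 * (gam * e ^+ 2) <=
  (1 + C0 / gam) * ((eps + x ^+ 2) * z ^+ 2 + y ^+ 2) +
  (eps * (de - z) * de + a * (de - z) * e + c * (e - y) * e
   - (2^-1 * a1 * e ^+ 2 + a * e * de)).
Proof.
move=> eps0 gam0 h1 h2 h3.
have C00 : 0 <= C0 by apply: le_trans h3; exact: sqr_ge0.
have k1 : 0 <= eps * (de - z) ^+ 2 by rewrite mulr_ge0 ?sqr_ge0// ltW.
have k2 : 0 <= (2^-1 * gam * e - a * z) ^+ 2 / gam by rewrite divr_ge0 ?sqr_ge0// ltW.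
have k3 : 0 <= (2^-1 * gam * e - c * y) ^+ 2 / gam by rewrite divr_ge0 ?sqr_ge0// ltW.
have k4 : 0 <= (c - 2^-1 * a1 - gam) * e ^+ 2.
  by rewrite mulr_ge0 ?sqr_ge0// subr_ge0.
have k5 : 0 <= (C0 * x ^+ 2 - a ^+ 2) * z ^+ 2 / gam.
  by rewrite divr_ge0 ?(ltW gam0)// mulr_ge0 ?sqr_ge0// subr_ge0.
have k6 : 0 <= (C0 - c ^+ 2) * y ^+ 2 / gam.
  by rewrite divr_ge0 ?(ltW gam0)// mulr_ge0 ?sqr_ge0// subr_ge0.
have k7 : 0 <= C0 / gam * (eps * z ^+ 2).
  apply: mulr_ge0; first by rewrite divr_ge0// ltW.
  by apply: mulr_ge0; [exact: ltW|exact: sqr_ge0].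
have k8 : 0 <= x ^+ 2 * z ^+ 2 by apply: mulr_ge0; exact: sqr_ge0.
have k9 : 0 <= y ^+ 2 by exact: sqr_ge0.
have k10 : 0 <= eps * z ^+ 2 by apply: mulr_ge0; [exact: ltW|exact: sqr_ge0].
rewrite -subr_ge0; set E := (X in 0 <= X).
have -> : E = 2^-1 * (eps * (de - z) ^+ 2) + (2^-1 * gam * e - a * z) ^+ 2 / gam +
   (2^-1 * gam * e - c * y) ^+ 2 / gam + (c - 2^-1 * a1 - gam) * e ^+ 2 +
   (C0 * x ^+ 2 - a ^+ 2) * z ^+ 2 / gam + (C0 - c ^+ 2) * y ^+ 2 / gam +
   C0 / gam * (eps * z ^+ 2) + x ^+ 2 * z ^+ 2 + y ^+ 2 + 2^-1 * (eps * z ^+ 2).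
  by rewrite /E; field; rewrite gt_eqF.
by rewrite !addr_ge0// mulr_ge0// invr_ge0.
Qed.

(** A quasi-optimality estimate in the manner of Cea: [uI] may be any continuous piecewise
    polynomial vanishing at the end points for which uN - uI is an admissible test function. *)
Lemma galerkin_error (A C F V : nat -> R -> R) (m : nat) (eps gam C0 : R) t n
    (uN uI : R -> R) :
  nodes t n -> t 0%N = -1 -> t n = 1 ->
  jet m A -> jet m C -> jet m F -> (2 <= m)%N -> sol A C F m eps V ->
  0 < gam -> (forall x, -1 < x < 1 -> gam <= C 0%N x - 2^-1 * A 1%N x) ->
  (forall x, -1 <= x <= 1 -> A 0%N x ^+ 2 <= C0 * x ^+ 2) ->
  (forall x, -1 <= x <= 1 -> C 0%N x ^+ 2 <= C0) ->
  ctn (-1) 1 uN -> pwpoly t n uN -> ctn (-1) 1 uI -> pwpoly t n uI ->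
  uN (-1) = 0 -> uN 1 = 0 -> uI (-1) = 0 -> uI 1 = 0 ->
  bilin eps (A 0%N) (C 0%N) uN (fun x => uN x - uI x) =
    L2ip (F 0%N) (fun x => uN x - uI x) ->
  eps_norm eps (fun x => V 0%N x - uN x) ^+ 2 <=
  (2 + 4 * (1 + gam^-1) * (1 + C0 / gam)) *
  itg (-1) 1 (fun x => (eps + x ^+ 2) * (V 1%N x - derive1 uI x) ^+ 2 +
     (V 0%N x - uI x) ^+ 2).
Proof.
move=> ht t0 tn jA jC jF m2 hs gam0 hco hC0 hC1 cN pN cI pI N1 N2 I1 I2 hG.
have [e01 jV eV V1 V2] := hs; have /andP[eps0 _] := e01.
have m0 : (0 < m)%N by exact: ltnW.
pose e x := uN x - uI x; pose de := derive1 e.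
have pe : pwpoly t n e by exact: pwpolyB.
have [qN qdN] := pwpoly_pwc pN; have [qI qdI] := pwpoly_pwc pI.
have [qe qde] := pwpoly_pwc pe.
have pc g : ctn (-1) 1 g -> pwc t n g by rewrite -t0 -tn; exact: ctn_pwc.
have qV j : (j <= m)%N -> pwc t n (V j) by move=> jm; apply/pc/jV.1.
have qA j : (j <= m)%N -> pwc t n (A j) by move=> jm; apply/pc/jA.1.
have qC j : (j <= m)%N -> pwc t n (C j) by move=> jm; apply/pc/jC.1.
have qF j : (j <= m)%N -> pwc t n (F j) by move=> jm; apply/pc/jF.1.
have qk (r : R) : pwc t n (fun=> r) by exact: pwc_cst.
have qx : pwc t n (fun x => x) by apply/pc/ctn_id.
have ib g : pwc t n g -> itgbl (-1) 1 g by rewrite -t0 -tn; exact: pwc_itgbl.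
have le1 g1 g2 : pwc t n g1 -> pwc t n g2 -> (forall i, (i < n)%N ->
    forall x, t i < x < t i.+1 -> g1 x <= g2 x) -> itg (-1) 1 g1 <= itg (-1) 1 g2.
  by rewrite -t0 -tn; exact: itg_pw_le.
have xI i x : (i < n)%N -> t i < x < t i.+1 -> -1 < x < 1.
  move=> ni /andP[x1 x2]; rewrite -t0 -tn; apply/andP; split.
    by apply: le_lt_trans x1; exact: nodes_le ht (leq0n i) (ltnW ni).
  by apply: (lt_le_trans x2); exact: nodes_le ht ni (leqnn n).
have dV i j : (i < n)%N -> (j < m)%N -> drv (t i) (t i.+1) (V j) (V j.+1).
  move=> ni jm; have := jV.2 j jm; rewrite -t0 -tn; apply: drv_sub.
    exact: nodes_le ht (leq0n i) (ltnW ni).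
  exact: nodes_le ht ni (leqnn n).
have dA i j : (i < n)%N -> (j < m)%N -> drv (t i) (t i.+1) (A j) (A j.+1).
  move=> ni jm; have := jA.2 j jm; rewrite -t0 -tn; apply: drv_sub.
    exact: nodes_le ht (leq0n i) (ltnW ni).
  exact: nodes_le ht ni (leqnn n).
have deE i x : (i < n)%N -> t i < x < t i.+1 -> de x = derive1 uN x - derive1 uI x.
  by move=> ni xi; exact: (derive1B_elt ni (pwpoly_drv pN ni) pI xi).
have ce : ctn (-1) 1 e by apply: ctnD => //; exact: ctnN.
(* G1, G2 and G3 have integral 0: they are the Galerkin equation and the derivatives
   of eps V' e and a e^2 / 2. *)
pose G1 x := eps * derive1 uN x * de x + A 0%N x * derive1 uN x * e x
  + C 0%N x * uN x * e x - F 0%N x * e x.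
have qG1 : pwc t n G1.
  apply: pwcD; last by apply: pwcN; apply: pwcM => //; exact: qF.
  apply: pwcD; first apply: pwcD; apply: pwcM => //.
  - exact: pwcM.
  - by apply: pwcM => //; exact: qA.
  - by apply: pwcM => //; exact: qC.
have G10 : itg (-1) 1 G1 = 0.
  rewrite /G1 itgD; last 2 first.
  - apply: ib; apply: pwcD; first apply: pwcD; apply: pwcM => //.
    + exact: pwcM.
    + by apply: pwcM => //; exact: qA.
    + by apply: pwcM => //; exact: qC.
  - by apply: ib; apply: pwcN; apply: pwcM => //; exact: qF.
  rewrite itgD; last 2 first.
  - apply: ib; apply: pwcD; apply: pwcM => //.
    + exact: pwcM.
    + by apply: pwcM => //; exact: qA.
  - by apply: ib; apply: pwcM => //; apply: pwcM => //; exact: qC.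
  rewrite itgD; last 2 first.
  - by apply: ib; apply: pwcM => //; exact: pwcM.
  - by apply: ib; apply: pwcM => //; apply: pwcM => //; exact: qA.
  have := hG; rewrite /bilin /L2ip -!/(itg _ _ _) => ->.
  have -> : itg (-1) 1 (fun x => - (F 0%N x * e x)) =
      - itg (-1) 1 (fun x => F 0%N x * e x).
    rewrite -[RHS]mulN1r -itgZ; last by apply: ib; apply: pwcM => //; exact: qF.
    by apply: eq_itg => x _; rewrite mulN1r.
  by rewrite subrr.
pose G2 x := eps * (V 2 x * e x + V 1%N x * de x).
have qG2 : pwc t n G2.
  by apply: pwcM => //; apply: pwcD; apply: pwcM => //; exact: qV.
have G20 : itg (-1) 1 G2 = 0.
  have := @ftc_pw R t n (fun x => eps * (V 1%N x * e x)) G2 ht.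
  rewrite t0 tn => -> //.
  - by rewrite /e N1 N2 I1 I2 subrr !mulr0 subrr.
  - by apply: ctnM; [exact: ctn_cst|apply: ctnM => //; exact: jV.1].
  - move=> i ni; apply: drvZ; apply: drvM; last exact: pwpoly_drv pe ni.
    exact: dV.
pose G3 x := 2^-1 * A 1%N x * e x ^+ 2 + A 0%N x * e x * de x.
have qG3 : pwc t n G3.
  apply: pwcD; apply: pwcM => //.
  - by apply: pwcM => //; exact: qA.
  - exact: pwcX.
  - by apply: pwcM => //; exact: qA.
have G30 : itg (-1) 1 G3 = 0.
  have := @ftc_pw R t n (fun x => 2^-1 * A 0%N x * e x ^+ 2) G3 ht.
  rewrite t0 tn => -> //.
  - by rewrite /e N1 N2 I1 I2 subrr expr0n/= !mulr0 subrr.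
  - apply: ctnM; last exact: ctnX.
    by apply: ctnM; [exact: ctn_cst|exact: jA.1].
  - move=> i ni; have d1 := drvM (drvZ 2^-1 (dA i 0%N ni m0)) (drvX 2 (pwpoly_drv pe ni)).
    by apply: (eq_drv d1) => x _; rewrite /G3 /de /=; field.
pose z x := V 1%N x - derive1 uI x; pose y x := V 0%N x - uI x.
have qz : pwc t n z by apply: pwcD; [exact: qV|exact: pwcN].
have qy : pwc t n y by apply: pwcD; [exact: qV|exact: pwcN].
pose D x := (eps + x ^+ 2) * z x ^+ 2 + y x ^+ 2.
have qD : pwc t n D.
  apply: pwcD; last exact: pwcX.
  by apply: pwcM; [apply: pwcD => //; exact: pwcX|exact: pwcX].
have D0 : 0 <= itg (-1) 1 D.
  apply: itg_ge0 => x _; apply: addr_ge0; last exact: sqr_ge0.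
  by apply: mulr_ge0; [apply: addr_ge0; [exact: ltW|]|]; exact: sqr_ge0.
pose Ee x := 2^-1 * (eps * de x ^+ 2) + 2^-1 * (gam * e x ^+ 2).
have qEe : pwc t n Ee.
  by apply: pwcD; apply: pwcM => //; apply: pwcM => //; exact: pwcX.
(* [K1] is the factor of [galerkin_pointwise]. The squared error is at most twice the sum of the
   squares for u - uI and uN - uI, and the latter is at most 2 (1 + 1 / gam) times [Ee]; hence
   [K2]. *)
pose K1 := 1 + C0 / gam; pose K2 := 4 * (1 + gam^-1).
have hE : itg (-1) 1 Ee <= K1 * itg (-1) 1 D.
  have q4 : pwc t n (fun x => G1 x + - 1 * (G2 x + G3 x)).
    by apply: pwcD => //; apply: pwcM => //; exact: pwcD.
  have q5 : pwc t n (fun x => K1 * D x) by exact: pwcM.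
  have h : itg (-1) 1 Ee <=
      itg (-1) 1 (fun x => K1 * D x + (G1 x + - 1 * (G2 x + G3 x))).
    apply: le1 => //; first exact: (pwcD q5 q4).
    move=> i ni x xi; have xx := xI i x ni xi; have /andP[x1 x2] := xx.
    have xx' : -1 <= x <= 1 by rewrite !ltW.
    have k := @galerkin_pointwise eps gam (A 0%N x) (A 1%N x) (C 0%N x) (z x) (y x)
      (de x) (e x) C0 x eps0 gam0 (hco x xx) (hC0 x xx') (hC1 x xx').
    apply: (le_trans k); rewrite lerD2l le_eqVlt; apply/orP; left; apply/eqP.
    have eqn := eV 0%N m2 x xx'; rewrite !jmul0 in eqn.
    have e2 : G2 x = (A 0%N x * V 1%N x + C 0%N x * V 0%N x - F 0%N x) * e x
        + eps * V 1%N x * de x by rewrite /G2 -eqn; ring.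
    by rewrite e2 /G1 /G3 (deE i x ni xi) /z /y /e; ring.
  have i23 := ib _ (pwcD qG2 qG3).
  have e1 : itg (-1) 1 (fun x => G1 x + - 1 * (G2 x + G3 x)) = 0.
    rewrite (itgD (ib _ qG1) (itgblZ (- 1) i23)) (itgZ (- 1) i23).
    by rewrite (itgD (ib _ qG2) (ib _ qG3)) G10 G20 G30 !(addr0, mulr0).
  by move: h; rewrite (itgD (ib _ q5) (ib _ q4)) e1 addr0 (itgZ K1 (ib _ qD)).
rewrite /eps_norm sqr_sqrtr; last first.
  by rewrite addr_ge0 ?sqr_ge0// mulr_ge0 ?sqr_ge0// ltW.
have L2sq v : L2norm v ^+ 2 = itg (-1) 1 (fun x => v x * v x).
  rewrite /L2norm sqr_sqrtr//; apply: itg_ge0 => x _.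
  by rewrite -expr2 sqr_ge0.
rewrite !L2sq.
pose w x := V 0%N x - uN x; pose dw := derive1 w.
have dwE i x : (i < n)%N -> t i < x < t i.+1 -> dw x = V 1%N x - derive1 uN x.
  by move=> ni xi; exact: (derive1B_elt ni (dV i 0%N ni m0) pN xi).
have qdw : pwc t n dw.
  apply: (@eq_pwc _ t n (fun x => V 1%N x - derive1 uN x)).
    by move=> i ni x xi; rewrite (dwE i x ni xi).
  by apply: pwcD; [exact: qV|exact: pwcN].
have qw : pwc t n w by apply: pwcD; [exact: qV|exact: pwcN].
rewrite -/w -/dw -itgZ; last by apply: ib; exact: pwcM.
rewrite -itgD; last 2 first.
- by apply: ib; apply: pwcM => //; exact: pwcM.
- by apply: ib; exact: pwcM.
have h2 : itg (-1) 1 (fun x => eps * (dw x * dw x) + w x * w x) <=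
    itg (-1) 1 (fun x => 2 * D x + K2 * Ee x).
  apply: le1.
  - by apply: pwcD; [apply: pwcM => //; exact: pwcM|exact: pwcM].
  - by apply: pwcD; exact: pwcM.
  move=> i ni x xi.
  have -> : dw x = z x - de x by rewrite (dwE i x ni xi) (deE i x ni xi) /z; ring.
  have -> : w x = y x - e x by rewrite /w /y /e; ring.
  rewrite /D /Ee /K2; move: (z x) (y x) (de x) (e x) => z0 y0 de0 e0.
  clear - eps0 gam0.
  have k1 : 0 <= eps * (z0 + de0) ^+ 2 by rewrite mulr_ge0 ?sqr_ge0// ltW.
  have k2 := sqr_ge0 (y0 + e0).
  have k3 : 0 <= x ^+ 2 * z0 ^+ 2 by apply: mulr_ge0; exact: sqr_ge0.
  have k4 : 0 <= gam^-1 * (eps * de0 ^+ 2).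
    apply: mulr_ge0; first by rewrite invr_ge0 ltW.
    by apply: mulr_ge0; [exact: ltW|exact: sqr_ge0].
  have k5 : 0 <= gam * e0 ^+ 2 by apply: mulr_ge0; [exact: ltW|exact: sqr_ge0].
  rewrite -subr_ge0; set E := (X in 0 <= X).
  have -> : E = eps * (z0 + de0) ^+ 2 + (y0 + e0) ^+ 2 + 2 * (x ^+ 2 * z0 ^+ 2) +
     2 * (gam^-1 * (eps * de0 ^+ 2)) + 2 * (gam * e0 ^+ 2).
    by rewrite /E; field; rewrite gt_eqF.
  have k3' := mulr_ge0 (ler0n R 2) k3; have k4' := mulr_ge0 (ler0n R 2) k4.
  have k5' := mulr_ge0 (ler0n R 2) k5.
  by rewrite !addr_ge0.
apply: (le_trans h2).
rewrite itgD; [|apply: ib; exact: pwcM|apply: ib; exact: pwcM].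
rewrite !itgZ; [|exact: ib|exact: ib].
rewrite [leRHS](_ : _ = 2 * itg (-1) 1 D + K2 * (K1 * itg (-1) 1 D)); last first.
  by rewrite mulrA -mulrDl.
rewrite lerD2l; apply: ler_wpM2l => //.
by rewrite /K2 mulr_ge0// addr_ge0// invr_ge0 ltW.
Qed.

End Galerkin.

(** * Parameters and the global interpolation error *)

Section Assembly.
Context {R : realType}.

Lemma exponent_choice (bb cc lam : R) (k : nat) : 0 < bb -> 0 < cc -> 0 < lam ->
  lam < cc / bb \/ (lam = cc / bb /\ cc / bb \isn't a Num.int) -> lam < k.+1%:R ->
  exists n Lam, [/\ (n <= k)%N, n%:R <= Lam, Lam < n.+1%:R, lam <= Lam &
    [/\ 2^-1 < Lam, Lam * bb < cc + 2^-1 * bb & n%:R * bb < cc]].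
Proof.
move=> b0 c0 l0 hl lk; have q0 : 0 < cc / bb by rewrite divr_gt0.
(* For lam <= 1/2 the exponent is raised above 1/2, as Lam = lam is not allowed. *)
have [l2|l2] := ltP 2^-1 lam; last first.
  (* The bound 1/4 keeps Lam below 1, so that n = 0; half of cc / bb keeps Lam below cc / bb +
     1/2. *)
  pose mu := Num.min (cc / bb / 2) 4^-1.
  have mu1 : mu <= cc / bb / 2 by rewrite /mu ge_min lexx.
  have mu2 : mu <= 4^-1 by rewrite /mu ge_min lexx orbT.
  have mu0 : 0 < mu by rewrite /mu lt_min; apply/andP; split; lra.
  exists 0%N, (2^-1 + mu); split; rewrite ?mul0r//; try lra.
  split => //; try lra.
  have : mu * bb <= cc / bb / 2 * bb by rewrite ler_wpM2r// ltW.
  rewrite (_ : cc / bb / 2 * bb = cc / 2); last by field; rewrite gt_eqF.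
  lra.
exists (Num.truncn lam), lam.
have /andP[t1 t2] := truncn_itv (ltW l0).
have le1 : lam <= cc / bb by case: hl => [/ltW|[->]].
(* Strictness is the point: if lam = cc / bb, then equality would make cc / bb an integer. *)
have nlt : (Num.truncn lam)%:R < cc / bb.
  case: hl => [|[e ni]]; first exact: le_lt_trans t1.
  rewrite lt_neqAle (le_trans t1 le1) andbT; apply/negP => /eqP e2.
  by move/negP: ni; apply; rewrite -e2 intr_nat.
split => //.
  by rewrite -ltnS -(ltr_nat R); exact: le_lt_trans lk.
split => //.
  have : lam * bb <= cc by rewrite -ler_pdivlMr.
  lra.
by rewrite -ltr_pdivlMr.
Qed.

(** The rounding in K makes 10^-K at most sigma, and sigma >= N^-(2k+1) limits K to a multiple of ln
    N. The exponent of eps in sigma is designed so that sigma^(2(k+1)) is the factor in the last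
    bound of [apriori]. *)
Lemma sigma_facts (k N : nat) (lam eps : R) : 0 < eps <= 1 -> (1 < N)%N ->
  0 < lam -> lam < k.+1%:R ->
  let K := mesh_K k lam eps N in let sg := mesh_sigma k lam eps N in
  [/\ 10 ^- K <= sg,
     K.+1%:R <= (2 / ln 2 + (2 * k + 1)%:R / ln 10) * ln (N%:R : R) &
     (eps `^ ((1 - lam / k.+1%:R) / 2) < N%:R ^- (2 * k + 1) ->
        sg = N%:R ^- (2 * k + 1)) /\
     (~~ (eps `^ ((1 - lam / k.+1%:R) / 2) < N%:R ^- (2 * k + 1)) ->
        eps <= sg ^+ 2 /\ sg ^+ 2 ^+ k.+1 = expR ((k.+1%:R - lam) * ln eps))].
Proof.
move=> /andP[eps0 eps1] N1 l0 lk K sg.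
have N0 : 0 < N%:R :> R by rewrite ltr0n ltnW.
have k0 : 0 < k.+1%:R :> R by rewrite ltr0n.
have lk0 : 0 <= lam / k.+1%:R <= 1.
  by rewrite divr_ge0 ?(ltW l0) ?(ltW k0)//= ler_pdivrMr// mul1r ltW.
have /andP[lk1 lk2] := lk0.
have le0 : ln eps <= 0 by rewrite -ln1 ler_ln ?posrE.
have l10 : 0 < ln 10 :> R by rewrite ln_gt0// ltr1n.
have l2 : 0 < ln 2 :> R by rewrite ln_gt0// ltr1n.
have Np : 0 < N%:R ^- (2 * k + 1) :> R by rewrite invr_gt0 exprn_gt0.
have sgN : N%:R ^- (2 * k + 1) <= sg by rewrite /sg /mesh_sigma le_max lexx orbT.
have sg0 : 0 < sg by exact: lt_le_trans sgN.
have lN : ln 2 <= ln N%:R :> R by rewrite ler_ln ?posrE// ler_nat.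
have hsg : - ln sg <= (2 * k + 1)%:R * ln N%:R.
  have : ln (N%:R ^- (2 * k + 1)) <= ln sg by rewrite ler_ln ?posrE.
  by rewrite lnV ?posrE ?exprn_gt0// lnXn// -mulr_natl; lra.
have sg1 : sg <= 1.
  rewrite /sg /mesh_sigma ge_max; apply/andP; split.
    rewrite /powR gt_eqF// -[leRHS]expR0 ler_expR mulr_ge0_le0//.
    by rewrite divr_ge0// subr_ge0.
  by rewrite invf_le1 ?exprn_gt0// exprn_ege1// ler1n ltnW.
have lsg : ln sg <= 0 by rewrite -ln1 ler_ln ?posrE.
have arg0 : 0 <= 1 - ln sg / ln 10.
  by rewrite subr_ge0 (le_trans _ ler01)// ler_pdivrMr// mul0r.
have /andP[K1 K2] := truncn_itv arg0; rewrite -/(mesh_K k lam eps N) -/K in K1 K2.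
split.
- have h : - (ln sg / ln 10) < K%:R by move: K2; rewrite -natr1; lra.
  rewrite -[leRHS]lnK ?posrE// -[leLHS]lnK ?posrE ?invr_gt0 ?exprn_gt0//.
  have h' : - ln sg < K%:R * ln 10 by rewrite -ltr_pdivrMr// mulNr.
  rewrite ler_expR lnV ?posrE ?exprn_gt0// lnXn// lerNl -[_ *+ K]mulr_natl.
  exact: ltW.
(* The constant 2 is at most (2 / ln 2) ln N because N >= 2. *)
- have h1 : K.+1%:R <= 2 - ln sg / ln 10 by rewrite -natr1; lra.
  apply: (le_trans h1); rewrite mulrDl; apply: lerD.
    by rewrite mulrAC -mulrA ler_peMr// ler_pdivlMr// mul1r.
  by rewrite mulrAC -mulNr ler_pM2r ?invr_gt0.
- split => h; rewrite /sg /mesh_sigma; first by rewrite max_r// ltW.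
  rewrite max_l; last by rewrite leNgt.
  rewrite /powR gt_eqF//; set th := _ / 2.
  have e2 : expR (th * ln eps) ^+ 2 = expR ((1 - lam / k.+1%:R) * ln eps).
    by rewrite -expRM_natl; congr expR; rewrite /th; field; rewrite gt_eqF.
  rewrite e2; split.
    rewrite -{1}[eps]lnK ?posrE// ler_expR.
    by rewrite mulrBl mul1r lerBrDr gerDl mulr_ge0_le0.
  by rewrite -expRM_natl; congr expR; field; rewrite nat1r gt_eqF.
Qed.

(** Summing over the elements costs nothing for the integrals. With linear interpolation, the inner
    elements contribute a multiple of their total length 2 * 10^-K, which [hlin'] and 1 / N <= (K +
    1) / N make at most twice the required power. *)
Lemma interpolation_error (k K N : nat) (eps S E sg cA cB : R) (V : nat -> R -> R)
  (lin : bool) : 424 <= cA -> 324 <= cB -> (0 < k)%N -> (0 < N)%N ->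
  (K.+1 %| N)%N -> 0 < eps <= 1 -> jet k.+1 V ->
  V 0%N (-1) = 0 -> V 0%N 1 = 0 ->
  0 < S -> 0 <= E ->
  (~~ lin -> [/\ 10 ^- K <= sg, eps <= sg ^+ 2 & sg ^+ 2 ^+ k.+1 <= E]) ->
  (lin -> 10 ^- K <= N%:R ^- (2 * k) :> R) ->
  (forall x, -1 <= x <= 1 -> `|V 0%N x| <= S) ->
  (forall x, -1 <= x <= 1 -> (eps + x ^+ 2) * V 1%N x ^+ 2 <= S) ->
  itg (-1) 1 (fun x => (eps + x ^+ 2) ^+ k.+1 * V k.+1 x ^+ 2) <= S ->
  itg (-1) 1 (fun x => E * V k.+1 x ^+ 2) <= S ->
  exists w, fe_space k K N w /\
    itg (-1) 1 (fun x => (eps + x ^+ 2) * (V 1%N x - derive1 w x) ^+ 2 +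
      (V 0%N x - w x) ^+ 2) <=
    (cA * cB ^+ k * (2 * S) + 2 * (8 * S + 24 * S ^+ 2)) *
      (K.+1%:R / N%:R) ^+ 2 ^+ k.
Proof.
move=> hA hB k0 N0 KN eps01 jV V1 V2 S0 E0 hlin hlin' hS0 hS1 hS2 hS3.
set H := K.+1%:R / N%:R; pose s : R := 10 ^- K.
have H0 : 0 < H := H_gt0 N0 KN; have H1 : H <= 1 := H_le1 N0 KN.
have s0 : 0 < s := s_gt0 K.
pose t := @node R K N; have ht : nodes t (N + N) by exact: nodes_node.
have t0 : t 0%N = -1 by exact: node0.
have tn : t (N + N)%N = 1 by exact: node_last.
have tI i : (i <= N + N)%N -> -1 <= t i <= 1.
  move=> iN; rewrite -t0 -tn; apply/andP; split; first exact: nodes_le ht _ iN.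
  exact: nodes_le ht iN _.
pose Psi x := (eps + x ^+ 2) ^+ k.+1 * V k.+1 x ^+ 2 + E * V k.+1 x ^+ 2.
pose C2 := 8 * S + 24 * S ^+ 2.
have hq i : exists q : {poly R}, (i < N + N)%N ->
    [/\ (size q <= k.+1)%N, q.[t i] = V 0%N (t i), q.[t i.+1] = V 0%N (t i.+1) &
     itg (t i) (t i.+1) (edens eps (V 0%N) (V 1%N) q) <=
      cA * cB ^+ k * H ^+ 2 ^+ k * itg (t i) (t i.+1) Psi +
      (if lin then C2 * (clamp s (t i.+1) - clamp s (t i)) else 0)].
  have [iN|] := boolP (i < N + N)%N; last by exists 0.
  have [lr helt] := node_elt (R := R) N0 KN iN.
  have /andP[l1 _] := tI i (ltnW iN); have /andP[_ r1] := tI i.+1 iN.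
  have [q hq] := elt_est hA hB k0 eps01 l1 lr r1 jV.1 jV.2 H0 H1 s0 S0 E0 helt
    hlin hS0 hS1.
  by exists q.
have [q {}hq] := choice hq.
have NN0 : (0 < N + N)%N by rewrite addn_gt0 N0.
have NN : (N + N = (N + N).-1.+1)%N by rewrite prednK.
have [|||w [cw ew]] := @glue R t (N + N).-1 (fun i => horner (q i)).
- by rewrite -NN.
- by move=> i _; exact: ctn_horner.
- move=> i iN; have iN1 : (i.+1 < N + N)%N by rewrite NN ltnS.
  by have [_ _ -> _] := hq i (ltnW iN1); have [_ -> _ _] := hq i.+1 iN1.
rewrite -NN t0 tn in cw.
have wE i x : (i < N + N)%N -> t i <= x <= t i.+1 -> w x = (q i).[x].
  by move=> iN; apply: ew; rewrite -ltnS -NN.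
have pw : pwpoly t (N + N) w.
  by move=> i iN; exists (q i) => x /andP[x1 x2]; apply: wE => //; rewrite !ltW.
have w1 : w (-1) = 0.
  rewrite -t0 (wE 0%N)//; last by rewrite lexx ltW// ht.
  by have [_ -> _ _] := hq 0%N NN0; rewrite t0.
have w2 : w 1 = 0.
  have NN1 : ((N + N).-1 < N + N)%N by rewrite {2}NN.
  rewrite -tn {1}NN (wE (N + N).-1)//; last by rewrite lexx andbT ltW// ht.
  by have [_ _ -> _] := hq _ NN1; rewrite -NN tn.
exists w; split.
  apply: elt_fe => // i iN; exists (q i); first by have [] := hq i iN.
  by move=> x /andP[x1 x2]; apply: wE => //; rewrite !ltW.
pose D x := (eps + x ^+ 2) * (V 1%N x - derive1 w x) ^+ 2 + (V 0%N x - w x) ^+ 2.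
have DE i x : (i < N + N)%N -> t i < x < t i.+1 -> D x = edens eps (V 0%N) (V 1%N) (q i) x.
  move=> iN xi; have hx y : t i < y < t i.+1 -> w y = (q i).[y].
    by move=> /andP[y1 y2]; apply: wE => //; rewrite !ltW.
  by rewrite /D (pwpoly_derive1 pw iN hx xi) (hx x xi).
have cV i j : (i < N + N)%N -> (j <= k.+1)%N -> ctn (t i) (t i.+1) (V j).
  move=> iN jk; have /andP[l1 _] := tI i (ltnW iN); have /andP[_ r1] := tI i.+1 iN.
  exact: ctn_sub l1 r1 (jV.1 j jk).
have qD : pwc t (N + N) D.
  move=> i iN; exists (edens eps (V 0%N) (V 1%N) (q i)); split.
    by apply: ctn_edens; exact: cV.
  by move=> x; exact: DE.
have cPsi : ctn (-1) 1 Psi.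
  have c2 : ctn (-1) 1 (fun x => V k.+1 x ^+ 2) by apply/ctnX/jV.1.
  apply: ctnD; apply: ctnM => //; last exact: ctn_cst.
  by apply: ctnX; apply: ctnD; [exact: ctn_cst|exact/ctnX/ctn_id].
have iPsi := ctn_itgbl cPsi.
have sumP : \sum_(i < N + N) itg (t i) (t i.+1) Psi = itg (-1) 1 Psi.
  by rewrite -t0 -tn -itg_sum// t0 tn.
have sumD : \sum_(i < N + N) itg (t i) (t i.+1) D = itg (-1) 1 D.
  by rewrite -t0 -tn -itg_sum//; exact: pwc_itgbl.
have sumC : \sum_(i < N + N) (clamp s (t i.+1) - clamp s (t i)) <= 2 * s.
  rewrite -(big_mkord xpredT (fun i => clamp s (t i.+1) - clamp s (t i))).
  rewrite telescope_sumr//.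
  have /andP[_ h1] := clamp_itv (t (N + N)%N) (ltW s0).
  by have /andP[h2 _] := clamp_itv (t 0%N) (ltW s0); lra.
rewrite -/D -sumD.
have C20 : 0 <= C2 by rewrite addr_ge0 ?mulr_ge0 ?sqr_ge0// ltW.
pose C1 := cA * cB ^+ k * H ^+ 2 ^+ k.
have Hk0 : 0 <= H ^+ 2 ^+ k by apply: exprn_ge0; exact: sqr_ge0.
have AB0 : 0 <= cA * cB ^+ k.
  by rewrite mulr_ge0 ?exprn_ge0 ?(le_trans _ hA) ?(le_trans _ hB) ?ler0n.
have C10 : 0 <= C1 by exact: mulr_ge0.
apply: (@le_trans _ _ (C1 * itg (-1) 1 Psi + (if lin then C2 * (2 * s) else 0))).
  apply: (@le_trans _ _ (\sum_(i < N + N) (C1 * itg (t i) (t i.+1) Psi +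
      (if lin then C2 * (clamp s (t i.+1) - clamp s (t i)) else 0)))).
    apply: ler_sum => -[i iN] _ /=.
    by rewrite (eq_itg (fun x => @DE i x iN)); have [] := hq i iN.
  rewrite big_split/= -mulr_sumr sumP lerD2l.
  case: (lin); last by rewrite big1.
  by rewrite -mulr_sumr ler_wpM2l.
have hPsi : itg (-1) 1 Psi <= 2 * S.
  rewrite itgD; first by rewrite mulrDl !mul1r lerD.
    apply/ctn_itgbl/ctnM; last exact/ctnX/jV.1.
    by apply: ctnX; apply: ctnD; [exact: ctn_cst|exact/ctnX/ctn_id].
  by apply/ctn_itgbl/ctnM; [exact: ctn_cst|exact/ctnX/jV.1].
have h1 := ler_wpM2l C10 hPsi.
have h2 : (if lin then C2 * (2 * s) else 0) <= C2 * 2 * H ^+ 2 ^+ k.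
  case: (lin) hlin' => [/(_ isT) hs|_]; last by rewrite !mulr_ge0.
  rewrite mulrA ler_wpM2l ?mulr_ge0//; apply: (le_trans hs).
  rewrite -exprVn exprM; apply: lerXn2r; rewrite ?nnegrE ?sqr_ge0//.
  by apply: lerXn2r; rewrite ?nnegrE ?invr_ge0 ?(ltW H0)//; exact: H_geV.
apply: (le_trans (lerD h1 h2)); rewrite /C1 /C2 le_eqVlt; apply/orP; left; apply/eqP.
by ring.
Qed.

End Assembly.

Theorem theorem3p3 (R : realType) (k : nat) (hk : (1 <= k)%N) :
  exists m N0 : nat,
  forall (a b c f : R -> R) (gamma lam : R),
    smooth_upto m a -> smooth_upto m c -> smooth_upto m f ->
    turning_point_data a b c gamma ->
    admissible_lambda a c k lam ->
  exists C C' : R, [/\ 0 < C, 0 < C' &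
  forall (eps : R) (N : nat) (u uN : R -> R),
    let K := mesh_K k lam eps N in
    0 < eps <= 1 ->
    (0 < N)%N -> (N0 <= N)%N -> (K.+1 %| N)%N ->
    bvp_solution eps a c f u ->
    galerkin_solution k K N eps a c f uN ->
    eps_norm eps (fun x => u x - uN x) <= C * (K.+1%:R / N%:R) ^+ k /\
    C * (K.+1%:R / N%:R) ^+ k <= C' * (ln (N%:R : R) / N%:R) ^+ k].
Proof.
(* The equation is differentiated k + 1 times, and its jets are taken up to order k + 3; N >= 2
   allows constants to be absorbed into ln N. *)
exists k.+3, 2%N => a b c f gamma lam sa sc sf.
move=> [[cb0 hb] hc c00 gamma0 hgam] [lam0 hlam lamk].
have [A [jA eA]] := smooth_jet sa; have [Cc [jC eC]] := smooth_jet sc.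
have [F [jF eF]] := smooth_jet sf.
have cb : ctn (-1) 1 b by split.
have Ab x : -1 <= x <= 1 -> A 0%N x = - x * b x by move=> /hb[]; rewrite eA.
have b0 x : -1 <= x <= 1 -> 0 < b x by move=> /hb[].
have a1E x : -1 < x < 1 -> derive1 a x = A 1%N x.
  by move=> xI; have [_] := drv_derive1 (jA.2 0%N (ltn0Sn _)) xI; rewrite eA.
have I0 : (-1 : R) < (0 : R) < 1 by rewrite ltrN10 ltr01.
have I0' : (-1 : R) <= (0 : R) <= 1 by rewrite lerN10 ler01.
have coer x : -1 < x < 1 -> gamma <= Cc 0%N x - 2^-1 * A 1%N x.
  by move=> xI; rewrite -a1E// eC; exact: hgam.
have bb0 := b0 0 I0'.
have lbE : lambda_bar a c = c 0 / b 0.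
  by rewrite /lambda_bar a1E// (A1_0 jA cb Ab)// normrN gtr0_norm.
have [n [Lam [nk nL Ln lL [L2 Lb nb]]]] :
    exists n Lam, [/\ (n <= k)%N, n%:R <= Lam, Lam < n.+1%:R, lam <= Lam &
    [/\ 2^-1 < Lam, Lam * b 0 < c 0 + 2^-1 * b 0 & n%:R * b 0 < c 0]].
  by apply: exponent_choice lamk => //; rewrite -lbE.
rewrite -eC in Lb nb.
have [S S0 hS] := apriori jA jC jF cb Ab b0 gamma0 coer hk nk nL Ln L2 Lb nb lL.
have [Mb Mb0 hMb] := ctn_bounded cb.
have [Mc Mc0 hMc] := ctn_bounded (jC.1 0%N isT).
pose C0 := Mb ^+ 2 + Mc ^+ 2.
have hC0 x : -1 <= x <= 1 -> A 0%N x ^+ 2 <= C0 * x ^+ 2.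
  move=> xI; rewrite Ab// exprMn sqrrN mulrC ler_wpM2r ?sqr_ge0//.
  rewrite -[b x ^+ 2]real_normK ?num_real// /C0.
  apply: (@le_trans _ _ (Mb ^+ 2)); last by rewrite lerDl sqr_ge0.
  by rewrite lerXn2r// ?nnegrE// hMb.
have hC1 x : -1 <= x <= 1 -> Cc 0%N x ^+ 2 <= C0.
  move=> xI; rewrite -[Cc _ _ ^+ 2]real_normK ?num_real// /C0.
  apply: (@le_trans _ _ (Mc ^+ 2)); last by rewrite lerDr sqr_ge0.
  by rewrite lerXn2r// ?nnegrE// hMc.
have C00 : 0 <= C0 by rewrite addr_ge0 ?sqr_ge0.
pose Cq := 2 + 4 * (1 + gamma^-1) * (1 + C0 / gamma).
have [cA hA] : exists cA : R, 424 <= cA by exists 424.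
have [cB hB] : exists cB : R, 324 <= cB by exists 324.
have A0 : 0 <= cA by apply: le_trans hA; exact: ler0n.
have B0 : 0 <= cB by apply: le_trans hB; exact: ler0n.
pose Cs := cA * cB ^+ k * (2 * S) + 2 * (8 * S + 24 * S ^+ 2).
have g0 : 0 <= 1 + gamma^-1 by rewrite addr_ge0// invr_ge0 ltW.
have g1 : 0 <= 1 + C0 / gamma by rewrite addr_ge0// divr_ge0// ltW.
have Cq0 : 0 <= Cq by apply: addr_ge0 => //; apply: mulr_ge0 => //; apply: mulr_ge0.
have Cs0 : 0 <= Cs.
  have S2 := sqr_ge0 S; have S1 := ltW S0.
  apply: addr_ge0; apply: mulr_ge0; rewrite ?mulr_ge0 ?exprn_ge0//.
  by apply: addr_ge0; apply: mulr_ge0.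
(* The summand 1 gives C >= 1, hence Cq * Cs <= C^2, and the squared estimate needs no root of a
   constant. *)
pose C := 1 + Cq * Cs.
have C1 : 1 <= C by rewrite lerDl mulr_ge0.
pose Cl : R := 2 / ln 2 + (2 * k + 1)%:R / ln 10.
have l2 : 0 < ln 2 :> R by rewrite ln_gt0// ltr1n.
have l10 : 0 < ln 10 :> R by rewrite ln_gt0// ltr1n.
have Cl0 : 0 < Cl by rewrite ltr_pwDl ?divr_gt0// divr_ge0// ltW.
have Cgt0 : 0 < C by exact: lt_le_trans C1.
exists C, (C * Cl ^+ k); split => //; first by rewrite mulr_gt0// exprn_gt0.
move=> eps N u uN K eps01 N0 N2 KN hu [fN hN].
have [h1 h2 [h3 h4]] := sigma_facts eps01 N2 lam0 lamk.
have NR : 0 < N%:R :> R by rewrite ltr0n.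
set H := K.+1%:R / N%:R.
have H0 : 0 < H := H_gt0 N0 KN.
split; last first.
  rewrite -[leRHS]mulrA ler_wpM2l ?(ltW Cgt0)// -exprMn.
  apply: lerXn2r; rewrite ?nnegrE ?(ltW H0)//.
    rewrite mulr_ge0 ?(ltW Cl0)// divr_ge0 ?(ltW NR)//.
    by rewrite ln_ge0// ler1n.
  by rewrite mulrA ler_pM2r ?invr_gt0.
have hu' : bvp_solution eps (A 0%N) (Cc 0%N) (F 0%N) u by rewrite eA eC eF.
have k3 : (k.+1 <= k.+3)%N by rewrite ltnW.
have [V [sV V0]] := sol_exists (jet_leq k3 jA) (jet_leq k3 jC) (jet_leq k3 jF) eps01 hu'.
have [_ jV _ V1 V2] := sV.
have [S1 S2 S3 S4] := hS eps V sV.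
set lin := eps `^ _ < _ in h3 h4.
set E := expR _ in h4 S4.
have hnl : ~~ lin -> [/\ 10 ^- K <= mesh_sigma k lam eps N,
    eps <= mesh_sigma k lam eps N ^+ 2 & mesh_sigma k lam eps N ^+ 2 ^+ k.+1 <= E].
  by move=> /h4[e1 e2]; split => //; rewrite e2.
have hl : lin -> 10 ^- K <= N%:R ^- (2 * k) :> R.
  (* In this case sigma = N^-(2k+1); one power of N is given away. *)
  move=> /h3 e; rewrite e in h1; apply: (le_trans h1).
  rewrite lef_pV2 ?posrE ?exprn_gt0// ler_eXn2l ?ltr1n// ?leq_addr//.
have [w [fw ew]] := interpolation_error hA hB hk N0 KN eps01 (jet_leq k3 jV) V1 V2 S0
  (expR_ge0 _) hnl hl S1 S2 S3 S4.
have [cw w1 w2 _] := fw; have [cN N1 NN1 _] := fN.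
have pfe (v : R -> R) : fe_space k K N v -> pwpoly (node K N) (N + N) v.
  by move=> fv i iN; have [p _ hp] := fe_elt N0 KN fv iN; exists p.
have cB' (v : R -> R) : fe_space k K N v -> ctn (-1) 1 v by move=> [cv _ _ _]; split.
have fe_e : fe_space k K N (fun x => uN x - w x).
  apply: elt_fe => //.
  - by apply: ctnD; [exact: cB'|apply: ctnN; exact: cB'].
  - by rewrite N1 w1 subrr.
  - by rewrite NN1 w2 subrr.
  move=> i iN; have [p sp hp] := fe_elt N0 KN fN iN; have [q sq hq] := fe_elt N0 KN fw iN.
  exists (p - q); last by move=> x xI; rewrite hp// hq// hornerD hornerN.
  by rewrite (leq_trans (size_polyD _ _))// size_polyN geq_max sp.
have hG := hN _ fe_e; rewrite -eA -eC -eF in hG.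
have := galerkin_error (nodes_node N0 KN) (node0 N0 KN) (node_last N0 KN)
  jA jC jF isT sV gamma0 coer hC0 hC1 (cB' _ fN) (pfe _ fN) (cB' _ fw) (pfe _ fw)
  N1 NN1 w1 w2 hG.
rewrite V0 -/Cq => hfin.
have {}hfin : eps_norm eps (fun x => u x - uN x) ^+ 2 <= (C * H ^+ k) ^+ 2.
  apply: (le_trans hfin); rewrite -V0; apply: (le_trans (ler_wpM2l Cq0 ew)).
  have -> : (C * H ^+ k) ^+ 2 = C ^+ 2 * H ^+ 2 ^+ k by rewrite exprMn -!exprM mulnC.
  rewrite -/Cs mulrA -/H; apply: ler_wpM2r.
    by apply: exprn_ge0; exact: sqr_ge0.
  have p0 : 0 <= Cq * Cs by exact: mulr_ge0.
  rewrite expr2; apply: (@le_trans _ _ (1 * C)); last by rewrite ler_wpM2r// ltW.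
  by rewrite mul1r lerDr.
have CH0 : 0 <= C * H ^+ k by rewrite mulr_ge0 ?exprn_ge0 ?(ltW Cgt0) ?(ltW H0).
by move: hfin; rewrite ler_pXn2r ?nnegrE ?sqrtr_ge0.
Qed.
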